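(* Let $1<s\le\infty$ and let $\Omega\in L_s(S^{n-1})$ be $A_t$-homogeneous of degree zero. Let $0<\alpha<\gamma$, $1<p<\frac{\gamma}{\alpha}$, $s'<p<q<\infty$, $0<\lambda<\gamma-\alpha p$ and $\frac1p-\frac1q=\frac{\alpha}{\gamma-\lambda}$. Then the operators $M^P_{\Omega,\alpha}$ and $I^P_{\Omega,\alpha}$ are bounded from $M_{p,\lambda,P}$ to $M_{q,\lambda,P}$.
   Context: Setting. $n\ge2$; $P$ is a real $n\times n$ matrix all of whose eigenvalues have positive real part; $A_t=t^P$ ($t>0$); $\gamma=\operatorname{tr}P$. $\rho$ is a quasi-distance associated with $P$: $\rho(A_tx)=t\rho(x)$ for $t>0$, $x\in\mathbb{R}^n$; $\rho(0)=0$, $\rho(x-y)=\rho(y-x)\ge0$ (with $\rho(x)>0$ for $x\neq0$), and $\rho(x-y)\le k(\rho(x-z)+\rho(y-z))$ for a constant $k$; and $dx=\rho^{\gamma-1}d\sigma(w)\,d\rho$ where $\rho=\rho(x)$, $w=A_{\rho^{-1}}x$ and $d\sigma(w)$ is a measure on $\{w:\rho(w)=1\}$. The ellipsoid is $E(x,r)=\{y\in\mathbb{R}^n:\rho(x-y)<r\}$; its Lebesgue measure is $|E(x,r)|=\upsilon_\rho r^\gamma$, where $\upsilon_\rho$ is the volume of the unit ellipsoid. $S^{n-1}$ is the Euclidean unit sphere with normalized surface measure. A real-valued measurable $\Omega$ on $\mathbb{R}^n$ is $A_t$-homogeneous of degree zero if $\Omega(A_tx)=\Omega(x)$ for all $t>0$,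 $x\in\mathbb{R}^n$; $\Omega\in L_s(S^{n-1})$ refers to its restriction to the sphere. $s'=s/(s-1)$ (with $\infty'=1$). Operators: $M^P_{\Omega,\alpha}f(x)=\sup_{t>0}|E(x,t)|^{-1+\frac{\alpha}{\gamma}}\int_{E(x,t)}|\Omega(x-y)||f(y)|\,dy$ and $I^P_{\Omega,\alpha}f(x)=\int_{\mathbb{R}^n}\frac{\Omega(x-y)}{\rho(x-y)^{\gamma-\alpha}}f(y)\,dy$. Parabolic Morrey space $M_{p,\lambda,P}$: the functions $f\in L_p^{loc}(\mathbb{R}^n)$ with $\|f\|_{M_{p,\lambda,P}}=\sup_{x\in\mathbb{R}^n}\sup_{r>0}r^{-\lambda/p}\|f\|_{L_p(E(x,r))}<\infty$. Bounded means the norm inequality $\|Tf\|\le C\|f\|$ with $C$ independent of $f$. *)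

(* Defs.v *)
From HB Require Import structures.
From mathcomp Require Import all_boot all_order all_algebra.
From mathcomp Require Import complex.
From mathcomp Require Import all_classical all_reals all_analysis.
From mathcomp Require Import measurable_realfun.

Set Implicit Arguments.
Unset Strict Implicit.
Unset Printing Implicit Defensive.
Import Order.TTheory GRing.Theory Num.Theory.
Import numFieldNormedType.Exports.
Local Open Scope classical_set_scope.
Local Open Scope ring_scope.

(* R^n is represented by the type 'cV[R]_n of column vectors.                 *)

(* The sigma-algebra on matrices generated by the coordinates; for real       *)
(* coefficients this is the Borel sigma-algebra.                              *)
Definition measure_matrix_display : measure_display -> measure_display.
Proof. exact. Qed.

Section measurable_matrix.
Context {d} {T : sigmaRingType d}.
Variables m n : nat.

Let coords : 'I_m * 'I_n -> 'M[T]_(m, n) -> T := fun ij M => M ij.1 ij.2.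

Definition mx_measurable : set (set 'M[T]_(m, n)) :=
  <<s [set A | exists ij B, measurable B /\ A = coords ij @^-1` B] >>.

Let mx_set0 : mx_measurable set0.
Proof. exact: sigma_algebra0. Qed.

Let mx_setC A : mx_measurable A -> mx_measurable (~` A).
Proof. exact: sigma_algebraC. Qed.

Let mx_bigcup (F : _^nat) :
  (forall i, mx_measurable (F i)) -> mx_measurable (\bigcup_i (F i)).
Proof. exact: sigma_algebra_bigcup. Qed.

HB.instance Definition _ := @isMeasurable.Build (measure_matrix_display d)
  'M[T]_(m, n) mx_measurable mx_set0 mx_setC mx_bigcup.

End measurable_matrix.

Lemma measurable_coord d (T : sigmaRingType d) m n i j :
  measurable_fun setT (fun M : 'M[T]_(m, n) => M i j).
Proof.
move=> _ B mB; rewrite setTI; apply: sub_sigma_algebra.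
by exists (i, j), B.
Qed.

Lemma measurable_fun_mxP d d' (S : measurableType d) (T : measurableType d')
    m n (f : S -> 'M[T]_(m, n)) :
  measurable_fun setT f <->
  forall i j, measurable_fun setT (fun x => f x i j).
Proof.
split=> [mf i j|mf].
  apply: (@measurableT_comp _ _ _ _ _ _ (fun M : 'M[T]_(m, n) => M i j)) => //.
  exact: measurable_coord.
move=> _ /= Y mY; rewrite setTI.
have : mx_measurable Y by [].
have sF : sigma_algebra setT [set A | measurable (f @^-1` A)].
  split => /=.
  - by rewrite preimage_set0.
  - by move=> A mA; rewrite setTD preimage_setC; exact: measurableC.
  - by move=> F mF; rewrite preimage_bigcup; exact: bigcup_measurable.
move=> /(_ [set A | measurable (f @^-1` A)]); apply; split => // A /=.
move=> [[i j] [B [mB ->]]].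
by have := mf i j measurableT B mB; rewrite setTI.
Qed.

Section sigma_finite_pack.
Context d (T : measurableType d) (R : realType).
Variables (mu : {measure set T -> \bar R}) (mu_sf : sigma_finite setT mu).

Let nu : set T -> \bar R := mu.
Let nu0 : nu set0 = 0%E. Proof. exact: measure0. Qed.
Let nu_ge0 A : (0 <= nu A)%E. Proof. exact: measure_ge0. Qed.
Let nu_additive : semi_sigma_additive nu.
Proof. exact: measure_semi_sigma_additive. Qed.
HB.instance Definition _ := isMeasure.Build _ _ R nu nu0 nu_ge0 nu_additive.
HB.instance Definition _ := @Measure_isSigmaFinite.Build _ _ R nu mu_sf.

Lemma sigma_finite_pack : {nu : {sigma_finite_measure set T -> \bar R} |
  nu = mu :> (set T -> \bar R)}.
Proof. by exists nu. Qed.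

End sigma_finite_pack.

Section lebesgue.
Variable R : realType.

Definition cons_cv n (x : measurableTypeR R * 'cV[R]_n) : 'cV[R]_n.+1 :=
  col_mx (x.1%:M : 'cV[R]_1) x.2.

(* n-dimensional Lebesgue measure, as an iterated product *)
Fixpoint lebesgue_cv n : set 'cV[R]_n -> \bar R :=
  match n return set 'cV[R]_n -> \bar R with
  | 0 => dirac (0 : 'cV[R]_0)
  | k.+1 => pushforward (@lebesgue_measure R \x @lebesgue_cv k)%E (@cons_cv k)
  end.

Lemma cons_cvE n x (i : 'I_n.+1) :
  cons_cv x i ord0 = if unlift ord0 i is Some j then x.2 j ord0 else x.1.
Proof.
rewrite /cons_cv mxE; case: unliftP => [j ->|->]; case: splitP => k //=.
- by rewrite ord1.
- by rewrite /bump /= !add1n => -[jk]; congr (x.2 _ _); exact: val_inj.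
- by move=> _; rewrite ord1 mxE.
Qed.

Lemma measurable_cons_cv n : measurable_fun setT (@cons_cv n).
Proof.
apply/measurable_fun_mxP => i j; rewrite ord1.
under eq_fun do rewrite cons_cvE.
case: (unlift ord0 i) => [k|]; last exact: measurable_fst.
apply: (@measurableT_comp _ _ _ _ _ _ (fun M : 'cV[R]_n => M k ord0)) => //.
exact: measurable_coord.
Qed.

Definition box n (a b : 'cV[R]_n) : set 'cV[R]_n :=
  [set x | forall i, x i ord0 \in `]a i ord0, b i ord0]].

Lemma measurable_box n (a b : 'cV[R]_n) : measurable (box a b).
Proof.
rewrite (_ : box a b = \bigcap_(i in [set: 'I_n])
    [set x : 'cV[R]_n | x i ord0 \in `]a i ord0, b i ord0]]); last first.
  by apply/seteqP; split => x /= + i => /(_ i) //; apply.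
apply: fin_bigcap_measurable => // i _.
have mI : measurable ([set` `]a i ord0, b i ord0]] : set (measurableTypeR R)).
  exact: measurable_itv.
have := @measurable_coord _ (measurableTypeR R) n 1 i ord0 measurableT _ mI.
by rewrite setTI.
Qed.

Lemma preimage_cons_box n (a b : 'cV[R]_n.+1) :
  @cons_cv n @^-1` box a b =
  [set` `]a ord0 ord0, b ord0 ord0]] `*`
  box (\col_i a (lift ord0 i) ord0) (\col_i b (lift ord0 i) ord0).
Proof.
apply/seteqP; split => -[x v] /=.
  move=> xv; split => [|i] /=.
    by have := xv ord0; rewrite cons_cvE unlift_none.
  by have := xv (lift ord0 i); rewrite cons_cvE liftK !mxE.
move=> [/= x0 vi] i; rewrite cons_cvE.
by case: unliftP => [j ->|->] //=; have := vi j; rewrite !mxE.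
Qed.

Lemma lebesgue_cv_subproof n :
  {mu : {sigma_finite_measure set 'cV[R]_n -> \bar R} |
    mu = @lebesgue_cv n :> (set 'cV[R]_n -> \bar R) &
    forall a b, mu (box a b) =
      (\prod_(i < n) lebesgue_measure [set` `]a i ord0, b i ord0]])%E}.
Proof.
elim: n => [|n [mu muE mubox]].
  exists (dirac (0 : 'cV[R]_0)) => // a b /=.
  by rewrite big_ord0 diracE mem_set// => -[].
pose m1 : {measure set (measurableTypeR R * 'cV[R]_n) -> \bar R} :=
  (@lebesgue_measure R \x mu)%E.
have mc := @measurable_cons_cv n.
pose nu := pushforward m1 (@cons_cv n).
have nubox a b : nu (box a b) =
    (\prod_(i < n.+1) lebesgue_measure [set` `]a i ord0, b i ord0]])%E.
  rewrite /nu /pushforward preimage_cons_box /m1/= product_measure1E//;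
    last exact: measurable_box.
  rewrite big_ord_recl mubox; congr (_ * _)%E.
  by apply: eq_bigr => i _; rewrite !mxE.
have nu_sf : sigma_finite setT nu.
  exists (fun k => box (\col_i (- k%:R)) (\col_i k%:R)).
    apply/esym; rewrite -subTset => x _.
    pose M := \sum_i `|x i ord0|.
    have [k Mk] : exists k : nat, M < k%:R.
      by exists (Num.truncn M).+1; exact: truncnS_gt.
    exists k => // i; rewrite !mxE in_itv/=.
    have xk : `|x i ord0| < k%:R.
      apply: le_lt_trans Mk; rewrite /M (bigD1 i)//= lerDl.
      exact: sumr_ge0.
    by move: xk; rewrite ltr_norml => /andP[-> /ltW].
  move=> k; split; first exact: measurable_box.
  rewrite nubox ltey_eq; apply/orP; left.
  apply: (big_ind (fun x => x \is a fin_num)) => //.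
    by move=> x y xf yf; exact: fin_numM.
  move=> i _; rewrite lebesgue_measure_itv/=.
  by case: ifP => // _; rewrite -EFinD.
have [nuF nuFE] := sigma_finite_pack (mu :=
  measure_function_pushforward__canonical__measure_function_Measure m1 mc)
  nu_sf.
exists nuF => [|a b]; last by rewrite nuFE; exact: nubox.
by rewrite nuFE /= /m1 /= muE.
Qed.

Let lebesgue_cv0 n : @lebesgue_cv n set0 = 0%E.
Proof. by have [mu <- _] := lebesgue_cv_subproof n. Qed.

Let lebesgue_cv_ge0 n A : (0 <= @lebesgue_cv n A)%E.
Proof. by have [mu <- _] := lebesgue_cv_subproof n; exact: measure_ge0. Qed.

Let lebesgue_cv_additive n : semi_sigma_additive (@lebesgue_cv n).
Proof.
have [mu <- _] := lebesgue_cv_subproof n.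
exact: measure_semi_sigma_additive.
Qed.

HB.instance Definition _ n := isMeasure.Build _ _ R (@lebesgue_cv n)
  (lebesgue_cv0 n) (@lebesgue_cv_ge0 n) (@lebesgue_cv_additive n).

Let lebesgue_cv_sigmafinite n : sigma_finite setT (@lebesgue_cv n).
Proof.
by have [mu <- _] := lebesgue_cv_subproof n; exact: sigma_finiteT.
Qed.

HB.instance Definition _ n := @Measure_isSigmaFinite.Build _ _ R
  (@lebesgue_cv n) (@lebesgue_cv_sigmafinite n).

Lemma lebesgue_cv_box n (a b : 'cV[R]_n) : lebesgue_cv (box a b) =
  (\prod_(i < n) lebesgue_measure [set` `]a i ord0, b i ord0]])%E.
Proof. by have [mu <- ->] := lebesgue_cv_subproof n. Qed.

End lebesgue.

(* Measurability with respect to the completion of mu: for the Lebesgue       *)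
(* measure, this is Lebesgue (rather than Borel) measurability.               *)
Definition ae_measurable d d' (T : measurableType d) (U : measurableType d')
    (R : realType) (mu : {measure set T -> \bar R}) (f : T -> U) : Prop :=
  exists2 g : T -> U, measurable_fun setT g & {ae mu, forall x, f x = g x}.

Section sphere.
Variables (R : realType) (n : nat).
Implicit Types x : 'cV[R]_n.

Definition enorm x : R := Num.sqrt (\sum_(i < n) x i ord0 ^+ 2).

Definition unit_ball : set 'cV[R]_n := [set x | enorm x < 1].

Definition radial x : 'cV[R]_n := (enorm x)^-1 *: x.

(* The normalized surface measure of the Euclidean unit sphere, seen as a     *)
(* measure on R^n carried by the sphere: the measure of A is the proportion   *)
(* of the unit ball filled by the cone {r x | 0 < r < 1, x in A}.             *)
Definition surface_measure (A : set 'cV[R]_n) : \bar R :=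
  ((fine (lebesgue_cv unit_ball))^-1%:E *
   lebesgue_cv (radial @^-1` A `&` unit_ball))%E.

Lemma measurable_enorm : measurable_fun setT enorm.
Proof.
apply: (measurableT_comp (f := @Num.sqrt R)).
  by apply: continuous_measurable_fun; exact: sqrt_continuous.
apply: measurable_sum => i; apply: measurable_funX.
exact: (@measurable_coord _ (measurableTypeR R) n 1 i ord0).
Qed.

Lemma measurable_unit_ball : measurable unit_ball.
Proof.
have E : enorm @^-1` `]-oo, 1[ = unit_ball.
  by apply/seteqP; split => x; rewrite /= in_itv.
have := measurable_enorm measurableT (measurable_itv `]-oo, 1[).
by rewrite setTI E.
Qed.

Lemma measurable_radial : measurable_fun setT radial.
Proof.
apply/measurable_fun_mxP => i j; rewrite ord1.
under eq_fun do rewrite mxE.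
apply: measurable_funM; last first.
  exact: (@measurable_coord _ (measurableTypeR R) n 1 i ord0).
under eq_fun do rewrite -powR_inv1 ?sqrtr_ge0//.
apply: (measurableT_comp (f := @powR R ^~ (-1))); first exact: measurable_powR.
exact: measurable_enorm.
Qed.

Let c_ge0 : 0 <= (fine (lebesgue_cv unit_ball))^-1.
Proof. by rewrite invr_ge0 fine_ge0. Qed.

Let sigma : {measure set 'cV[R]_n -> \bar R} :=
  mscale (NngNum c_ge0) (measure_function_pushforward__canonical__measure_function_Measure
    (mrestr (@lebesgue_cv R n) measurable_unit_ball) measurable_radial).

Let surface_measureE : surface_measure = sigma.
Proof. by []. Qed.

Let surface_measure0 : surface_measure set0 = 0%E.
Proof. by rewrite surface_measureE measure0. Qed.

Let surface_measure_ge0 A : (0 <= surface_measure A)%E.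
Proof. by rewrite surface_measureE; exact: measure_ge0. Qed.

Let surface_measure_additive : semi_sigma_additive surface_measure.
Proof. by rewrite surface_measureE; exact: measure_semi_sigma_additive. Qed.

HB.instance Definition _ := isMeasure.Build _ _ R surface_measure
  surface_measure0 surface_measure_ge0 surface_measure_additive.

End sphere.

Section dilations.
Variables (R : realType) (n : nat) (P : 'M[R]_n).

Definition eigenvalues_Re_gt0 : Prop :=
  forall z : R[i], eigenvalue (map_mx (fun x : R => x%:C%C) P) z ->
  0 < complex.Re z.

Definition expmx (M : 'M[R]_n) : 'M[R]_n :=
  lim (series (fun k : nat => k`!%:R^-1 *: M ^+ k) @ \oo).

(* A_t = t ^ P = exp ((ln t) P), for 0 < t *)
Definition dil (t : R) : 'M[R]_n := expmx (ln t *: P).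

(* dx = r^(gamma - 1) dsigma(w) dr in the coordinates r = rho x and           *)
(* w = A_(1/r) x, i.e., x = A_r w. The measure sigma on {rho = 1} is given as *)
(* a Borel measure on R^n, of which only the restriction to {rho = 1} is used. *)
Definition polar_decomposition (rho : 'cV[R]_n -> R) : Prop :=
  exists sigma : {measure set 'cV[R]_n -> \bar R},
  forall f : 'cV[R]_n -> \bar R, measurable_fun setT f ->
    (forall x, 0 <= f x)%E ->
  (\int[@lebesgue_cv R n]_x f x =
   \int[lebesgue_measure]_(r in `]0%R, +oo[)
     ((r `^ (\tr P - 1))%:E *
      \int[sigma]_(w in [set w | rho w = 1%R]) f (dil r *m w)))%E.

(* Borel measurability of rho is implicit in the use of the measure of its    *)
(* balls and of polar coordinates.                                            *)
Record quasi_distance (rho : 'cV[R]_n -> R) : Prop := QuasiDistance {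
  rho_measurable : measurable_fun setT rho ;
  rho_dil : forall t x, 0 < t -> rho (dil t *m x) = t * rho x ;
  rho0 : rho 0 = 0 ;
  rho_gt0 : forall x, x != 0 -> 0 < rho x ;
  rho_sym : forall x y, rho (x - y) = rho (y - x) ;
  rho_triangle : exists k : R,
    forall x y z, rho (x - y) <= k * (rho (x - z) + rho (y - z)) ;
  rho_polar : polar_decomposition rho
}.

Definition homogeneous0 (Omega : 'cV[R]_n -> R) : Prop :=
  forall t x, 0 < t -> Omega (dil t *m x) = Omega x.

End dilations.

Definition Lsphere (R : realType) (n : nat) (s : \bar R)
    (Omega : 'cV[R]_n -> R) : Prop :=
  ae_measurable (@surface_measure R n) Omega /\
  ('N[@surface_measure R n]_s[EFin \o Omega] < +oo)%E.

Section morrey.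
Local Open Scope ereal_scope.
Variables (R : realType) (n : nat) (rho : 'cV[R]_n -> R).
Local Notation mu := (@lebesgue_cv R n).
Implicit Types (f : 'cV[R]_n -> \bar R) (x : 'cV[R]_n).

Definition ellipsoid x (r : R) : set 'cV[R]_n :=
  [set y | (rho (x - y)%R < r)%R].

Definition Lp_norm_on (p : R) (D : set 'cV[R]_n) f : \bar R :=
  'N[mu]_p%:E[f \_ D].

Definition Lp_loc (p : R) f : Prop :=
  ae_measurable mu f /\
  forall K : set 'cV[R]_n, compact K -> Lp_norm_on p K f < +oo.

Definition morrey_norm (p lam : R) f : \bar R :=
  ereal_sup [set (xr.2 `^ (- lam / p))%:E *
                 Lp_norm_on p (ellipsoid xr.1 xr.2) f
            | xr in [set xr : 'cV[R]_n * R | (0 < xr.2)%R]].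

Definition morrey (p lam : R) f : Prop :=
  Lp_loc p f /\ morrey_norm p lam f < +oo.

Definition morrey_bounded (p q lam : R)
    (T : ('cV[R]_n -> \bar R) -> 'cV[R]_n -> \bar R) : Prop :=
  exists C : R, forall f, morrey p lam f ->
    morrey q lam (T f) /\ morrey_norm q lam (T f) <= C%:E * morrey_norm p lam f.

Variables (P : 'M[R]_n) (Omega : 'cV[R]_n -> R) (alpha : R).

Definition maximal_op f x : \bar R :=
  ereal_sup [set mu (ellipsoid x t) `^ (- 1 + alpha / \tr P) *
                 \int[mu]_(y in ellipsoid x t) (`|Omega (x - y)|%:E * `|f y|)
            | t in [set t : R | (0 < t)%R]].

(* Where the integral of the positive and of the negative part are both       *)
(* infinite, the value is -oo; membership of the result in a Morrey space     *)
(* thus entails absolute convergence of the integral for almost every x.      *)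
Definition integral_op f x : \bar R :=
  \int[mu]_y ((Omega (x - y) / rho (x - y) `^ (\tr P - alpha))%:E * f y).

End morrey.

(* Main.v *)
Require Import Defs.
From HB Require Import structures.
From mathcomp Require Import all_boot all_order all_algebra.
From mathcomp Require Import complex.
From mathcomp Require Import all_classical all_reals all_analysis.
From mathcomp Require Import measurable_realfun.
From mathcomp Require Import ring lra.

Set Implicit Arguments.
Unset Strict Implicit.
Unset Printing Implicit Defensive.
Import Order.TTheory GRing.Theory Num.Theory.
Import numFieldNormedType.Exports.
Local Open Scope classical_set_scope.
Local Open Scope ring_scope.

(* Both operators are dominated by the potential [u] of [|f|] with kernel
   [K z = |Omega z| rho(z)^(alpha - gamma)].

   The only information needed on [Omega] is that its integral and that of its
   power [p' = p / (p - 1) < s] over a shell [t/2 <= rho < t] are [O(t^gamma)].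
   By homogeneity it suffices to treat [t = 1]; there, the shell is covered by
   the image of a Euclidean annulus under a Lipschitz map that sends the ray
   through [w] into the orbit [A_t w], along which [Omega] is constant, and a
   Lipschitz map increases volumes by at most a constant factor. This rests on
   the facts, proved without spectral theory, that [rho] is bounded on bounded
   sets and that its unit ball is bounded.

   Normalise [f] so that the integral of [|f|^p] over a ball of radius [r] is at
   most [r^lambda], and put [beta = (gamma - lambda) / q], so that
   [(gamma - lambda) / p = alpha + beta]. Hoelder's inequality on shells bounds
   the part of [u] coming from [rho(x - y) >= r] by [C r^-beta]. Balancing it
   against the part coming from small values of [f] gives, up to a constant,
     [u(x)^q <= int K(x - y) |f(y)| min(|f(y)|^(p/q), rho(x - y)^-beta)^(q-1) dy].
   Integrate this over a ball of radius [r]: the part [rho(x - y) < r]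
   is bounded by the integral of [|f|^p] over a larger ball since the integral
   of [K(z) min(..)^(q-1)] in [z] is at most [C |f(y)|^(p-1)], and the remaining
   part is bounded by means of the averages of [|f|] over balls of radius [r].
   In this way no maximal theorem is needed. *)

(** * Integrals of possibly non-measurable functions *)

(** The obstacle is the passage from the Euclidean sphere to space: nothing ties the measure [sigma]
    of the polar decomposition to the surface measure, so polar coordinates only give the volumes of
    balls of [rho]. Moreover [Omega] has two Borel representatives, one for the volume and one for
    the surface measure, which can be compared only through [Omega] itself, along orbits. Hence the
    Lipschitz map is used to compare their distributions, and it has to carry null sets along.

    The exponents are forced by scaling. From [beta q = gamma - lambda] and
    [alpha + beta = (gamma - lambda) / p] follows [beta q = p (alpha + beta)], so that
    [p / q = beta / (alpha + beta)]. At infinity the kernel [K] is not integrable, but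
    [K rho^(-beta (q - 1))] is, since [alpha - beta (q - 1) = (1 - p)(alpha + beta)] is negative;
    near 0 the other term of the minimum keeps the weight bounded, and [K] is integrable there
    because [alpha > 0]. *)

Section integral_nonmeasurable.
Local Open Scope ereal_scope.
Context d (T : measurableType d) (R : realType) (mu : {measure set T -> \bar R}).
Implicit Types f g : T -> \bar R.

Import HBNNSimple.

(** The integral of a nonnegative function is the supremum of the integrals of the simple functions
    below it, measurable or not. A simple function below [f], set to 0 on the null set, is below [g]
    and keeps its integral. The integrands of the two operators, only almost everywhere equal to
    Borel functions, call for this generality. *)
Lemma ae_le_integralT f g : (forall x, 0 <= f x) -> (forall x, 0 <= g x) ->
  {ae mu, forall x, f x <= g x} -> \int[mu]_x f x <= \int[mu]_x g x.
Proof.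
move=> f0 g0 [N [mN N0 fgN]].
rewrite [leLHS]ge0_integralTE//; apply: ge_ereal_sup => _ [h /= hf <-].
have mh : measurable_fun setT (EFin \o h) by exact/measurable_EFinP.
have h0 x : setT x -> 0 <= (EFin \o h) x by rewrite lee_fin.
rewrite -integralT_nnsfun (ge0_negligible_integral mN measurableT mh h0 N0) setTD.
apply: (@le_trans _ _ (\int[mu]_x (EFin \o (h \_ (~` N))%R) x)).
  by rewrite integral_mkcond; under eq_integral do rewrite restrict_EFin.
pose h' := mul_nnsfun h (indic_nnsfun R (measurableC mN)).
have h'E x : h' x = (h x * \1_(~` N) x)%R by [].
rewrite (_ : EFin \o _ = EFin \o h'); last first.
  apply/funext => x; rewrite /comp h'E /patch indicE.
  by case: ifP => _; rewrite ?mulr1 ?mulr0.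
rewrite (integralT_nnsfun mu h') [leRHS]ge0_integralTE//.
apply: ereal_sup_ubound; exists h' => // x.
rewrite h'E indicE; have [/set_mem xN|_] := boolP (x \in ~` N); last by rewrite mulr0.
rewrite mulr1; apply: (le_trans (hf x)).
by apply: contrapT => fg; apply: xN; exact: fgN.
Qed.

Lemma le_integral_nonmeas (D : set T) f g : (forall x, D x -> 0 <= f x) ->
  (forall x, D x -> f x <= g x) -> \int[mu]_(x in D) f x <= \int[mu]_(x in D) g x.
Proof.
move=> f0 fg; rewrite integral_mkcond [leRHS]integral_mkcond.
apply: ae_le_integralT.
- by move=> x; rewrite patchE; case: ifPn => // /set_mem; exact: f0.
- move=> x; rewrite patchE; case: ifPn => // /set_mem Dx.
  by apply: le_trans (f0 _ Dx) (fg _ Dx).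
- apply: aeW => x; rewrite !patchE; case: ifPn => // /set_mem; exact: fg.
Qed.

Lemma ae_eq_integralT f g : {ae mu, forall x, f x = g x} ->
  \int[mu]_x f x = \int[mu]_x g x.
Proof.
move=> fg; rewrite integralE [RHS]integralE; congr (_ - _);
  apply/eqP; rewrite eq_le; apply/andP; split; apply: ae_le_integralT => //;
  by apply: filterS fg => x; rewrite ?funeposE ?funenegE => ->.
Qed.

End integral_nonmeasurable.

(** * Lebesgue measure on R^n *)

Section rect.
Variable R : realType.

Definition rect n (B : 'I_n -> set R) : set 'cV[R]_n :=
  [set x | forall i, B i (x i ord0)].

Lemma measurable_cv n (i : 'I_n) :
  measurable_fun setT (fun x : 'cV[R]_n => x i ord0).
Proof. exact: (@measurable_coord _ (measurableTypeR R) n 1 i ord0). Qed.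

Lemma measurable_fun_cvP d (S : measurableType d) n (f : S -> 'cV[R]_n) :
  measurable_fun setT f <-> forall i, measurable_fun setT (fun x => f x i ord0).
Proof.
split=> [mf i|mf].
  by apply: (measurableT_comp (f := fun x : 'cV[R]_n => x i ord0)) mf; exact: measurable_cv.
by apply/(@measurable_fun_mxP _ _ _ (measurableTypeR R)) => i j; rewrite ord1; exact: mf.
Qed.

Lemma measurable_rect n (B : 'I_n -> set R) :
  (forall i, measurable (B i)) -> measurable (rect B).
Proof.
move=> mB; rewrite (_ : rect B = \bigcap_(i in [set: 'I_n])
    (fun x : 'cV[R]_n => x i ord0) @^-1` (B i)); last first.
  by apply/seteqP; split => x /= + i => /(_ i) //; apply.
apply: fin_bigcap_measurable => // i _.
by have := @measurable_cv n i measurableT _ (mB i); rewrite setTI.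
Qed.

Lemma preimage_cons_rect n (B : 'I_n.+1 -> set R) :
  @cons_cv R n @^-1` rect B = B ord0 `*` rect (fun i => B (lift ord0 i)).
Proof.
apply/seteqP; split => -[x v] /=.
  move=> xv; split => [|i] /=.
    by have := xv ord0; rewrite cons_cvE unlift_none.
  by have := xv (lift ord0 i); rewrite cons_cvE liftK.
move=> [/= x0 vi] i; rewrite cons_cvE.
by case: unliftP => [j ->|->] //=; exact: vi.
Qed.

Lemma lebesgue_cv_rect n (B : 'I_n -> set R) : (forall i, measurable (B i)) ->
  lebesgue_cv (rect B) = (\prod_(i < n) lebesgue_measure (B i))%E.
Proof.
elim: n B => [|n IH] B mB.
  by rewrite big_ord0 /= diracE mem_set// => -[].
have mB0 : measurable (B ord0 : set (measurableTypeR R)) by exact: mB.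
rewrite /= /pushforward preimage_cons_rect (product_measure1E _ _ mB0)//;
  last exact: measurable_rect.
by rewrite big_ord_recl; congr (_ * _)%E; exact: IH.
Qed.

(** The sides are arbitrary Borel sets rather than intervals, so that a condition on one coordinate,
    which is a generator of the sigma-algebra, is itself a rectangle. *)
Let rects n : set (set 'cV[R]_n) :=
  [set A | exists2 B : 'I_n -> set R, (forall i, measurable (B i)) & A = rect B].

Let rects_gen n : @measurable _ 'cV[R]_n = <<s @rects n >>.
Proof.
apply/seteqP; split.
  apply: smallest_sub; first exact: smallest_sigma_algebra.
  move=> _ [[i j] [B [mB ->]]]; apply: sub_sigma_algebra.
  exists (fun k => if k == i then B else setT).
    by move=> k; case: ifP.
  apply/seteqP; split => x /=.
    by rewrite (ord1 j) => Bx k; case: eqP => // ->.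
  by move/(_ i); rewrite eqxx (ord1 j).
apply: smallest_sub; first exact: sigma_algebra_measurable.
by move=> _ [B mB ->]; exact: measurable_rect.
Qed.

Lemma lebesgue_cv_unique n (mu : {measure set 'cV[R]_n -> \bar R}) :
  (forall B, (forall i, measurable (B i)) ->
    lebesgue_cv (rect B) = mu (rect B)) ->
  forall A, measurable A -> lebesgue_cv A = mu A.
Proof.
move=> mu_rect A mA.
pose g k : set 'cV[R]_n := rect (fun=> `]- k%:R, k%:R]%classic).
apply: (measure_unique (@rects n) g) => //.
- exact: rects_gen.
- move=> _ _ [B mB ->] [C mC ->]; exists (fun i => B i `&` C i).
    by move=> i; exact: measurableI.
  apply/seteqP; split => x /=; first by move=> [Bx Cx] i; split.
  by move=> BC; split=> i; have [] := BC i.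
- by move=> k; exists (fun=> `]- k%:R, k%:R]%classic).
- apply/seteqP; split => // x _.
  pose M := \sum_i `|x i ord0|.
  exists (Num.truncn M).+1 => // i /=; rewrite in_itv/=.
  have xk : `|x i ord0| < (Num.truncn M).+1%:R.
    apply: le_lt_trans (truncnS_gt _); rewrite /M (bigD1 i)//= lerDl.
    exact: sumr_ge0.
  by move: xk; rewrite ltr_norml => /andP[-> /ltW].
- by move=> _ [B mB ->]; exact: mu_rect.
- move=> k; change (lebesgue_cv (g k) < +oo)%E; rewrite /g lebesgue_cv_rect// ltey_eq;
  apply/orP; left.
  apply: (big_ind (fun x => x \is a fin_num)) => //.
    by move=> x y xf yf; exact: fin_numM.
  move=> i _; rewrite lebesgue_measure_itv/=.
  by case: ifP => // _; rewrite -EFinD.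
Qed.

Let lebesgue_measure_reflect (c : R) (A : set R) : measurable A ->
  lebesgue_measure ((fun x : R => c - x) @^-1` A) = lebesgue_measure A.
Proof.
move=> mA.
have mr : measurable_fun setT ((fun x => c - x) : measurableTypeR R -> measurableTypeR R).
  by apply: measurable_funB => //.
apply/esym/(lebesgue_measure_unique (mu :=
  measure_function_pushforward__canonical__measure_function_Measure
    lebesgue_measure mr)) => // _ [[a b]] _ <-.
rewrite /= /pushforward.
rewrite (_ : _ @^-1` _ = `[c - b, c - a[%classic).
  rewrite !lebesgue_measure_itv/= !lte_fin ltrD2l ltrN2.
  by case: ifP => // _; congr _%:E; lra.
by apply/seteqP; split => x /=; rewrite !in_itv/= => /andP[? ?]; apply/andP; split; lra.
Qed.

Lemma measurable_reflect n (c : 'cV[R]_n) :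
  measurable_fun setT (fun x : 'cV[R]_n => c - x).
Proof.
apply/measurable_fun_cvP => i; under eq_fun do rewrite !mxE.
by apply: measurable_funB => //; exact: measurable_cv.
Qed.

(** Reflections are the substitutions that convolutions need, and a translation is the product of
    two of them; so they are the only maps that have to be checked on rectangles. *)
Lemma lebesgue_cv_reflect n (c : 'cV[R]_n) (A : set 'cV[R]_n) : measurable A ->
  lebesgue_cv ((fun x => c - x) @^-1` A) = lebesgue_cv A.
Proof.
move=> mA.
apply/esym/(lebesgue_cv_unique (mu :=
  measure_function_pushforward__canonical__measure_function_Measure
    (@lebesgue_cv R n) (measurable_reflect c))) => // B mB.
rewrite /= /pushforward.
rewrite (_ : _ @^-1` _ = rect (fun i => (fun x => c i ord0 - x) @^-1` B i)).
  rewrite !lebesgue_cv_rect//; last first.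
    move=> i; rewrite -[X in measurable X]setTI.
    have : measurable_fun setT (fun x : measurableTypeR R => c i ord0 - x).
      exact: measurable_funB.
    exact.
  by apply: eq_bigr => i _; rewrite lebesgue_measure_reflect.
by apply/seteqP; split => x /= + i => /(_ i); rewrite !mxE.
Qed.

Lemma measurable_ge0_pushforward d1 d2 (X : measurableType d1) (Y : measurableType d2)
    (phi : X -> Y) (mu : {measure set X -> \bar R}) (nu : {measure set Y -> \bar R})
    (f : Y -> \bar R) :
  measurable_fun setT phi ->
  (forall A, measurable A -> mu (phi @^-1` A) = nu A) ->
  measurable_fun setT f -> (forall y, 0 <= f y)%E ->
  (\int[mu]_x f (phi x) = \int[nu]_y f y)%E.
Proof.
move=> mphi munu mf f0.
transitivity (\int[pushforward mu phi]_y f y)%E.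
  rewrite (@ge0_integral_pushforward _ _ _ _ _ _ mphi)// preimage_setT//.
apply: eq_measure_integral => A mA _; exact: munu.
Qed.

Lemma ge0_integral_reflect n (c : 'cV[R]_n) (f : 'cV[R]_n -> \bar R) :
  measurable_fun setT f -> (forall x, 0 <= f x)%E ->
  (\int[@lebesgue_cv R n]_x f (c - x)%R = \int[@lebesgue_cv R n]_x f x)%E.
Proof.
move=> mf f0; apply: (@measurable_ge0_pushforward _ _ _ _ _ _ _ f (measurable_reflect c)) => //.
by move=> A; exact: lebesgue_cv_reflect.
Qed.

Lemma ge0_integral_translate n (c : 'cV[R]_n) (f : 'cV[R]_n -> \bar R) :
  measurable_fun setT f -> (forall x, 0 <= f x)%E ->
  (\int[@lebesgue_cv R n]_x f (x + c)%R = \int[@lebesgue_cv R n]_x f x)%E.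
Proof.
move=> mf f0; rewrite -(ge0_integral_reflect 0 mf f0).
have := @ge0_integral_reflect n (- c) (fun x => f (0 - x)) _ (fun x => f0 _).
rewrite (_ : (fun x => f (0 - (- c - x))) = (fun x => f (x + c))).
  by apply; apply: measurableT_comp => //; exact: measurable_reflect.
by apply/funext => x; congr f; rewrite !opprD !opprK add0r addrC.
Qed.

End rect.

(** * Regularity and Lipschitz images *)

Section outer_regularity.
Variables (R : realType) (n : nat).
Variable nu : {measure set 'cV[R]_n -> \bar R}.
Hypothesis nu_fin : (nu setT < +oo)%E.

(** Only the open set is wanted in the end; the closed set inside makes the property stable under
    complements, so that the approximable sets form a sigma-algebra. *)
Let approximable : set (set 'cV[R]_n) := [set A | forall e : R, 0 < e ->
  exists O F : set 'cV[R]_n, [/\ open O, measurable O, closed F, measurable F &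
    [/\ F `<=` A, A `<=` O & (nu (O `\` F) < e%:E)%E]]].

Let nu_lt A : measurable A -> (nu A < +oo)%E.
Proof.
by move=> mA; apply: le_lt_trans nu_fin; apply: le_measure; rewrite ?inE.
Qed.

Let approx_bigcup (A : (set 'cV[R]_n)^nat) :
  (forall i, approximable (A i)) -> approximable (\bigcup_i A i).
Proof.
move=> aA e e0.
have h i : {OF : set 'cV[R]_n * set 'cV[R]_n |
    [/\ open OF.1, measurable OF.1, closed OF.2, measurable OF.2 &
    [/\ OF.2 `<=` A i, A i `<=` OF.1 &
     (nu (OF.1 `\` OF.2) < (e / 2 / (2 ^ i.+1)%:R)%:E)%E]]}.
  apply: cid; have [|O [F H]] := aA i (e / 2 / (2 ^ i.+1)%:R).
    by rewrite !divr_gt0// ltr0n expn_gt0.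
  by exists (O, F).
pose O i := (sval (h i)).1; pose F i := (sval (h i)).2.
have oO i : open (O i) by rewrite /O; case: (svalP (h i)).
have mO i : measurable (O i) by rewrite /O; case: (svalP (h i)).
have cF i : closed (F i) by rewrite /F; case: (svalP (h i)).
have mF i : measurable (F i) by rewrite /F; case: (svalP (h i)).
have FA i : F i `<=` A i by rewrite /F; case: (svalP (h i)) => _ _ _ _ [].
have AO i : A i `<=` O i by rewrite /O; case: (svalP (h i)) => _ _ _ _ [].
have OFi i : (nu (O i `\` F i) < (e / 2 / (2 ^ i.+1)%:R)%:E)%E.
  by rewrite /O /F; case: (svalP (h i)) => _ _ _ _ [].
pose OO := \bigcup_i O i.
have mOO : measurable OO by exact: bigcup_measurable.
(* A countable union of closed sets need not be closed, so only finitely many are kept. As their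
   number grows the gap decreases to a set of measure at most [e / 2], by continuity from above, for
   which [nu] has to be finite. *)
pose FN N := \big[setU/set0]_(i < N) F i.
have mFN N : measurable (FN N) by exact: bigsetU_measurable.
have FNE : \bigcup_N FN N = \bigcup_i F i.
  apply/seteqP; split => x.
    by move=> [N _]; rewrite /FN -bigcup_mkord => -[i _ Fx]; exists i.
  by move=> [i _ Fx]; exists i.+1 => //; rewrite /FN -bigcup_mkord; exists i => /=.
have cvg : nu (OO `\` FN N) @[N --> \oo] --> nu (\bigcap_N (OO `\` FN N)).
  apply: nonincreasing_cvg_mu.
  - exact/nu_lt/measurableD.
  - by move=> i; exact: measurableD.
  - by apply: bigcap_measurable => // i _; exact: measurableD.
  - move=> i j ij; apply/subsetPset; apply: setDS.
    exact: subset_bigsetU.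
have lim_le : (nu (\bigcap_N (OO `\` FN N)) <= (e / 2)%:E)%E.
  apply: (@le_trans _ _ (\sum_(i <oo) nu (O i `\` F i))%E).
    apply: measure_sigma_subadditive.
    - by move=> i; exact: measurableD.
    - by apply: bigcap_measurable => // i _; exact: measurableD.
    - move=> x H; have [[i _ Oi] _] := H 0%N I; exists i => //; split => // Fx.
      have [_] := H i.+1 I; apply; rewrite /FN -bigcup_mkord.
      by exists i => /=.
  apply: (@le_trans _ _ (\sum_(i <oo) (e / 2 / (2 ^ i.+1)%:R)%:E)%E).
    by apply: lee_nneseries => // i _; exact/ltW.
  by apply: epsilon_trick0; rewrite divr_ge0// ltW.
have lim_lt : (nu (\bigcap_N (OO `\` FN N)) < e%:E)%E.
  by apply: le_lt_trans lim_le _; rewrite lte_fin; lra.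
have [N HN] : exists N, (nu (OO `\` FN N) < e%:E)%E.
  have /cvg_lim -/(_ (@ereal_hausdorff _)) limE := cvg.
  have : \forall N \near \oo, (nu (OO `\` FN N) < e%:E)%E.
    by apply: (cvg [set x | (x < e%:E)%E]); by apply: open_nbhs_nbhs; split => //;
      exact: open_ereal_lt_ereal.
  by move=> [N _ HN]; exists N; exact: HN (leqnn N).
exists OO, (FN N); split => //.
- exact: bigcup_open.
- exact: closed_bigsetU.
- split => //.
    apply: (subset_trans _ (subset_bigcup (fun i (_ : setT i) => FA i))).
    by rewrite -FNE => x Fx; exists N.
  exact: subset_bigcup.
Qed.

(** The half-space is closed, hence its own inner approximation, and it is the intersection of the
    decreasing open half-spaces [O k]. *)
Let approx_half i (a : R) : approximable [set x : 'cV[R]_n | a <= x i ord0].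
Proof.
have mh (P : set R) : measurable P -> measurable [set x : 'cV[R]_n | P (x i ord0)].
  by move=> mP; have := @measurable_cv R n i measurableT _ mP; rewrite setTI.
have mge (b : R) : measurable [set x : 'cV[R]_n | b <= x i ord0].
  have := mh `[b, +oo[%classic (measurable_itv _).
  by congr measurable; apply/seteqP; split => x /=; rewrite in_itv/= andbT.
have mgt (b : R) : measurable [set x : 'cV[R]_n | b < x i ord0].
  have := mh `]b, +oo[%classic (measurable_itv _).
  by congr measurable; apply/seteqP; split => x /=; rewrite in_itv/= andbT.
have cc : continuous (fun x : 'cV[R]_n => x i ord0) by exact: coord_continuous.
move=> e e0; pose F := [set x : 'cV[R]_n | a <= x i ord0].
pose O k := [set x : 'cV[R]_n | a - k.+1%:R^-1 < x i ord0].
have cvg : nu (O k `\` F) @[k --> \oo] --> nu (\bigcap_k (O k `\` F)).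
  apply: nonincreasing_cvg_mu.
  - by apply: nu_lt; apply: measurableD; [exact: mgt|exact: mge].
  - by move=> k; apply: measurableD; [exact: mgt|exact: mge].
  - by apply: bigcap_measurable => // k _; apply: measurableD; [exact: mgt|exact: mge].
  - move=> j k jk; apply/subsetPset; apply: setSD => x /=.
    apply: le_lt_trans; rewrite lerD2l lerN2 lef_pV2 ?posrE//.
    by rewrite ler_nat.
have capE : \bigcap_k (O k `\` F) = set0.
  apply/seteqP; split => // x H.
  have [_ /negP] := H 0%N I; rewrite -ltNge => xa.
  have [N _ HN] : \forall k \near \oo, k.+1%:R^-1 < a - x i ord0.
    by apply: near_infty_natSinv_lt (PosNum _); rewrite subr_gt0.
  have [+ _] := H N I; have := HN N (leqnn N); rewrite /O /= ltrBlDr ltrBrDr addrC.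
  by move=> /lt_trans/[apply]; rewrite ltxx.
rewrite capE measure0 in cvg.
have [N HN] : exists N, (nu (O N `\` F) < e%:E)%E.
  have : \forall N \near \oo, (nu (O N `\` F) < e%:E)%E.
    by apply: (cvg [set x | (x < e%:E)%E]); by apply: open_nbhs_nbhs; split => //;
      exact: open_ereal_lt_ereal.
  by move=> [N _ HN]; exists N; exact: HN (leqnn N).
exists (O N), F; split => //.
- rewrite (_ : O N = (fun x : 'cV[R]_n => x i ord0) @^-1` [set y | a - N.+1%:R^-1 < y])//.
  by apply: open_comp => //; exact: open_gt.
- exact: mgt.
- rewrite (_ : F = (fun x : 'cV[R]_n => x i ord0) @^-1` [set y | a <= y])//.
  by apply: preimage_closed => //; exact: closed_ge.
- exact: mge.
- split => // x; rewrite /F /O /=; apply: lt_le_trans.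
  by rewrite ltrBlDr ltrDl.
Qed.

Lemma finite_measure_regular (A : set 'cV[R]_n) : measurable A ->
  forall e : R, 0 < e -> exists O : set 'cV[R]_n,
    [/\ open O, measurable O, A `<=` O & (nu (O `\` A) < e%:E)%E].
Proof.
have saA : sigma_algebra setT approximable.
  split.
  - move=> e e0; exists set0, set0; split => //.
    + exact: closed0.
    + by split => //; rewrite setD0 measure0.
  - move=> {}A aA e e0; have [V [F [oO mO cF mF [FA AO OmF]]]] := aA e e0.
    exists (~` F), (~` V); rewrite setTD; split.
    + by rewrite openC.
    + exact: measurableC.
    + by rewrite closedC.
    + exact: measurableC.
    + split; [exact: subsetC|exact: subsetC|].
      by rewrite setDE setCK setIC -setDE.
  - exact: approx_bigcup.
have sub : @measurable _ 'cV[R]_n `<=` approximable.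
  apply: smallest_sub => // _ [[i j] [B [mB ->]]].
  have : (@RGenCInfty.G R).-sigma.-measurable B.
    by rewrite -RGenCInfty.measurableE.
  have sB : sigma_algebra setT [set B | approximable
      ((fun M : 'M[R]_(n, 1) => M i j) @^-1` B)].
    case: saA => a0 aC aU; split => /=.
    - by rewrite preimage_set0.
    - by move=> C aC1; rewrite setTD preimage_setC -setTD; exact: aC.
    - by move=> C aC1; rewrite preimage_bigcup; exact: aU.
  move=> /(_ [set B | approximable ((fun M : 'M[R]_(n, 1) => M i j) @^-1` B)]); apply; split => //.
  move=> _ [a ->] /=; rewrite (ord1 j) (_ : _ @^-1` _ = [set x : 'cV[R]_n | a <= x i ord0]).
    exact: approx_half.
  by apply/seteqP; split => x /=; rewrite in_itv/= andbT.
move=> mA e e0; have [V [F [oO mO cF mF [FA AO OmF]]]] := sub _ mA _ e0.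
exists V; split => //; apply: le_lt_trans OmF; apply: le_measure; rewrite ?inE.
- exact: measurableD.
- exact: measurableD.
- exact: setDS.
Qed.

End outer_regularity.

Section lipschitz_image.
Variable R : realType.

Lemma cv_norm_le n (x : 'cV[R]_n) (r : R) : 0 <= r ->
  (`|x| <= r) <-> (forall i, `|x i ord0| <= r).
Proof.
move=> r0; rewrite [`|x|]mx_normrE; split=> [/bigmax_leP[_ h] i|h].
  exact: (h (i, ord0)).
by apply/bigmax_leP; split => // -[i j] _ /=; rewrite (ord1 j).
Qed.

Lemma cv_norm_coord n (x : 'cV[R]_n) i : `|x i ord0| <= `|x|.
Proof. exact: (cv_norm_le x (normr_ge0 x)).1. Qed.

Lemma limn_einf_ge (u : (\bar R)^nat) (c : \bar R) :
  (\forall k \near \oo, c <= u k)%E -> (c <= limn_einf u)%E.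
Proof.
move=> [N _ HN]; rewrite limn_einf_lim.
rewrite (cvg_lim _ (@cvg_einfs_sup _ u))//.
apply: (@le_trans _ _ (einfs u N)); last by apply: ereal_sup_ubound; exists N.
by apply: le_ereal_inf_tmp => _ [k /= Nk <-]; exact: HN.
Qed.

Lemma limn_einf_le (u : (\bar R)^nat) (c : \bar R) :
  (forall k, u k <= c)%E -> (limn_einf u <= c)%E.
Proof.
move=> uc; rewrite limn_einf_lim.
rewrite (cvg_lim _ (@cvg_einfs_sup _ u))//.
apply: ge_ereal_sup => _ [k _ <-].
by apply: le_trans (uc k); apply: ereal_inf_lbound; exists k => /=.
Qed.

Variable n : nat.
Local Notation mu := (@lebesgue_cv R n).

(** The norm on column vectors is the maximum norm, of which these are the closed balls when
    [r >= 0]; stating the Lipschitz condition in this norm gives the factor [L ^+ n] without a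
    dimensional constant. *)
Definition cube (c : 'cV[R]_n) (r : R) : set 'cV[R]_n :=
  rect (fun i => `[c i ord0 - r, c i ord0 + r]%classic).

Lemma cubeE (c : 'cV[R]_n) (r : R) :
  cube c r = [set x | forall i, `|x i ord0 - c i ord0| <= r].
Proof.
apply/seteqP; split => x /= h i; have := h i; rewrite /= in_itv/= ler_distl.
  by move=> /andP[-> ->].
by move=> /andP[-> ->].
Qed.

Lemma measurable_cube (c : 'cV[R]_n) (r : R) : measurable (cube c r).
Proof. by apply: measurable_rect => i; exact: measurable_itv. Qed.

Lemma lebesgue_cv_cube (c : 'cV[R]_n) (r : R) : 0 < r ->
  mu (cube c r) = ((2 * r) ^+ n)%:E.
Proof.
move=> r0; rewrite lebesgue_cv_rect; last by move=> i; exact: measurable_itv.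
rewrite (eq_bigr (fun=> (2 * r)%:E)); last first.
  move=> i _; rewrite lebesgue_measure_itv/= lte_fin.
  rewrite (_ : _ < _); last by lra.
  by rewrite -EFinD; congr _%:E; lra.
by rewrite prodEFin prodr_const card_ord.
Qed.

Section open_image.
Variables (Phi : 'cV[R]_n -> 'cV[R]_n) (L : R) (O Y : set 'cV[R]_n).
Hypotheses (L0 : 0 < L) (mPhi : measurable_fun setT Phi).
Hypotheses (oO : open O) (mO : measurable O) (mY : measurable Y).
Hypothesis lipPhi : forall u y, O u -> O y -> `|Phi y - Phi u| <= L * `|y - u|.
Hypothesis YO : Y `<=` Phi @` O.

(* For [x] in [Y], a cube of half-side [r] around a preimage of [x] is mapped
   into the cube of half-side [L r] around [x], so that the volume of
   [{y in O, |Phi y - x| <= L r}] divided by [(2 r)^n] is at least [1] for small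
   [r]; Tonelli's theorem bounds its integral over [Y] by [L^n |O|], and Fatou's
   lemma lets [r] tend to [0]. *)
Let D (r : R) : set ('cV[R]_n * 'cV[R]_n) :=
  [set z | [/\ Y z.1, O z.2 & forall i, `|Phi z.2 i ord0 - z.1 i ord0| <= L * r]].

Let mD r : measurable (D r).
Proof.
rewrite (_ : D r = (Y `*` O) `&` \bigcap_(i in [set: 'I_n])
    (fun z : 'cV[R]_n * 'cV[R]_n => `|Phi z.2 i ord0 - z.1 i ord0|) @^-1` `]-oo, L * r]).
  apply: measurableI; first exact: measurableX.
  apply: fin_bigcap_measurable => // i _.
  rewrite -[X in measurable X]setTI.
  suff : measurable_fun setT (fun z : 'cV[R]_n * 'cV[R]_n =>
    `|Phi z.2 i ord0 - z.1 i ord0|) by apply => //; exact: measurable_itv.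
  apply: measurableT_comp => //; apply: measurable_funB.
    apply: (measurableT_comp (f := fun x : 'cV[R]_n => x i ord0)).
      exact: measurable_cv.
    by apply: measurableT_comp => //; exact: measurable_snd.
  apply: (measurableT_comp (f := fun x : 'cV[R]_n => x i ord0)).
    exact: measurable_cv.
  exact: measurable_fst.
apply/seteqP; split => z /=.
  by move=> [? ? h]; split => // i _; rewrite /= in_itv/=.
by move=> [[? ?] h]; split => // i; have := h i I; rewrite /= in_itv/=.
Qed.

Let g r (z : 'cV[R]_n * 'cV[R]_n) : \bar R := (\1_(D r) z)%:E.

Let mg r : measurable_fun setT (g r).
Proof. by apply/measurable_EFinP; exact: measurable_indic. Qed.

Let f (k : nat) (x : 'cV[R]_n) : \bar R :=
  (((2 * k.+1%:R^-1) ^+ n)^-1%:E * \int[mu]_y g k.+1%:R^-1 (x, y))%E.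

Let mf k : measurable_fun setT (f k).
Proof.
apply: measurable_funeM.
by apply: (measurable_fun_fubini_tonelli_F (m2 := mu) (g k.+1%:R^-1)) => // z; rewrite lee_fin.
Qed.

Let int_f k : (\int[mu]_x f k x <= (L ^+ n)%:E * mu O)%E.
Proof.
set r : R := k.+1%:R^-1.
have r0 : 0 < r by rewrite invr_gt0.
have c0 : 0 <= ((2 * r) ^+ n)^-1 by rewrite invr_ge0 exprn_ge0// mulr_ge0// ltW.
rewrite ge0_integralZl//; last 2 first.
- by apply: (measurable_fun_fubini_tonelli_F (m2 := mu) (g r)) => // z; rewrite lee_fin.
- by move=> x _; apply: integral_ge0 => y _; rewrite lee_fin.
rewrite (fubini_tonelli (m1 := mu) (m2 := mu) (g r))//; last by move=> z; rewrite lee_fin.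
apply: (@le_trans _ _ (((2 * r) ^+ n)^-1%:E *
    \int[mu]_y (((2 * (L * r)) ^+ n)%:E * (\1_O y)%:E))%E).
  rewrite lee_wpmul2l ?lee_fin//; apply: ge0_le_integral => //.
  - by move=> y _; apply: integral_ge0 => x _; rewrite lee_fin.
  - by apply: (measurable_fun_fubini_tonelli_G (m1 := mu) (g r)) => // z; rewrite lee_fin.
  - by apply: measurable_funeM; apply/measurable_EFinP; exact: measurable_indic.
  - move=> y _; rewrite [in leRHS]indicE; have [Oy|Oy] := boolP (y \in O).
      rewrite mule1 -(lebesgue_cv_cube (Phi y))//; last exact: mulr_gt0.
      rewrite -[leRHS]mul1e -integral_cst//; last exact: measurable_cube.
      rewrite [leRHS]integral_mkcond; apply: ge0_le_integral => //.
      + by move=> x _; rewrite lee_fin.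
      + by apply: (measurableT_comp (mg r)); exact: measurable_pair2.
      + apply/(measurable_restrictT _ _).1 => //; exact: measurable_cube.
      + move=> x _; rewrite /g indicE patchE.
        have [/set_mem[_ _ /= h]|_] := boolP ((x, y) \in D r).
          rewrite mem_set// cubeE => i /=.
          by rewrite distrC.
        by case: ifP => // _; rewrite lee_fin.
    rewrite mule0 integral0_eq// => x _; rewrite /g indicE.
    case: (boolP ((x, y) \in D r)) => // /set_mem[_ /= yO _].
    by rewrite mem_set in Oy.
rewrite ge0_integralZl//; last 2 first.
- by apply/measurable_EFinP; exact: measurable_indic.
- by rewrite lee_fin exprn_ge0// !mulr_ge0// ltW.
rewrite integral_indic// setIT muleA -EFinM; apply: lee_wpmul2r => //.
rewrite lee_fin mulrCA [(L * _) ^+ n]exprMn mulrCA mulVf ?mulr1//.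
by rewrite expf_neq0// mulf_neq0// gt_eqF.
Qed.

Lemma open_lipschitz_image : (mu Y <= (L ^+ n)%:E * mu O)%E.
Proof.
have f0 k x : (0 <= f k x)%E.
  rewrite mule_ge0//.
  by apply: integral_ge0 => y _; rewrite lee_fin.
apply: (@le_trans _ _ (\int[mu]_x limn_einf (f ^~ x))%E); last first.
  apply: (@le_trans _ _ (limn_einf (fun k => \int[mu]_x f k x))%E).
    by apply: (fatou mu measurableT mf) => k x _; exact: f0.
  by apply: limn_einf_le => k; exact: int_f.
rewrite -[leLHS]mul1e -integral_cst// integral_mkcond.
apply: le_integral_nonmeas => x _; first by rewrite patchE; case: ifP.
rewrite patchE; case: ifPn => [/set_mem Yx|_]; last first.
  by apply: limn_einf_ge; near=> k; exact: f0.
have [u Ou xE] := YO Yx.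
have /nbhs_ballP[e /= e0 eO] : nbhs u O by exact: open_nbhs_nbhs.
apply: limn_einf_ge; near=> k.
have r0 : 0 < k.+1%:R^-1 :> R by rewrite invr_gt0.
have re : k.+1%:R^-1 < e by near: k; exact: (near_infty_natSinv_lt (PosNum e0)).
rewrite /f; set r : R := k.+1%:R^-1 in r0 re *.
have c0 : 0 < (2 * r) ^+ n by rewrite exprn_gt0// mulr_gt0.
rewrite -[leLHS](_ : ((2 * r) ^+ n)^-1%:E * ((2 * r) ^+ n)%:E = 1)%E; last first.
  by rewrite -EFinM mulVf// gt_eqF.
apply: lee_wpmul2l; first by rewrite lee_fin invr_ge0 ltW.
rewrite -(lebesgue_cv_cube u)// -[leLHS]mul1e -integral_cst//; last exact: measurable_cube.
rewrite integral_mkcond; apply: ge0_le_integral => //.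
- by move=> y _; rewrite patchE; case: ifP.
- by apply/(measurable_restrictT _ _).1 => //; exact: measurable_cube.
- by apply: (measurableT_comp (mg r)); exact: pair1_measurable.
move=> y _; rewrite patchE; case: ifPn => [|_]; last by rewrite lee_fin.
rewrite cubeE => /set_mem /= yu.
have {}yu : `|y - u| <= r.
  by apply/cv_norm_le; [exact: ltW|move=> i; rewrite !mxE].
have Oy : O y.
  by apply: eO; rewrite -ball_normE/= distrC; exact: le_lt_trans yu re.
rewrite /g indicE mem_set//; split => //= i.
have := cv_norm_coord (Phi y - x) i; rewrite !mxE => /le_trans; apply.
by rewrite -xE; apply: (le_trans (lipPhi Ou Oy)); rewrite ler_pM2l.
Unshelve. all: by end_near. Qed.

End open_image.

(** The open case applies to the intersection of [U] with an open [V] containing [A] whose excess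
    over [A] inside [U] has volume below [e / L ^+ n]. Regularity is used for the volume restricted
    to [U], a finite measure. *)
Lemma lipschitz_image (Phi : 'cV[R]_n -> 'cV[R]_n) (L : R) (U A Y : set 'cV[R]_n) :
  0 < L -> measurable_fun setT Phi -> open U -> measurable U -> (mu U < +oo)%E ->
  (forall u y, U u -> U y -> `|Phi y - Phi u| <= L * `|y - u|) ->
  measurable A -> A `<=` U -> measurable Y -> Y `<=` Phi @` A ->
  (mu Y <= (L ^+ n)%:E * mu A)%E.
Proof.
move=> L0 mPhi oU mU Ufin lipPhi mA AU mY YA.
have Ln0 : 0 < L ^+ n by rewrite exprn_gt0.
apply/lee_addgt0Pr => e e0.
pose nu := mrestr mu mU.
have nufin : (nu setT < +oo)%E by rewrite /nu /mrestr setTI.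
have [|V [oV mV AV VA]] := @finite_measure_regular _ _
  (measure_function_mrestr__canonical__measure_function_Measure mu mU) nufin _ mA (e / L ^+ n).
  by rewrite divr_gt0.
have mW : measurable (V `&` U) by exact: measurableI.
have AW : A `<=` V `&` U by move=> x Ax; split; [exact: AV|exact: AU].
apply: (@le_trans _ _ ((L ^+ n)%:E * mu (V `&` U))%E).
  apply: (open_lipschitz_image (Phi := Phi)) => //.
  - exact: openI.
  - by move=> u y [_ ?] [_ ?]; exact: lipPhi.
  - by apply: (subset_trans YA); exact: image_subset.
rewrite -[X in mu X](setDUK AW) (measureU _ mA)//; last 2 first.
- exact: measurableD.
- by rewrite setDE setICA setICr setI0.
rewrite ge0_muleDr//; apply: leeD => //.
have {}VA : (mu ((V `&` U) `\` A) <= (e / L ^+ n)%:E)%E.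
  by rewrite [X in mu X](_ : _ = (V `\` A) `&` U); [exact: ltW|rewrite !setDE setIAC].
apply: (le_trans (lee_wpmul2l _ VA)); first by rewrite lee_fin ltW.
by rewrite -EFinM mulrCA divff ?mulr1// gt_eqF.
Qed.

End lipschitz_image.

(** * One-parameter groups of matrices *)

Section matrix_exponential.
Variables (R : realType) (n : nat) (P : 'M[R]_n).
Implicit Types (s t : R) (i j : 'I_n).

Definition expmxZ (s : R) : 'M[R]_n := expmx (s *: P).

(** Each entry of the exponential is a real power series in [s], so that its derivative is obtained
    by termwise differentiation. *)
Let c i j (k : nat) : R := (k`!%:R)^-1 * (P ^+ k) i j.

Let S s N : 'M[R]_n := series (fun k : nat => k`!%:R^-1 *: (s *: P) ^+ k) N.

Let exprZmx s (k : nat) : (s *: P) ^+ k = s ^+ k *: P ^+ k.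
Proof.
elim: k => [|k IH]; first by rewrite !expr0 scale1r.
rewrite !exprS IH; apply/matrixP => i j; rewrite !mxE mulr_sumr.
by apply: eq_bigr => l _; rewrite !mxE; ring.
Qed.

Let SE s N i j : S s N i j = pseries (c i j) s N.
Proof.
rewrite /S /pseries /series /= summxE; apply: eq_bigr => k _.
by rewrite exprZmx /c !mxE; ring.
Qed.

(** Each row sum of absolute values of [P] is at most [B], whence the bound [B ^+ k] on the entries
    of [P ^+ k]; the summand 1 keeps [B] positive. *)
Let B := 1 + \sum_i \sum_j `|P i j|.

Let B1 : 1 <= B.
Proof. by rewrite lerDl; apply: sumr_ge0 => i _; apply: sumr_ge0. Qed.

Let pow_bound (k : nat) i j : `|(P ^+ k) i j| <= B ^+ k.
Proof.
elim: k i j => [|k IH] i j; first by rewrite !expr0 !mxE; case: eqP; rewrite ?normr1 ?normr0 ?ler01.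
rewrite !exprS mxE; apply: (le_trans (ler_norm_sum _ _ _)).
apply: (@le_trans _ _ (\sum_l `|P i l| * B ^+ k)).
  by apply: ler_sum => l _; rewrite normrM ler_wpM2l.
rewrite -mulr_suml ler_wpM2r ?exprn_ge0//; first by apply: le_trans B1.
rewrite /B [in leRHS](bigD1 i)//= addrCA lerDl addr_ge0//.
by apply: sumr_ge0 => a _; apply: sumr_ge0.
Qed.

(** Comparison with the exponential series at [B * |s|]. Termwise differentiation requires this
    convergence for the series and for its first two derived series. *)
Let cvg_coef (d : nat -> R) (C : R) s : 0 <= C ->
  (forall k, `|d k| <= C * ((k`!%:R)^-1 * B ^+ k)) -> cvgn (pseries d s).
Proof.
move=> C0 dC; apply: normed_cvg.
apply: (@series_le_cvg _ (fun k => `|d k * s ^+ k|)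
  (fun k => C * exp_coeff (B * `|s|) k)).
- by move=> k.
- by move=> k; rewrite mulr_ge0// exp_coeff_ge0// mulr_ge0// (le_trans _ B1).
- move=> k; rewrite normrM normrX /exp_coeff /= exprMn.
  apply: (le_trans (ler_wpM2r _ (dC k))); first exact: exprn_ge0.
  by rewrite le_eqVlt; apply/orP; left; apply/eqP; ring.
- by apply: is_cvg_seriesZ; exact: is_cvg_series_exp_coeff.
Qed.

Let cvg_c i j s : cvgn (pseries (c i j) s).
Proof.
apply: (@cvg_coef _ 1) => // k; rewrite mul1r normrM ger0_norm ?invr_ge0//.
by rewrite ler_wpM2l// invr_ge0.
Qed.

Let diffs_c i j k : pseries_diffs (c i j) k = (k`!%:R)^-1 * (P ^+ k.+1) i j.
Proof. by rewrite /pseries_diffs /c factS natrM invfM mulrA mulVKf. Qed.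

Let diffs2_c i j k :
  pseries_diffs (pseries_diffs (c i j)) k = (k`!%:R)^-1 * (P ^+ k.+2) i j.
Proof. by rewrite [LHS]/pseries_diffs diffs_c factS natrM invfM mulrA mulVKf. Qed.

Let cvg_dc i j s : cvgn (pseries (pseries_diffs (c i j)) s).
Proof.
apply: (@cvg_coef _ B) => [|k]; first exact: le_trans B1.
rewrite diffs_c normrM ger0_norm ?invr_ge0// mulrCA -exprS.
by rewrite ler_wpM2l// invr_ge0.
Qed.

Let cvg_ddc i j s : cvgn (pseries (pseries_diffs (pseries_diffs (c i j))) s).
Proof.
apply: (@cvg_coef _ (B ^+ 2)) => [|k]; first by rewrite exprn_ge0// (le_trans _ B1).
rewrite diffs2_c normrM ger0_norm ?invr_ge0// mulrCA -exprD.
by rewrite ler_wpM2l// invr_ge0.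
Qed.

Let cvg_mx (u : nat -> 'M[R]_n) (M : 'M[R]_n) :
  (forall i j, u N i j @[N --> \oo] --> M i j) -> u @ \oo --> M.
Proof.
move=> h; apply/cvg_ballP => e e0.
suff : \forall N \near \oo, forall i j, ball (M i j) e (u N i j).
  by apply: filterS => N.
apply: filter_forall => i; apply: filter_forall => j.
by move/cvg_ballP : (h i j); apply.
Qed.

Let expmxZE s i j : expmxZ s i j = limn (pseries (c i j) s).
Proof.
pose M : 'M[R]_n := \matrix_(i, j) limn (pseries (c i j) s).
have SM : S s @ \oo --> M.
  apply: cvg_mx => a b; rewrite mxE (_ : (fun N => S s N a b) = pseries (c a b) s).
    exact: cvg_c.
  by apply/funext => N; rewrite SE.
have -> : expmxZ s = M by apply: cvg_lim SM.
by rewrite mxE.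
Qed.

Let cvg_S s i j : S s N i j @[N --> \oo] --> expmxZ s i j.
Proof.
rewrite expmxZE (_ : (fun N => S s N i j) = pseries (c i j) s); first exact: cvg_c.
by apply/funext => N; rewrite SE.
Qed.

Let cvg_sumn (u : 'I_n -> nat -> R) (l : 'I_n -> R) :
  (forall i, u i N @[N --> \oo] --> l i) ->
  (\sum_i u i N) @[N --> \oo] --> \sum_i l i.
Proof.
move=> h; rewrite (_ : (fun N => \sum_i u i N) = \sum_i u i); last first.
  by apply/funext => N; rewrite fct_sumE.
elim/big_ind2 : _ => //; first exact: cvg_cst.
by move=> f a g b fa gb; exact: cvgD.
Qed.

Let S_comm s N : S s N *m P = P *m S s N.
Proof.
rewrite /S /series /= mulmx_suml mulmx_sumr; apply: eq_bigr => k _.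
rewrite exprZmx -!scalemxAl -!scalemxAr; congr (_ *: (_ *: _)).
by rewrite -[LHS](exprSr P k) exprS.
Qed.

Let cvg_mulPS s i j : (P *m S s N) i j @[N --> \oo] --> (P *m expmxZ s) i j.
Proof.
rewrite mxE (_ : (fun N => (P *m S s N) i j) = fun N => \sum_l P i l * S s N l j).
  apply: (cvg_sumn (u := fun l N => P i l * S s N l j)) => l.
  by apply: cvgM; [exact: cvg_cst|exact: cvg_S].
by apply/funext => N; rewrite mxE.
Qed.

Lemma expmxZ_comm s : expmxZ s *m P = P *m expmxZ s.
Proof.
apply/matrixP => i j.
apply: (@cvg_unique _ _ ((P *m S s N) i j @[N --> \oo])) => //; last exact: cvg_mulPS.
rewrite mxE (_ : (fun N => (P *m S s N) i j) = fun N => \sum_l S s N i l * P l j).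
  apply: (cvg_sumn (u := fun l N => S s N i l * P l j)) => l.
  by apply: cvgM; [exact: cvg_S|exact: cvg_cst].
by apply/funext => N; rewrite -S_comm mxE.
Qed.

Lemma is_derive_expmxZ s i j :
  is_derive s (1 : R) (fun s => expmxZ s i j) ((P *m expmxZ s) i j).
Proof.
rewrite (_ : (fun s => expmxZ s i j) = fun s => limn (pseries (c i j) s)); last first.
  by apply/funext => t; rewrite expmxZE.
rewrite (_ : (P *m _) i j = limn (pseries (pseries_diffs (c i j)) s)); last first.
  apply/esym/cvg_lim => //.
  rewrite (_ : pseries (pseries_diffs (c i j)) s = fun N => (P *m S s N) i j).
    exact: cvg_mulPS.
  apply/funext => N; rewrite /S /pseries /series /= mulmx_sumr summxE.
  apply: eq_bigr => k _; rewrite diffs_c exprZmx -!scalemxAr !mxE exprS.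
  by rewrite [(P * P ^+ k) i j]mxE; ring.
apply: (@pseries_snd_diffs _ _ (`|s| + 1)) => //.
by rewrite [ltRHS]ger0_norm ?ltrDl// addr_ge0.
Qed.

Lemma expmxZ0 : expmxZ 0 = 1%:M.
Proof.
apply/matrixP => i j; apply: (@cvg_unique _ _ (S 0 N i j @[N --> \oo])) => //.
  exact: cvg_S.
rewrite /=; apply: cvg_near_cst; exists 1%N => // -[//|N] _.
rewrite /S /series /= summxE big_nat_recl// big1 ?addr0.
  by rewrite expr0 fact0 invr1 scale1r.
by move=> k _; rewrite exprZmx expr0n/= scale0r scaler0 mxE.
Qed.

(** The product [exp(u P) exp((s + t - u) P)] does not depend on [u]: its derivative vanishes
    because the exponential commutes with [P]. The two sides are its values at [u = 0] and [u = s],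
    and no product of series is expanded. *)
Lemma expmxZD s t : expmxZ (s + t) = expmxZ s *m expmxZ t.
Proof.
pose F (i k : 'I_n) u := (expmxZ u *m expmxZ (s + t - u)) i k.
have dF i k u : is_derive u (1 : R) (F i k) 0.
  have dE l : is_derive u (1 : R) (fun u => expmxZ (s + t - u) l k)
      (- (P *m expmxZ (s + t - u)) l k).
    rewrite -[X in is_derive _ _ _ X]mulrN1.
    apply: (@is_derive1_comp _ (fun v => expmxZ v l k) (fun u => s + t - u)).
      exact: is_derive_expmxZ.
    have := is_deriveB (is_derive_cst (s + t) u (1 : R)) (is_derive_id u (1 : R)).
    by rewrite sub0r.
  rewrite (_ : F i k = \sum_l ((fun u => expmxZ u i l) * (fun u => expmxZ (s + t - u) l k)));
    last first.
    by apply/funext => v; rewrite /F mxE fct_sumE.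
  rewrite -[X in is_derive _ _ _ X](_ : \sum_l (expmxZ u i l * - (P *m expmxZ (s + t - u)) l k +
     expmxZ (s + t - u) l k * (P *m expmxZ u) i l) = 0).
    apply: is_derive_sum => l; apply: is_deriveM; first exact: is_derive_expmxZ.
  transitivity ((- (expmxZ u *m (P *m expmxZ (s + t - u))) +
     (P *m expmxZ u) *m expmxZ (s + t - u)) i k).
    rewrite !mxE -sumrN -big_split /=; apply: eq_bigr => l _.
    by rewrite mulrN; congr (_ + _); rewrite mulrC.
  by rewrite mulmxA expmxZ_comm addNr mxE.
apply/matrixP => i k.
have := is_derive_0_is_cst 0 s (dF i k).
by rewrite /F expmxZ0 mul1mx subr0 addrAC subrr add0r.
Qed.

Lemma continuous_expmxZ i j : continuous (fun s => expmxZ s i j).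
Proof.
move=> s; apply: differentiable_continuous; apply/derivable1_diffP.
by have [] := is_derive_expmxZ s i j.
Qed.

Lemma expmxZ_bounded a b : exists2 C : R, 0 < C &
  forall s i j, a <= s <= b -> `|expmxZ s i j| <= C.
Proof.
have h (ij : 'I_n * 'I_n) : {C : R | forall s, a <= s <= b -> `|expmxZ s ij.1 ij.2| <= C}.
  apply: cid; have [ab|ab] := leP a b; last first.
    by exists 0 => s /andP[? ?]; exfalso; lra.
  have [|d _ H] := @EVT_max R (fun s => `|expmxZ s ij.1 ij.2|) a b ab.
    apply: continuous_subspaceT => s; apply: (@continuous_comp _ _ _ _ (fun x : R => `|x|)).
      exact: continuous_expmxZ.
    exact: norm_continuous.
  by exists `|expmxZ d ij.1 ij.2| => s sab; apply: H; rewrite in_itv.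
exists (1 + \sum_ij `|sval (h ij)|).
  by rewrite ltr_wpDr// sumr_ge0.
move=> s i j sab; have := svalP (h (i, j)) _ sab => /= /le_trans; apply.
rewrite (bigD1 (i, j))//= addrCA; apply: (le_trans (ler_norm _)).
by rewrite lerDl addr_ge0// sumr_ge0.
Qed.

Lemma expmxZ_lipschitz a b : exists2 C : R, 0 < C & forall s t i j,
  a <= s <= b -> a <= t <= b -> `|expmxZ s i j - expmxZ t i j| <= C * `|s - t|.
Proof.
have [C C0 HC] := expmxZ_bounded a b.
exists (B * C); first by rewrite mulr_gt0// (lt_le_trans ltr01).
move=> s t i j; wlog ts : s t / t <= s => [hw|].
  have [ts|/ltW st] := leP t s; first exact: hw.
  by move=> sab tab; rewrite distrC (distrC s); exact: hw.
move=> sab tab.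
have [|x|d] := @MVT_segment R (fun s => expmxZ s i j) (fun s => (P *m expmxZ s) i j) t s ts.
- by move=> x _; exact: is_derive_expmxZ.
- exact: continuous_subspaceT (@continuous_expmxZ i j) x.
rewrite in_itv/= => /andP[td ds] ->; rewrite normrM ler_wpM2r//.
have cab : a <= d <= b by move: sab tab => /andP[? ?] /andP[? ?]; apply/andP; split; lra.
rewrite mxE; apply: (le_trans (ler_norm_sum _ _ _)).
apply: (@le_trans _ _ (\sum_l `|P i l| * C)).
  by apply: ler_sum => l _; rewrite normrM ler_wpM2l// HC.
rewrite -mulr_suml ler_wpM2r ?(ltW C0)//.
rewrite /B [in leRHS](bigD1 i)//= addrCA lerDl addr_ge0//.
by apply: sumr_ge0 => u _; apply: sumr_ge0.
Qed.

Lemma expmxZ_unit s : expmxZ (- s) *m expmxZ s = 1%:M.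
Proof. by rewrite -expmxZD addNr expmxZ0. Qed.

End matrix_exponential.

(** * Quasi-distances *)

Section cv_norms.
Variable R : realType.

Lemma mulmx_norm_le m n (M : 'M[R]_(m, n)) (x : 'cV[R]_n) :
  `|M *m x| <= (\sum_i \sum_j `|M i j|) * `|x|.
Proof.
apply/cv_norm_le => [|i].
  by rewrite mulr_ge0// sumr_ge0// => i _; exact: sumr_ge0.
rewrite mxE; apply: (le_trans (ler_norm_sum _ _ _)).
rewrite (bigD1 i)//= mulrDl ler_wpDr//.
  by rewrite mulr_ge0// sumr_ge0// => k _; exact: sumr_ge0.
rewrite mulr_suml; apply: ler_sum => j _.
by rewrite normrM ler_wpM2l// cv_norm_coord.
Qed.

Lemma enorm_ge0 n (x : 'cV[R]_n) : 0 <= enorm x.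
Proof. exact: sqrtr_ge0. Qed.

Lemma norm_le_enorm n (x : 'cV[R]_n) : `|x| <= enorm x.
Proof.
apply/cv_norm_le => [|i]; first exact: enorm_ge0.
rewrite /enorm -sqrtr_sqr ler_sqrt; last by apply: sumr_ge0 => j _; exact: sqr_ge0.
by rewrite (bigD1 i)//= lerDl sumr_ge0// => j _; exact: sqr_ge0.
Qed.

Lemma enorm_le_norm n (x : 'cV[R]_n) : enorm x <= n%:R * `|x|.
Proof.
have nx0 : 0 <= n%:R * `|x| by rewrite mulr_ge0.
rewrite -(ger0_norm nx0) -sqrtr_sqr ler_sqrt ?sqr_ge0//.
apply: (@le_trans _ _ (\sum_(i < n) `|x| ^+ 2)).
  apply: ler_sum => i _; rewrite -[x i ord0 ^+ 2]ger0_norm ?sqr_ge0// normrX.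
  by rewrite lerXn2r ?nnegrE// cv_norm_coord.
rewrite sumr_const card_ord -[leLHS]mulr_natl exprMn ler_wpM2r ?sqr_ge0//.
by case: n {x nx0} => [|n]; rewrite expr2 ?mul0r// ler_peMr// ler1n.
Qed.

Lemma enormZ n (c : R) (x : 'cV[R]_n) : enorm (c *: x) = `|c| * enorm x.
Proof.
rewrite /enorm -sqrtr_sqr -sqrtrM ?sqr_ge0// mulr_sumr; congr Num.sqrt.
by apply: eq_bigr => i _; rewrite mxE exprMn.
Qed.

(** Closed bounded sets of row vectors are compact; transposition is an isometry and transports this
    to columns. *)
Lemma compact_shell n (a b : R) : compact [set x : 'cV[R]_n | a <= `|x| <= b].
Proof.
have trE (x : 'rV[R]_n) : `|x^T| = `|x|.
  rewrite [LHS]mx_normrE [RHS]mx_normrE; apply/eqP; rewrite eq_le.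
  apply/andP; split; apply/bigmax_leP; split.
  - by apply: bigmax_ge_id.
  - move=> -[i j] _ /=; rewrite mxE; apply/bigmax_geP; right.
    by exists (j, i).
  - by apply: bigmax_ge_id.
  - move=> -[i j] _ /=; apply/bigmax_geP; right.
    by exists (j, i) => //=; rewrite mxE.
pose K : set 'rV[R]_n := [set x | a <= `|x| <= b].
have -> : [set x : 'cV[R]_n | a <= `|x| <= b] = trmx @` K.
  apply/seteqP; split => x /=.
    by move=> h; exists x^T; rewrite /K/= ?trmxK// -trE trmxK.
  by move=> [y + <-]; rewrite /K/= trE.
have ct : continuous (trmx : 'rV[R]_n -> 'cV[R]_n).
  move=> x A /= /nbhs_ballP[e e0 eA]; apply/nbhs_ballP; exists e => //= z xz.
  by apply: eA; move: xz; rewrite -!ball_normE /= -linearB/= trE.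
apply: continuous_compact; first exact: continuous_subspaceT.
apply: bounded_closed_compact.
  exists b; split; first exact: num_real.
  by move=> c bc x /= /andP[_ /le_trans]; apply; exact: ltW.
rewrite (_ : K = Num.norm @^-1` [set` `[a, b]]).
  by apply: preimage_closed; [move=> x _; exact: norm_continuous|exact: itv_closed].
by apply/seteqP; split => x; rewrite /K /= in_itv.
Unshelve. all: by end_near. Qed.

End cv_norms.

Section quasi_distance_geometry.
Variables (R : realType) (n : nat) (P : 'M[R]_n) (rho : 'cV[R]_n -> R).
Hypothesis qd : quasi_distance P rho.
Local Notation mu := (@lebesgue_cv R n).
Implicit Types (x y z : 'cV[R]_n).

Let dilE t : dil P t = expmxZ P (ln t). Proof. by []. Qed.

Lemma dilM (s t : R) : 0 < s -> 0 < t -> dil P s *m dil P t = dil P (s * t).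
Proof. by move=> s0 t0; rewrite !dilE -expmxZD lnM. Qed.

Lemma dil1 : dil P 1 = 1%:M.
Proof. by rewrite dilE ln1 expmxZ0. Qed.

Lemma dilK (t : R) : 0 < t -> dil P t *m dil P t^-1 = 1%:M.
Proof. by move=> t0; rewrite dilM ?invr_gt0// divff ?gt_eqF// dil1. Qed.

Lemma dilVK (t : R) : 0 < t -> dil P t^-1 *m dil P t = 1%:M.
Proof. by move=> t0; rewrite dilM ?invr_gt0// mulVf ?gt_eqF// dil1. Qed.

Lemma rho_ge0 x : 0 <= rho x.
Proof.
have [->|/(rho_gt0 qd)/ltW//] := eqVneq x 0; by rewrite (rho0 qd).
Qed.

Lemma rhoN x : rho (- x) = rho x.
Proof. by have := rho_sym qd 0 x; rewrite sub0r subr0. Qed.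

Lemma rho_quasi_triangle : exists2 k : R, 1 <= k &
  forall x y, rho (x + y) <= k * (rho x + rho y).
Proof.
have [k kP] := rho_triangle qd; exists (Num.max k 1).
  by rewrite le_max lexx orbT.
move=> x y; have := kP x (- y) 0; rewrite !subr0 opprK rhoN => /le_trans; apply.
by rewrite ler_wpM2r ?addr_ge0 ?rho_ge0// le_max lexx.
Qed.

Let measurable_rho_lt (a : R) : measurable [set x | rho x < a].
Proof.
have := rho_measurable qd measurableT (measurable_itv `]-oo, a[).
by rewrite setTI; congr measurable; apply/seteqP; split => x /=; rewrite in_itv.
Qed.

(* For m large, [A = {rho < m}] fills most of the cube [Q] of side 2; a small
   translate of [-A] then cannot avoid [A], so that small vectors are sums of
   two elements of [A]. *)
Let rho_bounded_near0 : exists d M : R, [/\ 0 < d, 0 < M &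
  forall x, `|x| <= d -> rho x <= M].
Proof.
have [k k1 kP] := rho_quasi_triangle.
pose Q := cube (0 : 'cV[R]_n) 1.
pose A m := Q `&` [set x | rho x < m%:R].
have mQ : measurable Q by exact: measurable_cube.
have mA m : measurable (A m) by exact: measurableI.
have muQ : mu Q = ((2 * 1) ^+ n)%:E by exact: lebesgue_cv_cube.
(* If [A m] and its reflection, each of volume more than 3/4 of that of [Q], were disjoint, they
   would fill more than 3/2 of it inside the cube of half-side [1 + eta], which is too small for
   that. *)
have [eta [eta0 Heta]] : exists eta : R, 0 < eta /\
    (2 * (1 + eta)) ^+ n < 3 / 2 * (2 * 1) ^+ n.
  pose e : R := (2 ^+ n.+1)^-1.
  have e0 : 0 < e by rewrite invr_gt0 exprn_gt0.
  have e1 : e <= 1 by rewrite invf_le1 ?exprn_gt0// exprn_ege1// ler1n.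
  (* On [[0, 1]] the convex function [(1 + e) ^+ j] lies below its chord. *)
  have H j : (1 + e) ^+ j <= 1 + (2 ^+ j - 1) * e.
    elim: j => [|j IH]; first by rewrite !expr0; lra.
    have a1 : 1 <= 2 ^+ j :> R by rewrite exprn_ege1// ler1n.
    rewrite !exprS; set a : R := 2 ^+ j in IH a1 *.
    apply: (@le_trans _ _ ((1 + e) * (1 + (a - 1) * e))); first by rewrite ler_pM2l// addr_gt0.
    have : 0 <= (a - 1) * (e * (1 - e)) by rewrite !mulr_ge0 ?subr_ge0// ltW.
    by lra.
  have c0 : 0 < (2 * 1 : R) ^+ n by rewrite exprn_gt0.
  exists e; split => //; rewrite [ltLHS]exprMn mulr1 mulrC ltr_pM2r ?exprn_gt0//.
  apply: (le_lt_trans (H n)).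
  have : 2 ^+ n * e = 2^-1 by rewrite /e exprS invfM mulrCA divff ?mulr1// expf_neq0.
  by move=> he; rewrite mulrBl he; lra.
have [m Hm] : exists m, ((3 / 4 * (2 * 1) ^+ n)%:E < mu (A m))%E.
  have cvgA : mu (A m) @[m --> \oo] --> mu (\bigcup_m A m).
    apply: nondecreasing_cvg_mu => //; first exact: bigcup_measurable.
    move=> i j ij; apply/subsetPset => x [Qx /= xi]; split => //=.
    by apply: lt_le_trans xi _; rewrite ler_nat.
  have AQ : \bigcup_m A m = Q.
    apply/seteqP; split => [x [m _ []]//|x Qx].
    by exists (Num.truncn (rho x)).+1 => //; split => //=; exact: truncnS_gt.
  rewrite AQ muQ in cvgA.
  have : \forall m \near \oo, ((3 / 4 * (2 * 1) ^+ n)%:E < mu (A m))%E.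
    apply: (cvgA [set x | ((3 / 4 * (2 * 1) ^+ n)%:E < x)%E]).
    apply: open_nbhs_nbhs; split; first exact: open_ereal_gt_ereal.
    have : 0 < (2 * 1 : R) ^+ n by rewrite exprn_gt0.
    by rewrite /= lte_fin; set c := _ ^+ n; lra.
  by move=> [m _ Hm]; exists m; exact: Hm (leqnn m).
exists eta, (k * (m%:R + m%:R) + 1); split => //.
  by rewrite ltr_wpDl// mulr_ge0// (le_trans _ k1).
move=> h hd.
pose B := (fun x => h - x) @^-1` A m.
have mB : measurable B.
  by have := measurable_reflect h measurableT (mA m); rewrite setTI.
have muB : mu B = mu (A m) by exact: lebesgue_cv_reflect.
have [AB|/set0P[x [[_ /= Ax] [_ /= Bx]]]] := eqVneq (A m `&` B) set0; last first.
  have -> : h = x + (h - x) by rewrite addrC subrK.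
  apply: (le_trans (kP _ _)); rewrite ler_wpDr// ler_wpM2l ?(le_trans _ k1)//.
  by rewrite lerD// ltW.
exfalso.
have : (mu (A m) + mu B <= mu (cube (0 : 'cV[R]_n) (1 + eta)))%E.
  rewrite -measureU//; apply: le_measure; rewrite ?inE//.
  - exact: measurableU.
  - exact: measurable_cube.
  - rewrite cubeE => x [[Qx _] i|[Qx _] i]; move: Qx; rewrite /Q cubeE => /(_ i);
    rewrite !mxE !subr0.
      by move=> /le_trans; apply; rewrite lerDl ltW.
    move=> hx; have hi := le_trans (cv_norm_coord h i) hd.
    have -> : x i ord0 = h i ord0 - (h i ord0 - x i ord0) by rewrite subKr.
    by apply: (le_trans (ler_normB _ _)); lra.
rewrite muB lebesgue_cv_cube ?addr_gt0//; apply/negP; rewrite -ltNge.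
apply: (@lt_trans _ _ (3 / 4 * (2 * 1) ^+ n + 3 / 4 * (2 * 1) ^+ n)%:E).
  by rewrite lte_fin; move: Heta; set c := _ ^+ n; set c' := _ ^+ n; lra.
by rewrite EFinD; apply: lteD.
Unshelve. all: by end_near. Qed.

Lemma rho_bounded (r : R) : exists2 M : R, 0 < M & forall x, `|x| <= r -> rho x <= M.
Proof.
have [d [M [d0 M0 HM]]] := rho_bounded_near0.
have [k k1 kP] := rho_quasi_triangle.
have k0 : 0 < k by exact: lt_le_trans k1.
have H j x : `|x| <= 2 ^+ j * d -> rho x <= (2 * k) ^+ j * M.
  elim: j x => [|j IH] x; first by rewrite !expr0 !mul1r; exact: HM.
  move=> xj; have -> : x = 2^-1 *: x + 2^-1 *: x.
    by rewrite -scalerDl (_ : _ + _ = 1) ?scale1r//; field.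
  apply: (le_trans (kP _ _)).
  have : rho (2^-1 *: x) <= (2 * k) ^+ j * M.
    by apply: IH; rewrite normrZ ger0_norm// ler_pdivrMl// mulrA -exprS.
  move=> h; apply: (@le_trans _ _ (k * ((2 * k) ^+ j * M + (2 * k) ^+ j * M))).
    by rewrite ler_pM2l// lerD.
  by rewrite exprS; lra.
have [j Hj] : exists j, r <= 2 ^+ j * d.
  exists (Num.truncn (r / d)).+1; rewrite -ler_pdivrMr//.
  apply: (le_trans (ltW (truncnS_gt _))).
  by rewrite -natrX ler_nat ltnW// ltn_expl.
exists ((2 * k) ^+ j * M); first by rewrite mulr_gt0// exprn_gt0// mulr_gt0.
by move=> x xr; apply: H; exact: le_trans xr Hj.
Qed.

(** By homogeneity [rho x] is [t] times the value of [rho] at [dil P t^-1 *m x], which is at most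
    [M] once [x] is small compared with the inverse of the norm of that matrix; [t] is such that
    [t * M = e / 2]. *)
Lemma rho_cvg0 (e : R) : 0 < e -> exists2 d : R, 0 < d &
  forall x, `|x| <= d -> rho x < e.
Proof.
move=> e0; have [M M0 HM] := rho_bounded 1.
pose t := e / (2 * M); have t0 : 0 < t by rewrite divr_gt0// mulr_gt0.
pose C := 1 + \sum_i \sum_j `|dil P t^-1 i j|.
have C0 : 0 < C by rewrite ltr_wpDr// sumr_ge0// => i _; exact: sumr_ge0.
exists C^-1; first by rewrite invr_gt0.
move=> x xC; have -> : x = dil P t *m (dil P t^-1 *m x).
  by rewrite mulmxA dilK// mul1mx.
rewrite (rho_dil qd)//; apply: (@le_lt_trans _ _ (t * M)).
  rewrite ler_pM2l//; apply: HM; apply: (le_trans (mulmx_norm_le _ _)).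
  apply: (@le_trans _ _ (C * C^-1)); last by rewrite divff ?gt_eqF.
  apply: ler_pM => //; first by rewrite sumr_ge0// => i _; exact: sumr_ge0.
  by rewrite lerDr.
by rewrite /t invfM mulrA -mulrA mulVf ?gt_eqF//; lra.
Qed.

(** In place of semicontinuity: near a point [x], the quasi-triangle inequality and [rho_cvg0] keep
    [rho y] above [rho x / (2 * k)], and this weak local bound is enough for the compactness
    argument. *)
Lemma rho_lower_bound (a b : R) : 0 < a -> exists2 m : R, 0 < m &
  forall x, a <= `|x| <= b -> m <= rho x.
Proof.
move=> a0; have [k k1 kP] := rho_quasi_triangle.
have k0 : 0 < k by exact: lt_le_trans k1.
have := @compact_shell R n a b => /compact_near_coveringP.
move=> /(_ nat \oo (fun N x => N.+1%:R^-1 <= rho x) _) H.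
have [x /= /andP[ax _]|N _ HN] := H _; last first.
  by exists N.+1%:R^-1 => [|x xab]; [rewrite invr_gt0|exact: (HN N (leqnn N))].
have rx0 : 0 < rho x by apply: (rho_gt0 qd); rewrite -normr_gt0 (lt_le_trans a0).
have e0 : 0 < rho x / (2 * k) by rewrite divr_gt0// mulr_gt0.
have [d d0 Hd] := rho_cvg0 e0.
near=> y N => /=.
have xy : rho (x - y) < rho x / (2 * k).
  apply: Hd; near: y; apply/nbhs_ballP; exists d => //= z.
  by rewrite -ball_normE /= => /ltW.
have N1 : N.+1%:R^-1 <= rho x / (2 * k).
  by apply/ltW; near: N; exact: (near_infty_natSinv_lt (PosNum e0)).
apply: (le_trans N1).
have := kP (x - y) y; rewrite subrK => h.
have : k * rho (x - y) <= rho x / 2.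
  rewrite (_ : rho x / 2 = k * (rho x / (2 * k))); first by rewrite ler_pM2l// ltW.
  by field; rewrite gt_eqF.
rewrite ler_pdivrMr ?mulr_gt0//; move: h; rewrite mulrDr; lra.
Unshelve. all: by end_near. Qed.

(* No spectral theory: for [|y| = 1] and [u] large, [rho (A_u y) = u rho y]
   exceeds the supremum of [rho] on the ball of radius [lam]. *)
Lemma dil_expand (lam : R) : 0 < lam -> exists2 u0 : R, 1 <= u0 &
  forall u z, u0 <= u -> lam * `|z| <= `|dil P u *m z|.
Proof.
move=> lam0; have [M M0 HM] := rho_bounded lam.
have [m m0 Hm] := @rho_lower_bound 1 1 ltr01.
exists (1 + (M + 1) / m); first by rewrite lerDl divr_ge0// ltW// addr_gt0.
move=> u z uu; have u0 : 0 < u.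
  by apply: lt_le_trans uu; rewrite ltr_wpDr// divr_ge0// ltW// addr_gt0.
have [->|z0] := eqVneq z 0; first by rewrite normr0 mulr0.
have nz0 : 0 < `|z| by rewrite normr_gt0.
have [y y1 zE] : exists2 y : 'cV[R]_n, `|y| = 1 & z = `|z| *: y.
  exists (`|z|^-1 *: z); last by rewrite scalerA divff ?gt_eqF// scale1r.
  by rewrite normrZ normrV ?unitfE ?gt_eqF// normr_id mulVf// gt_eqF.
rewrite [in leRHS]zE -scalemxAr normrZ normr_id mulrC ler_pM2l//.
rewrite leNgt; apply/negP => /ltW/HM; rewrite (rho_dil qd)//; apply/negP; rewrite -ltNge.
have my : m <= rho y by apply: Hm; rewrite y1 lexx.
apply: (@lt_le_trans _ _ (u * m)); last by rewrite ler_pM2l.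
have : (M + 1) / m <= u by apply: le_trans uu; rewrite lerDr.
by rewrite ler_pdivrMr//; apply: lt_le_trans; rewrite ltrDl.
Qed.

Lemma dilE_exp (s : R) : dil P (expR s) = expmxZ P s.
Proof. by rewrite dilE expRK. Qed.

Lemma rho_expmxZ (s : R) x : rho (expmxZ P s *m x) = expR s * rho x.
Proof. by rewrite -dilE_exp (rho_dil qd) ?expR_gt0. Qed.

Let continuous_orbit x : continuous (fun s => enorm (expmxZ P s *m x)).
Proof.
move=> s; apply: (@continuous_comp _ _ _ (fun s =>
  \sum_i (expmxZ P s *m x) i ord0 ^+ 2) (@Num.sqrt R));
  last exact: sqrt_continuous.
rewrite (_ : (fun s => \sum_i _) = \sum_i (fun s => (expmxZ P s *m x) i ord0 ^+ 2)); last first.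
  by apply/funext => t; rewrite fct_sumE.
apply: (@big_ind _ (fun f : R -> R => {for s, continuous f})) => //.
- exact: cst_continuous.
- by move=> f g cf cg; exact: continuousD.
move=> i _; apply: (@continuous_comp _ _ _ (fun s => (expmxZ P s *m x) i ord0) (fun y : R =>
  y ^+ 2));
  last exact: exprn_continuous.
rewrite (_ : (fun s => _) = \sum_j (fun s => expmxZ P s i j * x j ord0)); last first.
  by apply/funext => t; rewrite fct_sumE mxE.
apply: (@big_ind _ (fun f : R -> R => {for s, continuous f})) => //.
- exact: cst_continuous.
- by move=> f g cf cg; exact: continuousD.
move=> j _; apply: continuousM; [exact: continuous_expmxZ|exact: cst_continuous].
Qed.

Let orbit_IVT x (a b : R) : a <= b -> enorm (expmxZ P a *m x) <= 1 ->
  1 <= enorm (expmxZ P b *m x) ->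
  exists2 s : R, a <= s <= b & enorm (expmxZ P s *m x) = 1.
Proof.
move=> ab ha hb.
have cg := @continuous_orbit x.
move: cg ha hb; set g := (fun s => enorm (expmxZ P s *m x)).
rewrite -/(g a) -/(g b) => cg ha hb.
suff [s sab gs] : exists2 s, a <= s <= b & g s = 1 by exists s.
move: g cg ha hb => g cg ha hb.
have g1 : Num.min (g a) (g b) <= 1 <= Num.max (g a) (g b) by rewrite ge_min ha/= le_max hb orbT.
have [s sab gs] := IVT ab (continuous_subspaceT cg) g1.
by exists s => //; move: sab; rewrite in_itv.
Qed.

(** Applied to the point [dil P u^-1 *m x], the expansion of [dil_expand] becomes a contraction
    backwards in time, by the factor [lam]; this [lam] absorbs [n * |x|], hence the passage to the
    Euclidean norm. *)
Let orbit_small x : exists2 a : R, a <= 0 & enorm (expmxZ P a *m x) <= 1.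
Proof.
pose lam := 1 + n%:R * `|x|.
have lam0 : 0 < lam by rewrite ltr_wpDr// mulr_ge0.
have [u u1 Hu] := dil_expand lam0.
have u0 : 0 < u by exact: lt_le_trans u1.
exists (- ln u); first by rewrite oppr_le0 ln_ge0.
have := Hu u (expmxZ P (- ln u) *m x) (lexx _).
rewrite -[u in dil _ u]lnK ?posrE// dilE_exp mulmxA -expmxZD subrr expmxZ0 mul1mx => h.
apply: (le_trans (enorm_le_norm _)).
apply: (@le_trans _ _ (n%:R * (lam^-1 * `|x|))).
  by rewrite ler_wpM2l// ler_pdivlMl.
by rewrite mulrCA ler_pdivrMl// mulr1 /lam lerDr.
Qed.

Lemma orbit_meets_sphere x : x != 0 -> exists s : R, enorm (expmxZ P s *m x) = 1.
Proof.
move=> x0; have [a a0 Ha] := orbit_small x.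
have nx0 : 0 < `|x| by rewrite normr_gt0.
have lam0 : 0 < `|x|^-1 by rewrite invr_gt0.
have [u u1 Hu] := dil_expand lam0.
have u0 : 0 < u by exact: lt_le_trans u1.
have [|s _ Hs] := orbit_IVT (le_trans a0 (ln_ge0 u1)) Ha; last by exists s.
rewrite -dilE_exp lnK ?posrE//; apply: le_trans (norm_le_enorm _).
by have := Hu u x (lexx _); rewrite mulVf ?gt_eqF.
Qed.

Lemma rho_bounded_sphere : exists m M : R, [/\ 0 < m, 0 < M &
  forall w, enorm w = 1 -> m <= rho w <= M].
Proof.
have [M M0 HM] := rho_bounded 1.
(* From [enorm w <= n * |w|], a unit vector has [|w|] at least this large; the successor avoids a
   division by 0. *)
have a0 : 0 < (n.+1%:R)^-1 :> R by rewrite invr_gt0.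
have [m m0 Hm] := @rho_lower_bound _ 1 a0.
exists m, M; split => // w w1.
have w_le1 : `|w| <= 1 by rewrite -w1 norm_le_enorm.
rewrite HM// andbT; apply: Hm; rewrite w_le1 andbT -[_^-1]mulr1 ler_pdivrMl// -[leLHS]w1;
  apply: (le_trans (enorm_le_norm _)).
by rewrite ler_wpM2r// ler_nat.
Qed.

(** Let [m] bound [rho] from below on the sphere. If [rho x < m] and [x] were outside the Euclidean
    ball, going backwards along its orbit would decrease [rho] and yet meet the sphere. The dilation
    by [m] brings the unit ball of [rho] to this case. *)
Lemma rho_ball_bounded : exists2 b : R, 0 < b & forall x, rho x < 1 -> `|x| <= b.
Proof.
have [m [M [m0 M0 HmM]]] := rho_bounded_sphere.
have small x : rho x < m -> `|x| <= 1.
  move=> xm; rewrite leNgt; apply/negP => /ltW x1.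
  have [a a0 Ha] := orbit_small x.
  have [|s /andP[_ s0] Hs] := orbit_IVT a0 Ha.
    by rewrite expmxZ0 mul1mx (le_trans x1)// norm_le_enorm.
  have /andP[+ _] := HmM _ Hs; rewrite rho_expmxZ; apply/negP; rewrite -ltNge.
  apply: le_lt_trans xm; rewrite -[leRHS]mul1r ler_wpM2r ?rho_ge0//.
  by rewrite -expR0 ler_expR.
pose C := 1 + \sum_i \sum_j `|dil P m^-1 i j|.
have C0 : 0 < C by rewrite ltr_wpDr// sumr_ge0// => i _; exact: sumr_ge0.
exists C => // x x1.
have -> : x = dil P m^-1 *m (dil P m *m x) by rewrite mulmxA dilVK// mul1mx.
apply: (le_trans (mulmx_norm_le _ _)); rewrite -[leRHS]mulr1.
apply: ler_pM => //.
- by rewrite sumr_ge0// => i _; exact: sumr_ge0.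
- by rewrite lerDr.
- by apply: small; rewrite (rho_dil qd)// -[ltRHS]mulr1 ltr_pM2l.
Qed.

End quasi_distance_geometry.

(** * Volumes under linear maps and dilations *)

Section linear_maps.
Variables (R : realType) (n : nat).
Local Notation mu := (@lebesgue_cv R n).

Lemma measurable_mulmx (L : 'M[R]_n) :
  measurable_fun setT (fun x : 'cV[R]_n => L *m x).
Proof.
apply/measurable_fun_cvP => i; under eq_fun do rewrite mxE.
apply: measurable_sum => j; apply: measurable_funM => //.
exact: measurable_cv.
Qed.

Lemma measurable_subcv (d : measure_display) (T : measurableType d) (f g : T -> 'cV[R]_n) :
  measurable_fun setT f -> measurable_fun setT g ->
  measurable_fun setT (fun x => f x - g x).
Proof.
move=> /measurable_fun_cvP mf /measurable_fun_cvP mg; apply/measurable_fun_cvP => i.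
by under eq_fun do rewrite !mxE; exact: measurable_funB.
Qed.

(* Uniqueness of Haar measure, by Tonelli's theorem. *)
Lemma lebesgue_cv_linear_ratio (L Li : 'M[R]_n) (A B : set 'cV[R]_n) :
  L *m Li = 1%:M -> measurable A -> measurable B ->
  (mu ((mulmx L) @^-1` A) * mu B = mu A * mu ((mulmx L) @^-1` B))%E.
Proof.
move=> LLi mA mB.
have mL := measurable_mulmx L.
have mpre C : measurable C -> measurable ((fun x : 'cV[R]_n => L *m x) @^-1` C).
  by move=> mC; have := mL measurableT _ mC; rewrite setTI.
pose ind (C D : set 'cV[R]_n) (z : 'cV[R]_n * 'cV[R]_n) : \bar R :=
  (\1_C (L *m z.1) * \1_D (z.2 - L *m z.1))%:E.
have mL1 : measurable_fun setT (fun z : 'cV[R]_n * 'cV[R]_n => L *m z.1).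
  by apply: measurableT_comp => //; exact: measurable_fst.
have mind C D : measurable C -> measurable D -> measurable_fun setT (ind C D).
  move=> mC mD; apply/measurable_EFinP; apply: measurable_funM.
    have mI : measurable_fun setT (\1_C : 'cV[R]_n -> R) by exact: measurable_indic.
    exact: measurableT_comp mI mL1.
  have mI : measurable_fun setT (\1_D : 'cV[R]_n -> R) by exact: measurable_indic.
  have mS : measurable_fun setT (fun z : 'cV[R]_n * 'cV[R]_n => z.2 - L *m z.1).
    by apply: measurable_subcv; [exact: measurable_snd|exact: mL1].
  exact: measurableT_comp mI mS.
have ind0 C D z : (0 <= ind C D z)%E by rewrite lee_fin mulr_ge0.
have iter C D : measurable C -> measurable D ->
    (\int[mu]_x \int[mu]_y ind C D (x, y) = mu (mulmx L @^-1` C) * mu D)%E.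
  move=> mC mD.
  transitivity (\int[mu]_x ((\1_(mulmx L @^-1` C) x)%:E * mu D))%E.
    apply: eq_integral => x _.
    transitivity (\int[mu]_y ((\1_C (L *m x))%:E * (\1_D (y + - (L *m x)))%:E))%E.
      by [].
    rewrite ge0_integralZl//; last first.
    - have mI : measurable_fun setT (\1_D : 'cV[R]_n -> R) by exact: measurable_indic.
      have mS : measurable_fun setT (fun y : 'cV[R]_n => y - L *m x).
        by apply: measurable_subcv; [exact: measurable_id|exact: measurable_cst].
      by apply/measurable_EFinP; exact: measurableT_comp mI mS.
    congr (_ * _)%E.
    rewrite (ge0_integral_translate (- (L *m x)) (f := fun y => (\1_D y)%:E)) //.
      by rewrite integral_indic// setIT.
    by apply/measurable_EFinP; exact: measurable_indic.
  rewrite ge0_integralZr//; last first.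
    by apply/measurable_EFinP; apply: measurable_indic; exact: mpre.
  by rewrite integral_indic ?setIT//; exact: mpre.
have FA := fubini_tonelli (m1 := mu) (m2 := mu) (ind A B) (mind _ _ mA mB) (ind0 A B).
have FB := fubini_tonelli (m1 := mu) (m2 := mu) (ind B A) (mind _ _ mB mA) (ind0 B A).
apply: etrans (esym (iter _ _ mA mB)) _; apply: (etrans FA).
apply: etrans (etrans (iter _ _ mB mA) (muleC _ _)); apply: etrans (esym FB).
apply: eq_integral => y _.
have my : measurable_fun setT (fun x => ind A B (x, y)).
  by apply: (measurableT_comp (mind _ _ mA mB)); exact: measurable_pair2.
(* Since [L (Li y - x) = y - L x], reflecting [x] in this way exchanges the two indicator arguments,
   hence the roles of [A] and [B]. *)
apply: etrans (esym (ge0_integral_reflect (Li *m y) my (fun x => ind0 A B (x, y)))) _.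
apply: eq_integral => x _; rewrite /ind /= mulmxBr mulmxA LLi mul1mx subKr.
by rewrite mulrC.
Qed.

End linear_maps.

Lemma powRD_gt0 (R : realType) (x r s : R) : 0 < x ->
  x `^ (r + s) = x `^ r * x `^ s.
Proof. by move=> x0; rewrite powRD// (gt_eqF x0) implybT. Qed.

Section scaling.
Variables (R : realType) (n : nat) (P : 'M[R]_n) (rho : 'cV[R]_n -> R).
Hypothesis qd : quasi_distance P rho.
Local Notation mu := (@lebesgue_cv R n).
Local Notation gam := (\tr P).

Lemma measurable_rho_ball (t : R) : measurable [set x | rho x < t].
Proof.
have := rho_measurable qd measurableT (measurable_itv `]-oo, t[).
by rewrite setTI; congr measurable; apply/seteqP; split => x /=; rewrite in_itv.
Qed.

Lemma rho_ball_fin : (mu [set x | (rho x < 1)%R] < +oo)%E.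
Proof.
have [b b0 Hb] := rho_ball_bounded qd.
apply: (@le_lt_trans _ _ (mu (cube 0 b))); last by rewrite lebesgue_cv_cube// ltry.
apply: le_measure; rewrite ?inE.
- exact: measurable_rho_ball.
- exact: measurable_cube.
- move=> x /= /Hb xb; rewrite cubeE => i; rewrite /= !mxE subr0.
  by apply: le_trans xb; exact: cv_norm_coord.
Qed.

Lemma rho_ball_gt0 : (0 < mu [set x | (rho x < 1)%R])%E.
Proof.
have [d d0 Hd] := rho_cvg0 qd (@ltr01 R).
apply: (@lt_le_trans _ _ (mu (cube 0 d))).
  by rewrite lebesgue_cv_cube// lte_fin exprn_gt0// mulr_gt0.
apply: le_measure; rewrite ?inE.
- exact: measurable_cube.
- exact: measurable_rho_ball.
- rewrite cubeE => x xd; apply: Hd; apply/cv_norm_le; first exact: ltW.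
  by move=> i; have := xd i; rewrite mxE subr0.
Qed.

Let lebesgue_measure_scale (t : R) (A : set R) : 0 < t -> measurable A ->
  lebesgue_measure ((fun x : R => t^-1 * x) @^-1` A) = (t%:E * lebesgue_measure A)%E.
Proof.
move=> t0 mA.
have mr : measurable_fun setT ((fun x => t * x) : measurableTypeR R -> measurableTypeR R).
  exact: measurable_funM.
have mr' : measurable_fun setT ((fun x => t^-1 * x) : measurableTypeR R -> measurableTypeR R).
  exact: measurable_funM.
have ti0 : 0 <= t^-1 by rewrite invr_ge0 ltW.
have H := @lebesgue_measure_unique R (mscale (NngNum ti0)
  (measure_function_pushforward__canonical__measure_function_Measure
    lebesgue_measure mr')).
rewrite [in RHS]H//.
  by rewrite /= /mscale /pushforward /= muleA -EFinM divff ?mul1e// gt_eqF.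
move=> _ [[a b]] _ <-; rewrite /= /mscale /= /pushforward.
rewrite (_ : _ @^-1` _ = `]t * a, t * b]%classic).
  rewrite !lebesgue_measure_itv/= !lte_fin ltr_pM2l//.
  case: ifP => _; last by rewrite mule0.
  by rewrite -!EFinD -EFinM; congr _%:E; field; rewrite gt_eqF.
apply/seteqP; split => x /=; rewrite !in_itv/= ltr_pdivlMl// ler_pdivrMl//.
Qed.

(** In polar coordinates the volume is the integral of [r^(gam - 1)] over []0, t[] times [sigma S].
    The radial integral is rescaled to []0, 1[] rather than evaluated, which is legitimate even with
    infinite values. *)
Lemma rho_ball_measure (t : R) : 0 < t ->
  mu [set x | rho x < t] = ((t `^ gam)%:E * mu [set x | (rho x < 1)%R])%E.
Proof.
move=> t0; have [sigma polar] := rho_polar qd.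
pose S := [set w | rho w = 1].
have mS : measurable S.
  have := rho_measurable qd measurableT (measurable_set1 (1 : R)).
  by rewrite setTI.
pose h (r : R) : \bar R := (r `^ (gam - 1) * \1_(`]0, 1[%classic) r)%:E.
have mh : measurable_fun setT h.
  apply/measurable_EFinP; apply: measurable_funM => //.
have h0 r : (0 <= h r)%E by rewrite lee_fin mulr_ge0// powR_ge0.
have ball_polar u : 0 < u -> mu [set x | rho x < u] =
    (\int[lebesgue_measure]_r ((u `^ (gam - 1))%:E * h (u^-1 * r)%R) * sigma S)%E.
  move=> u0; have mb := measurable_rho_ball u.
  have := polar (fun x => (\1_[set x | rho x < u] x)%:E) _ (fun x => _).
  rewrite integral_indic// setIT => ->//; last first.
    by apply/measurable_EFinP; exact: measurable_indic.
  rewrite -ge0_integralZr//; last 2 first.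
  - by apply: measurable_funeM; apply: measurableT_comp => //.
  - by move=> r _; rewrite mule_ge0// lee_fin powR_ge0.
  rewrite [LHS]integral_mkcond; apply: eq_integral => r _.
  rewrite patchE; have [r0|r0] := ltP 0 r; last first.
    rewrite memNset; last by rewrite /= in_itv/= andbT; apply/negP; rewrite -leNgt.
    rewrite /h indicE memNset ?mulr0 ?mule0 ?mul0e//=.
    by rewrite in_itv/= pmulr_rgt0 ?invr_gt0// ltNge r0.
  rewrite mem_set; last by rewrite /= in_itv/= r0.
  rewrite (eq_integral (fun=> (\1_(`]0, u[%classic) r)%:E)); last first.
    move=> w /set_mem Sw; rewrite !indicE; congr (_%:R%:E); congr (nat_of_bool _).
    by apply/idP/idP => /set_mem/= hw; apply/mem_set => /=; move: hw;
      rewrite (rho_dil qd)// Sw mulr1 in_itv/= r0.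
  rewrite integral_cst// muleA; congr (_ * _)%E; rewrite /h -!EFinM mulrA; congr _%:E.
  rewrite -powRM ?invr_ge0 ?(ltW u0)//; last by rewrite mulr_ge0 ?invr_ge0 ?ltW.
  rewrite mulrA divff ?gt_eqF// mul1r; congr (_ * _); rewrite !indicE; congr (_%:R);
    congr (nat_of_bool _).
  apply/idP/idP => /set_mem/= hw; apply/mem_set => /=; move: hw;
    by rewrite !in_itv/= r0 mulr_gt0 ?invr_gt0//= ltr_pdivrMl// mulr1.
rewrite !ball_polar// muleA; congr (_ * _)%E.
have I1 u : 0 < u -> (\int[lebesgue_measure]_r ((u `^ (gam - 1))%:E * h (u^-1 * r)%R) =
    (u `^ gam)%:E * \int[lebesgue_measure]_r h r)%E.
  move=> u0; rewrite ge0_integralZl//; last 2 first.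
  - by apply: measurableT_comp => //; exact: measurable_funM.
  - by rewrite lee_fin powR_ge0.
  have mr : measurable_fun setT ((fun x => u^-1 * x) : measurableTypeR R -> measurableTypeR R).
    exact: measurable_funM.
  have u0' : 0 <= u by exact: ltW.
  rewrite (@measurable_ge0_pushforward _ _ _ _ _ _ _ (mscale (NngNum u0') lebesgue_measure) h
    mr)//; last first.
    by move=> A mA; exact: lebesgue_measure_scale.
  rewrite ge0_integral_mscale// muleA -EFinM; congr (_%:E * _)%E.
  by rewrite /= -[X in _ * X]powRr1// -powRD_gt0// subrK.
by rewrite !I1// powR1 mul1e.
Qed.

(** A linear map scales all volumes by the same ratio, by [lebesgue_cv_linear_ratio]; it is read off
    on the unit ball of [rho], of finite positive volume. No determinant of an exponential is
    computed. *)
Lemma lebesgue_cv_dil (t : R) (A : set 'cV[R]_n) : 0 < t -> measurable A ->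
  mu (mulmx (dil P t) @^-1` A) = ((t `^ (- gam))%:E * mu A)%E.
Proof.
move=> t0 mA; pose B := [set x | rho x < 1].
have mB : measurable B := measurable_rho_ball 1.
have := lebesgue_cv_linear_ratio (dilK P t0) mA mB.
have -> : mu (mulmx (dil P t) @^-1` B) = ((t `^ (- gam))%:E * mu B)%E.
  rewrite (_ : _ @^-1` _ = [set x | rho x < t^-1]); last first.
    by apply/seteqP; split => x /=; rewrite /B/= (rho_dil qd)// -ltr_pdivlMl// mulr1.
  rewrite rho_ball_measure ?invr_gt0//; congr (_%:E * _)%E.
  by rewrite -powR_inv1 ?ltW// -powRrM mulN1r.
have vB : mu B \is a fin_num by rewrite ge0_fin_numE// rho_ball_fin.
rewrite muleA => H.
have v0 : fine (mu B) != 0.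
  by rewrite gt_eqF// fine_gt0// rho_ball_gt0 rho_ball_fin.
move/(congr1 (fun x => x * ((fine (mu B))^-1)%:E)%E) : H.
rewrite -(fineK vB) -!muleA -!EFinM !divff// !mule1.
by move=> ->; rewrite mulr1 muleC.
Qed.

Lemma ge0_integral_dil (t : R) (f : 'cV[R]_n -> \bar R) : 0 < t ->
  measurable_fun setT f -> (forall x, 0 <= f x)%E ->
  (\int[mu]_x f (dil P t *m x) = (t `^ (- gam))%:E * \int[mu]_x f x)%E.
Proof.
move=> t0 mf f0; have tg0 : 0 <= t `^ (- gam) by exact: powR_ge0.
rewrite (@measurable_ge0_pushforward _ _ _ _ _ _ _ (mscale (NngNum tg0) mu) f (measurable_mulmx
  (dil P t)))//.
  by rewrite ge0_integral_mscale.
by move=> A mA; exact: lebesgue_cv_dil.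
Qed.

Lemma measurable_ellipsoid x (r : R) : measurable (ellipsoid rho x r).
Proof.
by have := measurable_reflect x measurableT (measurable_rho_ball r); rewrite setTI.
Qed.

Lemma ellipsoid_measure x (r : R) : 0 < r ->
  mu (ellipsoid rho x r) = ((r `^ gam)%:E * mu [set x | (rho x < 1)%R])%E.
Proof.
move=> r0; rewrite -rho_ball_measure//.
exact: (lebesgue_cv_reflect x (measurable_rho_ball r)).
Qed.

End scaling.

(** * From the Euclidean sphere to dyadic shells *)

Lemma ge0_integral_mrestr d (T : measurableType d) (R : realType)
    (mu : {measure set T -> \bar R}) (D : set T) (mD : measurable D) (f : T -> \bar R) :
  measurable_fun setT f -> (forall x, 0 <= f x)%E ->
  (\int[mrestr mu mD]_x f x = \int[mu]_(x in D) f x)%E.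
Proof.
move=> mf f0.
have D0 : mrestr mu mD (~` D) = 0%E by rewrite /mrestr setICl measure0.
rewrite (ge0_negligible_integral (mu := mrestr mu mD) (measurableC mD) measurableT mf (fun x _
  => f0 x) D0).
rewrite setTD setCK; apply: eq_measure_integral => A mA AD.
by rewrite /= /mrestr setIidl.
Qed.

Section polar_map.
Variables (R : realType) (n : nat) (P : 'M[R]_n).

Lemma continuous_enorm : continuous (@enorm R n).
Proof.
move=> x; apply: (@continuous_comp _ _ _ (fun x : 'cV[R]_n => \sum_i x i ord0 ^+ 2) (@Num.sqrt R));
  last exact: sqrt_continuous.
rewrite (_ : (fun x : 'cV[R]_n => \sum_i _) = \sum_i (fun x : 'cV[R]_n => x i ord0 ^+ 2));
  last first.
  by apply/funext => t; rewrite fct_sumE.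
apply: (@big_ind _ (fun f : 'cV[R]_n -> R => {for x, continuous f})) => //.
- exact: cst_continuous.
- by move=> f g cf cg; exact: continuousD.
move=> i _; apply: (@continuous_comp _ _ _ (fun x : 'cV[R]_n => x i ord0) (fun y : R => y ^+ 2)).
  exact: coord_continuous.
exact: exprn_continuous.
Qed.

Definition annulus : set 'cV[R]_n := [set x | 2^-1 < enorm x < 1].

Lemma open_annulus : open annulus.
Proof.
rewrite (_ : annulus = @enorm R n @^-1` [set` `]2^-1, 1[]); last first.
  by apply/seteqP; split => x; rewrite /annulus /= in_itv.
by apply: open_comp; [move=> x _; exact: continuous_enorm|exact: itv_open].
Qed.

Lemma measurable_annulus : measurable annulus.
Proof.
have := @measurable_enorm R n measurableT _ (measurable_itv `]2^-1, 1[).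
by rewrite setTI; congr measurable; apply/seteqP; split => x; rewrite /annulus /= in_itv.
Qed.

Lemma annulus_fin : (lebesgue_cv annulus < +oo)%E.
Proof.
apply: (@le_lt_trans _ _ (lebesgue_cv (cube (0 : 'cV[R]_n) 1)));
  last by rewrite lebesgue_cv_cube// ltry.
apply: le_measure; rewrite ?inE.
- exact: measurable_annulus.
- exact: measurable_cube.
- move=> x /andP[_ x1]; rewrite cubeE => i; rewrite /= !mxE subr0.
  by apply: le_trans (ltW x1); apply: le_trans (norm_le_enorm x); exact: cv_norm_coord.
Qed.

Let enorm_lip (y u : 'cV[R]_n) : annulus y -> annulus u ->
  `|enorm y - enorm u| <= (n%:R * 2) * `|y - u|.
Proof.
move=> /andP[y0 y1] /andP[u0 u1].
have E (x : 'cV[R]_n) : enorm x ^+ 2 = \sum_i x i ord0 ^+ 2.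
  by rewrite sqr_sqrtr// sumr_ge0// => i _; exact: sqr_ge0.
(* Multiplying by this sum does not decrease the left side and produces a difference of squares,
   which is a polynomial in the coordinates. *)
have s1 : 1 <= enorm y + enorm u by lra.
apply: (@le_trans _ _ (`|enorm y - enorm u| * (enorm y + enorm u))).
  by rewrite ler_peMr.
rewrite -[X in _ * X <= _]ger0_norm ?(le_trans ler01 s1)// -normrM -subr_sqr !E -sumrB.
apply: (le_trans (ler_norm_sum _ _ _)).
apply: (@le_trans _ _ (\sum_(i < n) 2 * `|y - u|)).
  apply: ler_sum => i _; rewrite subr_sqr normrM mulrC; apply: ler_pM => //.
    apply: (le_trans (ler_normD _ _)).
    have := le_trans (cv_norm_coord y i) (norm_le_enorm y).
    have := le_trans (cv_norm_coord u i) (norm_le_enorm u).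
    by lra.
  by have := cv_norm_coord (y - u) i; rewrite !mxE.
by rewrite sumr_const card_ord -[leLHS]mulr_natl mulrA.
Qed.

Let radial_le1 (y : 'cV[R]_n) i : annulus y -> `|radial y i ord0| <= 1.
Proof.
move=> /andP[y0 y1]; have e0 : 0 < enorm y by lra.
rewrite mxE normrM ger0_norm ?invr_ge0 ?enorm_ge0// ler_pdivrMl// mulr1.
exact: le_trans (cv_norm_coord y i) (norm_le_enorm y).
Qed.

Let radial_lip (y u : 'cV[R]_n) i : annulus y -> annulus u ->
  `|radial y i ord0 - radial u i ord0| <= (2 + 4 * (n%:R * 2)) * `|y - u|.
Proof.
move=> Ay Au; have /andP[y0 y1] := Ay; have /andP[u0 u1] := Au.
have ey0 : 0 < enorm y by lra.
have eu0 : 0 < enorm u by lra.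
have Vle (x : R) : 2^-1 < x -> x^-1 <= 2.
  move=> x0; rewrite -[leRHS]invrK lef_pV2 ?posrE ?invr_gt0//; first exact: ltW.
  by lra.
have -> : radial y i ord0 - radial u i ord0 =
    (enorm y)^-1 * (y i ord0 - u i ord0) +
    (enorm y)^-1 * (enorm u)^-1 * (enorm u - enorm y) * u i ord0.
  by rewrite !mxE; field; rewrite !gt_eqF.
apply: (le_trans (ler_normD _ _)); rewrite mulrDl; apply: lerD.
  rewrite normrM; apply: ler_pM => //.
    by rewrite ger0_norm ?invr_ge0 ?enorm_ge0// Vle.
  by have := cv_norm_coord (y - u) i; rewrite !mxE.
rewrite -[leRHS]mulr1 normrM; apply: ler_pM => //; last first.
  by apply: le_trans (ltW u1); exact: le_trans (cv_norm_coord u i) (norm_le_enorm u).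
rewrite normrM -[leRHS]mulrA; apply: ler_pM => //.
  rewrite normrM !ger0_norm ?invr_ge0 ?enorm_ge0//.
  rewrite (_ : 4 = 2 * 2); last by lra.
  by apply: ler_pM; rewrite ?invr_ge0 ?enorm_ge0// Vle.
by rewrite distrC; exact: enorm_lip.
Qed.

(* [4 |y| - 3] maps the annulus [1/2 < |y| < 1] onto [-1 < s < 1]: the radius
   is turned into a time along the orbit of the direction of [y]. *)
Definition polar_map (b : R) (y : 'cV[R]_n) : 'cV[R]_n :=
  expmxZ P ((4 * enorm y - 3) * b) *m radial y.

Lemma measurable_polar_map b : measurable_fun setT (polar_map b).
Proof.
apply/measurable_fun_cvP => i; under eq_fun do rewrite mxE.
apply: measurable_sum => j; apply: measurable_funM.
  apply: (@measurableT_comp _ _ _ _ _ _ (fun s => expmxZ P s i j)).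
    by apply: continuous_measurable_fun; exact: continuous_expmxZ.
  apply: measurable_funM => //; apply: measurable_funB => //.
  by apply: measurable_funM => //; exact: measurable_enorm.
apply: (measurableT_comp (f := fun x : 'cV[R]_n => x j ord0)).
  exact: measurable_cv.
exact: measurable_radial.
Qed.

Lemma polar_map_lipschitz b : 0 < b -> exists2 L : R, 0 < L &
  forall u y, annulus u -> annulus y -> `|polar_map b y - polar_map b u| <= L * `|y - u|.
Proof.
move=> b0; have [C C0 HC] := expmxZ_bounded P (- b) b.
have [D D0 HD] := expmxZ_lipschitz P (- b) b.
pose L := n%:R * (D * (4 * (n%:R * 2) * b) + C * (2 + 4 * (n%:R * 2))).
have L0 : 0 <= L.
  by rewrite /L mulr_ge0// addr_ge0// !(mulr_ge0, addr_ge0)// ltW.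
exists (1 + L); first by rewrite ltr_wpDr.
move=> u y Au Ay; apply: (@le_trans _ _ (L * `|y - u|)); last by rewrite ler_wpM2r// lerDr.
apply/cv_norm_le => [|i]; first by rewrite mulr_ge0.
have rng x : annulus x -> - b <= (4 * enorm x - 3) * b <= b.
  by move=> /andP[x0 x1]; apply/andP; split; nra.
rewrite /polar_map !mxE -sumrB; apply: (le_trans (ler_norm_sum _ _ _)).
rewrite (_ : L * _ = \sum_(j < n)
    (D * (4 * (n%:R * 2) * b) + C * (2 + 4 * (n%:R * 2))) * `|y - u|); last first.
  by rewrite sumr_const card_ord -[RHS]mulr_natl mulrA.
apply: ler_sum => j _.
set Ey := expmxZ P _ i j; set Eu := expmxZ P _ i j.
have -> : Ey * radial y j ord0 - Eu * radial u j ord0 =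
    (Ey - Eu) * radial y j ord0 + Eu * (radial y j ord0 - radial u j ord0) by ring.
apply: (le_trans (ler_normD _ _)); rewrite [leRHS]mulrDl; apply: lerD.
  rewrite normrM -[leRHS]mulr1; apply: ler_pM => //; last exact: radial_le1.
  apply: (le_trans (HD _ _ _ _ (rng _ Ay) (rng _ Au))).
  rewrite -mulrA ler_pM2l// -mulrBl normrM (ger0_norm (ltW b0)).
  rewrite (_ : _ - _ = 4 * (enorm y - enorm u)); last by ring.
  rewrite normrM ger0_norm// -!mulrA ler_pM2l// [leRHS](_ : _ = n%:R * 2 * `|y - u| * b);
    last by ring.
  by rewrite ler_pM2r// enorm_lip.
rewrite normrM -mulrA; apply: ler_pM => //; first by rewrite HC// rng.
exact: radial_lip.
Qed.

Variables (rho : 'cV[R]_n -> R).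
Hypothesis qd : quasi_distance P rho.

(** A point [x] of the shell is reached from a unit vector [w] in time [- s], where
    [expR s * rho x = rho w]. Since [rho w] lies between [m] and [M] and [rho x] between 1/2 and 1,
    [s] lies between [ln m] and [ln (2 * M)]; [b] exceeds both in absolute value. *)
Lemma polar_map_onto : exists2 b : R, 0 < b &
  forall x, 2^-1 <= rho x < 1 -> exists y, [/\ annulus y, polar_map b y = x &
    exists s, x = expmxZ P s *m radial y].
Proof.
have [m [M [m0 M0 HmM]]] := rho_bounded_sphere qd.
pose b := 1 + (`|ln m| + `|ln (2 * M)|).
have b0 : 0 < b by rewrite ltr_wpDr.
exists b => // x /andP[x0 x1].
have xn0 : x != 0.
  by apply: contraTneq x0 => ->; rewrite (rho0 qd) -ltNge invr_gt0.
have [s Hs] := orbit_meets_sphere qd xn0.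
have /andP[wm wM] := HmM _ Hs; rewrite (rho_expmxZ qd) in wm wM.
set w := expmxZ P s *m x in Hs.
have xE : x = expmxZ P (- s) *m w by rewrite /w mulmxA expmxZ_unit mul1mx.
have rx0 : 0 < rho x by lra.
have s_lo : ln m < s.
  rewrite -ltr_expR lnK ?posrE//; apply: (le_lt_trans wm).
  by rewrite -[ltRHS]mulr1 ltr_pM2l ?expR_gt0.
have s_hi : s <= ln (2 * M).
  rewrite -ler_expR lnK ?posrE ?mulr_gt0//.
  have : expR s * 2^-1 <= M by apply: le_trans wM; rewrite ler_pM2l ?expR_gt0.
  by rewrite ler_pdivrMr// mulrC.
have sb : - b < - s < b.
  have := ler_norm (ln (2 * M)); have := lerNnormlW (lexx `|ln m|).
  have := normr_ge0 (ln m); have := normr_ge0 (ln (2 * M)).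
  by move=> ? ? ? ?; rewrite /b; apply/andP; split; lra.
(* The radius at which [polar_map b] runs for the time [- s], that is [(4 * e - 3) * b = - s]. *)
pose e := (- s / b + 3) / 4.
have e01 : 2^-1 < e < 1.
  have /andP[h1 h2] : -1 < - s / b < 1.
    by rewrite ltr_pdivrMr// mul1r ltr_pdivlMr// mulN1r.
  by rewrite /e; apply/andP; split; lra.
have /andP[e0 e1] := e01.
have ee0 : 0 < e by lra.
have wn : enorm (e *: w) = e by rewrite enormZ Hs mulr1 ger0_norm// ltW.
have rw : radial (e *: w) = w by rewrite /radial wn scalerA mulVf ?gt_eqF// scale1r.
exists (e *: w); split.
- by rewrite /annulus /= wn.
- rewrite /polar_map rw wn [RHS]xE; congr (expmxZ P _ *m w).
  by rewrite /e; field; rewrite gt_eqF.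
- by exists (- s); rewrite rw.
Qed.

End polar_map.

Section surface.
Variables (R : realType) (n : nat).
Local Notation mu := (@lebesgue_cv R n).
Local Notation surf := (@surface_measure R n).

Lemma unit_ball_gt0 : 0 < fine (mu (@unit_ball R n)).
Proof.
pose r : R := (2 * n.+1%:R)^-1.
have r0 : 0 < r by rewrite invr_gt0 mulr_gt0.
apply: fine_gt0; apply/andP; split.
  apply: (@lt_le_trans _ _ (mu (cube 0 r))).
    by rewrite lebesgue_cv_cube// lte_fin exprn_gt0// mulr_gt0.
  apply: le_measure; rewrite ?inE.
  - exact: measurable_cube.
  - exact: measurable_unit_ball.
  - rewrite cubeE => x xr; rewrite /unit_ball/=; apply: (le_lt_trans (enorm_le_norm _)).
    have xr' : `|x| <= r.
      by apply/cv_norm_le; [exact: ltW|move=> i; have := xr i; rewrite mxE subr0].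
    apply: (@le_lt_trans _ _ (n.+1%:R * r)).
      by apply: ler_pM => //; rewrite ler_nat.
    by rewrite /r invfM mulrCA mulfV// mulr1; lra.
apply: (@le_lt_trans _ _ (mu (cube 0 1))); last by rewrite lebesgue_cv_cube// ltry.
apply: le_measure; rewrite ?inE.
- exact: measurable_unit_ball.
- exact: measurable_cube.
- move=> x /ltW x1; rewrite cubeE => i; rewrite /= !mxE subr0.
  by apply: le_trans x1; apply: le_trans (norm_le_enorm x); exact: cv_norm_coord.
Qed.

Lemma surface_null (N : set 'cV[R]_n) : measurable N -> surf N = 0%E ->
  mu (@radial R n @^-1` N `&` @unit_ball R n) = 0%E.
Proof.
move=> mN; rewrite /surface_measure => /eqP; rewrite mule_eq0 => /orP[|/eqP//].
by rewrite eqe invr_eq0 gt_eqF// unit_ball_gt0.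
Qed.

Lemma surface_fin : (surf setT < +oo)%E.
Proof.
rewrite /surface_measure preimage_setT setTI.
have B0 := unit_ball_gt0.
have Bf : mu (@unit_ball R n) \is a fin_num.
  by case: (mu (@unit_ball R n)) B0 => //=; rewrite ltxx.
by rewrite -(fineK Bf) -EFinM ltry.
Qed.

Lemma ge0_integral_surface (f : 'cV[R]_n -> \bar R) :
  measurable_fun setT f -> (forall x, 0 <= f x)%E ->
  (\int[mu]_(x in @unit_ball R n) f (radial x) =
   (fine (mu (@unit_ball R n)))%:E * \int[surf]_x f x)%E.
Proof.
move=> mf f0; have B0 := unit_ball_gt0.
have c0 : 0 <= (fine (mu (@unit_ball R n)))^-1 by rewrite invr_ge0 ltW.
pose nu := mscale (NngNum c0)
  (measure_function_pushforward__canonical__measure_function_Measure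
    (mrestr mu (@measurable_unit_ball R n)) (@measurable_radial R n)).
have -> : (\int[surf]_x f x = \int[nu]_x f x)%E.
  by apply: eq_measure_integral => A mA _.
rewrite ge0_integral_mscale// muleA -EFinM mulfV ?gt_eqF// mul1e.
rewrite -(ge0_integral_mrestr mu (@measurable_unit_ball R n) (measurableT_comp mf
  (@measurable_radial R n)) (fun x => f0 (radial x))).
apply: (measurable_ge0_pushforward (@measurable_radial R n)) => //.
Qed.

End surface.

(** * Integrals of powers of the homogeneous function over shells *)

Section shell_integral.
Variables (R : realType) (n : nat) (P : 'M[R]_n) (rho : 'cV[R]_n -> R).
Hypothesis qd : quasi_distance P rho.
Local Notation mu := (@lebesgue_cv R n).
Local Notation surf := (@surface_measure R n).
Local Notation gam := (\tr P).
Variables (Omega g h : 'cV[R]_n -> R).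
Hypothesis hom : homogeneous0 P Omega.
Hypothesis (mg : measurable_fun setT g) (mh : measurable_fun setT h).
Hypothesis Og : {ae mu, forall x, Omega x = g x}.
Hypothesis Oh : {ae surf, forall x, Omega x = h x}.

Definition shell (t : R) : set 'cV[R]_n := [set x | t / 2 <= rho x < t].

Lemma measurable_shell t : measurable (shell t).
Proof.
have := rho_measurable qd measurableT (measurable_itv `[t / 2, t[).
by rewrite setTI; congr measurable; apply/seteqP; split => x /=; rewrite in_itv.
Qed.

(** For [x] in the shell off the null set of [g], the values [g x], [Omega x] and [Omega] at the
    direction of its preimage agree; so [h] at that direction lies in [Y], unless the direction is
    in the null set of [h]. The cone over the latter has volume 0, and so has its Lipschitz
    image. *)
Let measure_shell_le : exists2 C : R, 0 < C & forall Y : set R, measurable Y ->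
  (mu (shell 1 `&` g @^-1` Y) <=
   C%:E * mu (@annulus R n `&` (fun x => h (radial x)) @^-1` Y))%E.
Proof.
have [b b0 Honto] := polar_map_onto qd.
have [L L0 HL] := polar_map_lipschitz P b0.
exists (L ^+ n); first by rewrite exprn_gt0.
move=> Y mY.
have [N0 [mN0 N00 N0P]] := Og; have [N1 [mN1 N10 N1P]] := Oh.
have mr := @measurable_radial R n.
have mhr : measurable_fun setT (fun x => h (radial x)) by exact: measurableT_comp.
have mA1 : measurable (@annulus R n `&` (fun x => h (radial x)) @^-1` Y).
  apply: measurableI; first exact: measurable_annulus.
  by have := mhr measurableT _ mY; rewrite setTI.
have mA2 : measurable (@annulus R n `&` @radial R n @^-1` N1).
  apply: measurableI; first exact: measurable_annulus.
  by have := mr measurableT _ mN1; rewrite setTI.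
have mV : measurable (shell 1 `&` g @^-1` Y).
  apply: measurableI; first exact: measurable_shell.
  by have := mg measurableT mY; rewrite setTI.
have A20 : mu (@annulus R n `&` @radial R n @^-1` N1) = 0%E.
  apply: (subset_measure0 _ _ _ (surface_null mN1 N10)) => //.
    apply: measurableI; last exact: measurable_unit_ball.
    by have := mr measurableT _ mN1; rewrite setTI.
  by move=> x [/andP[_ x1] Nx].
pose A := (@annulus R n `&` (fun x => h (radial x)) @^-1` Y) `|`
  (@annulus R n `&` @radial R n @^-1` N1).
apply: (@le_trans _ _ (mu ((shell 1 `&` g @^-1` Y) `\` N0))).
  apply: (@le_trans _ _ (mu (((shell 1 `&` g @^-1` Y) `\` N0) `|` N0))).
    apply: le_measure; rewrite ?inE//.
      by apply: measurableU => //; exact: measurableD.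
    by move=> x Vx; have [N0x|N0x] := pselect (N0 x); [right|left].
  rewrite (le_trans (measureU2 _ _ _))//; first exact: measurableD.
  by rewrite [X in (_ + X)%E](_ : _ = 0%E) ?adde0.
have := @lipschitz_image R n (polar_map P b) L (@annulus R n) A
  ((shell 1 `&` g @^-1` Y) `\` N0) L0 (measurable_polar_map P b)
  (@open_annulus R n) (@measurable_annulus R n) (@annulus_fin R n) HL.
move=> /(_ _ _ _ _) H; apply: (le_trans (H _ _ _ _)).
- exact: measurableU.
- by move=> x [[]|[]].
- exact: measurableD.
- move=> x [[Vx Yx] N0x].
  have [|y [Ay yx [s xs]]] := Honto x.
    by move: Vx; rewrite /shell /= mul1r.
  exists y => //.
  have Oxg : Omega x = g x by apply: contrapT => ne; apply: N0x; exact: N0P.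
  have OxO : Omega x = Omega (radial y).
    by rewrite xs -dilE_exp hom// expR_gt0.
  have [N1y|N1y] := pselect (N1 (radial y)); [by right|left; split => //=].
  have <- : Omega (radial y) = h (radial y).
    by apply: contrapT => ne; apply: N1y; exact: N1P.
  by rewrite -OxO Oxg.
apply: lee_wpmul2l; first by rewrite lee_fin exprn_ge0// ltW.
rewrite (le_trans (measureU2 _ _ _))//.
by rewrite [X in (_ + X)%E](_ : _ = 0%E) ?adde0.
Qed.

(** The previous bound, valid for every Borel [Y], compares two image measures on the line, under
    [g] and under [h] of the direction; hence it extends to all nonnegative [F]. *)
Let integral_shell_le : exists2 C : R, 0 < C & forall F : R -> \bar R,
  measurable_fun setT F -> (forall y, 0 <= F y)%E ->
  (\int[mu]_(x in shell 1) F (g x) <= C%:E * \int[surf]_x F (h x))%E.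
Proof.
have [C C0 HC] := measure_shell_le.
have B0 := @unit_ball_gt0 R n.
exists (C * fine (mu (@unit_ball R n))); first by rewrite mulr_gt0.
move=> F mF F0; have mr := @measurable_radial R n.
have mhr : measurable_fun setT (fun x => h (radial x)) by exact: measurableT_comp.
have mFhr : measurable_fun setT (fun x => F (h (radial x))) by exact: measurableT_comp mF mhr.
rewrite EFinM -muleA -(ge0_integral_surface (f := fun x => F (h x)))//;
  last exact: measurableT_comp.
apply: (@le_trans _ _ (C%:E * \int[mu]_(x in @annulus R n) F (h (radial x)))%E); last first.
  apply: lee_wpmul2l; first by rewrite lee_fin ltW.
  apply: ge0_subset_integral => //.
  - exact: measurable_annulus.
  - exact: measurable_unit_ball.
  - exact: measurable_funTS.
  - by move=> x /andP[].
rewrite -(ge0_integral_mrestr mu (measurable_shell 1) (measurableT_comp mF mg) (fun x => F0 (g x))).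
rewrite -(ge0_integral_mrestr mu (@measurable_annulus R n) mFhr)//.
have C0' : 0 <= C by exact: ltW.
pose m1 := measure_function_pushforward__canonical__measure_function_Measure
    (mrestr mu (measurable_shell 1)) mg.
pose m2 := measure_function_pushforward__canonical__measure_function_Measure
    (mrestr mu (@measurable_annulus R n)) mhr.
have -> : (\int[mrestr mu (measurable_shell 1)]_x (F \o g) x = \int[m1]_y F y)%E.
  exact: (measurable_ge0_pushforward mg).
have -> : (\int[mrestr mu (@measurable_annulus R n)]_x F (h (radial x)) = \int[m2]_y F y)%E.
  exact: (measurable_ge0_pushforward mhr).
rewrite (_ : C%:E = (NngNum C0')%:num%:E)// -ge0_integral_mscale//.
apply: ge0_le_measure_integral => // Y mY.
rewrite /= /mscale /= /pushforward /mrestr /=.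
by have := HC _ mY; rewrite setIC [X in (_ <= _ * mu X)%E]setIC.
Qed.

(** The sphere has finite measure, so that [L_s] is contained in [L_a]; this gives the case [t = 1].
    The dilation by [t] leaves [Omega] unchanged and multiplies volumes by [t^gam]. *)
Lemma shell_integral_le (s : \bar R) (a : R) : (1 < s)%E -> 0 < a -> (a%:E <= s)%E ->
  ('N[surf]_s[EFin \o Omega] < +oo)%E ->
  exists2 W : R, 0 < W & forall t, 0 < t ->
    (\int[mu]_(x in shell t) (`|g x| `^ a)%:E <= (W * t `^ gam)%:E)%E.
Proof.
move=> s1 a0 as_ Ns.
have mabs : measurable_fun setT (fun y : R => (`|y| `^ a)%:E).
  apply/measurable_EFinP; apply: (measurableT_comp (f := @powR R ^~ a)) => //.
have abs0 (y : R) : (0 <= (`|y| `^ a)%:E)%E by rewrite lee_fin powR_ge0.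
have mga : measurable_fun setT (fun x => (`|g x| `^ a)%:E) by exact: measurableT_comp mabs mg.
have int_h : (\int[surf]_x (`|h x| `^ a)%:E < +oo)%E.
  move: s s1 as_ Ns => [s| |]//.
    rewrite lte_fin lee_fin => s1 as_; rewrite unlock => Ns.
    have s0 : 0 < s by lra.
    have {}Ns : (\int[surf]_x (`|h x| `^ s)%:E < +oo)%E.
      apply: (@lty_poweRy _ _ s^-1); first by rewrite invr_eq0 gt_eqF.
      apply: le_lt_trans Ns; rewrite le_eqVlt; apply/orP; left; apply/eqP.
      apply: (congr1 (@poweR R ^~ s^-1)); apply: ae_eq_integralT; apply: filterS Oh => x Ox.
      by rewrite /= Ox -poweR_EFin.
    apply: (@le_lt_trans _ _ (\int[surf]_x (1 + (`|h x| `^ s)%:E))%E).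
      apply: le_integral_nonmeas => // x _; rewrite -EFinD lee_fin.
      have [h1|h1] := leP 1 `|h x|.
        by apply: (@le_trans _ _ (`|h x| `^ s)); [exact: ler_powR|rewrite lerDr].
      apply: (@le_trans _ _ 1); last by rewrite lerDl powR_ge0.
      rewrite [leRHS](_ : 1 = 1 `^ a); last by rewrite powR1.
      apply: ge0_ler_powR; rewrite ?nnegrE//; exact: ltW.
    rewrite ge0_integralD//; last first.
      apply/measurable_EFinP; apply: (measurableT_comp (f := @powR R ^~ s)) => //.
      exact: measurableT_comp.
    rewrite lte_add_pinfty// integral_cst// mul1e; exact: surface_fin.
  (* For [s = +oo] the norm is the essential supremum if the measure is nonzero and 0 by convention
     otherwise; in the latter case the integral vanishes. *)
  move=> _ _; rewrite unlock; case: ifPn => [_ Ns|]; last first.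
    rewrite -leNgt => sT _.
    rewrite (_ : (\int[surf]_x _ = 0)%E)//.
    have sT0 : surf setT = 0%E by apply/eqP; rewrite eq_le sT measure_ge0.
    have mha : measurable_fun setT (fun x => (`|h x| `^ a)%:E) by exact: measurableT_comp mabs mh.
    rewrite (ge0_negligible_integral measurableT measurableT mha (fun x _ => abs0 _) sT0).
    by rewrite setDv integral_set0.
  have [M HM] : exists M : R, {ae surf, forall x, `|h x| <= M}.
    have [M HM] : exists M : R, (ess_sup_inf.ess_sup surf (abse \o (EFin \o Omega)) <= M%:E)%E.
      by case: (ess_sup_inf.ess_sup _ _) Ns => [M| |]// _; [exists M|exists 0; rewrite leNye].
    exists M; move/ess_sup_inf.ess_supP : HM => HM; near=> x.
    rewrite -(near Oh x)// -lee_fin.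
    exact: (near HM x).
  apply: (@le_lt_trans _ _ (\int[surf]_x (cst (Num.max M 0 `^ a)%:E x))%E).
    apply: ae_le_integralT => //.
      by move=> x; rewrite lee_fin powR_ge0.
    apply: filterS HM => x hM; rewrite /= lee_fin; apply: ge0_ler_powR; rewrite ?nnegrE//.
    - exact: ltW.
    - by rewrite le_max lexx orbT.
    - by rewrite le_max hM.
  rewrite integral_cst//; apply: lte_mul_pinfty => //; last exact: surface_fin.
  by rewrite lee_fin powR_ge0.
have [C C0 HC] := integral_shell_le.
pose W := 1 + C * fine (\int[surf]_x (`|h x| `^ a)%:E).
have int0 : (0 <= \int[surf]_x (`|h x| `^ a)%:E)%E by apply: integral_ge0.
have Wle : (\int[mu]_(x in shell 1) (`|g x| `^ a)%:E <= W%:E)%E.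
  apply: (le_trans (HC _ mabs abs0)).
  rewrite -[X in (_ * X)%E]fineK ?ge0_fin_numE// -EFinM lee_fin.
  by rewrite /W lerDr.
have W0 : 0 < W by rewrite ltr_wpDr// mulr_ge0 ?fine_ge0// ltW.
exists W => // t t0.
pose f x : \bar R := (\1_(shell t) x * `|g x| `^ a)%:E.
have mf : measurable_fun setT f.
  apply/measurable_EFinP; apply: measurable_funM; last exact/measurable_EFinP.
  by apply: measurable_indic; exact: measurable_shell.
have f0 x : (0 <= f x)%E by rewrite lee_fin mulr_ge0// powR_ge0.
have patchf D : ((fun x => (`|g x| `^ a)%:E) \_ D) =
    (fun x => (\1_D x * `|g x| `^ a)%:E).
  by apply/funext => x; rewrite patchE indicE; case: ifPn => _; rewrite ?mul1r ?mul0r.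
have -> : (\int[mu]_(x in shell t) (`|g x| `^ a)%:E = \int[mu]_x f x)%E.
  by rewrite integral_mkcond patchf.
have := ge0_integral_dil qd t0 mf f0.
have -> : (\int[mu]_x f (dil P t *m x) = \int[mu]_(x in shell 1) (`|g x| `^ a)%:E)%E.
  rewrite [RHS]integral_mkcond patchf; apply: ae_eq_integralT.
  (* Homogeneity holds everywhere for [Omega] but only almost everywhere for [g]; it is transferred
     because preimages of null sets under a dilation are null. *)
  have Ogt : {ae mu, forall x, Omega (dil P t *m x) = g (dil P t *m x)}.
    have [N [mN N0 NP]] := Og.
    exists (mulmx (dil P t) @^-1` N); split => //.
    - by have := measurable_mulmx (dil P t) measurableT mN; rewrite setTI.
    - by have := lebesgue_cv_dil qd t0 mN; rewrite N0 mule0.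
    - by move=> x /= ne; apply: NP.
  near=> x.
  rewrite /f; congr (_ * _)%:E; last first.
    congr (`|_| `^ _); rewrite -(near Ogt x)// -(near Og x)//; exact: hom.
  rewrite !indicE; congr (_%:R); congr (nat_of_bool _).
  apply/idP/idP => /set_mem/= H; apply/mem_set; move: H;
    rewrite /shell /= (rho_dil qd)// mul1r => /andP[h1 h2]; apply/andP; split.
  - by move: h1; rewrite ler_pM2l.
  - by move: h2; rewrite -[ltRHS]mulr1 ltr_pM2l.
  - by rewrite ler_pM2l.
  - by rewrite -[ltRHS]mulr1 ltr_pM2l.
move=> H; have tg0 : 0 < t `^ gam by exact: powR_gt0.
have -> : (\int[mu]_x f x = (t `^ gam)%:E * \int[mu]_(x in shell 1) (`|g x| `^ a)%:E)%E.
  by rewrite H muleA -EFinM powRN mulfV ?gt_eqF// mul1e.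
rewrite mulrC EFinM; apply: lee_wpmul2l => //; by rewrite lee_fin ltW.
Unshelve. all: by end_near. Qed.

End shell_integral.

(** * Potentials *)

Section shell_summation.
Context d (T : measurableType d) (R : realType) (mu : {measure set T -> \bar R}).
Variables (r : T -> R) (G : T -> \bar R) (W a : R).
Hypotheses (mr : measurable_fun setT r) (mG : measurable_fun setT G).
Hypotheses (r0 : forall x, 0 <= r x) (G0 : forall x, (0 <= G x)%E) (W0 : 0 <= W).
Hypothesis GW : forall t : R, 0 < t ->
  (\int[mu]_(x in [set x | (t / 2 <= r x < t)%R]) G x <= (W * t `^ a)%:E)%E.

Let mshell (t : R) : measurable [set x | t / 2 <= r x < t].
Proof.
have := mr measurableT (measurable_itv `[t / 2, t[).
by rewrite setTI; congr measurable; apply/seteqP; split => x /=; rewrite in_itv.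
Qed.

Let powR_shell (c t y : R) : 0 < t -> t / 2 <= y < t -> y `^ c <= 2 `^ `|c| * t `^ c.
Proof.
move=> t0 /andP[ty yt]; have y0 : 0 < y by lra.
have one2 : 1 <= 2 `^ `|c| :> R.
  by rewrite -[leLHS](powRr0 2) ler_powR// ler1n.
have [c0|c0] := leP 0 c.
  apply: (@le_trans _ _ (t `^ c)); last by rewrite ler_peMl// powR_ge0.
  by apply: ge0_ler_powR; rewrite ?nnegrE// ltW.
have cE : c = - `|c| by rewrite ltr0_norm// opprK.
have h : t `^ `|c| <= 2 `^ `|c| * y `^ `|c|.
  rewrite -powRM ?(ltW y0)//; apply: ge0_ler_powR;
    rewrite ?nnegrE ?normr_ge0 ?mulr_ge0 ?(ltW t0) ?(ltW y0)//.
  by lra.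
rewrite [in leLHS]cE [X in _ <= _ * _ `^ X]cE !powRN.
by rewrite ler_pdivlMr ?powR_gt0// ler_pdivrMl ?powR_gt0// mulrC.
Qed.

Let geometric_le (K th : R) : 0 <= K -> 0 <= th < 1 ->
  (\sum_(0 <= j <oo) (K * th ^+ j)%:E <= (K / (1 - th))%:E)%E.
Proof.
move=> K0 /andP[th0 th1].
apply: lime_le.
  by apply: is_cvg_nneseries => j _ _; rewrite lee_fin mulr_ge0// exprn_ge0.
near=> N; rewrite sumEFin lee_fin -mulr_sumr ler_wpM2l//.
rewrite -[leRHS]mul1r ler_pdivlMr ?subr_gt0//.
have E m : (\sum_(0 <= i < m) th ^+ i) * (1 - th) = 1 - th ^+ m.
  elim: m => [|m IH]; first by rewrite big_geq// mul0r expr0 subrr.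
  by rewrite big_nat_recr//= mulrDl IH exprSr; ring.
rewrite E.
by rewrite gerBl exprn_ge0.
Unshelve. all: by end_near. Qed.

(** The ratio [b] will be 1/2 for shells shrinking to 0 and 2 for shells growing to infinity. In
    both cases the shell of index [j] contributes a multiple of the [j]-th power of [b^(a + c)], so
    the series is geometric. *)
Lemma integral_shells_le (D : set T) (c t0 b : R) : c != 0 -> 0 < t0 -> 0 < b ->
  b `^ (a + c) < 1 -> measurable D ->
  (forall x, D x -> 0 < r x -> exists j : nat, t0 * b ^+ j / 2 <= r x < t0 * b ^+ j) ->
  (\int[mu]_(x in D) (G x * (r x `^ c)%:E) <=
    (2 `^ `|c| / (1 - b `^ (a + c)) * W * t0 `^ (a + c))%:E)%E.
Proof.
move=> c0 t00 b0 th1 mD HD.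
pose t (j : nat) := t0 * b ^+ j.
have tj0 j : 0 < t j by rewrite mulr_gt0// exprn_gt0.
pose F j x : \bar R := ((G x * (\1_([set x | (t j / 2 <= r x < t j)%R]) x)%:E) *
  (2 `^ `|c| * t j `^ c)%:E)%E.
have F0 j x : (0 <= F j x)%E.
  by rewrite !mule_ge0// lee_fin// mulr_ge0// powR_ge0.
have mGi j : measurable_fun setT (fun x =>
  (G x * (\1_([set x | (t j / 2 <= r x < t j)%R]) x)%:E)%E).
  by apply: emeasurable_funM => //; apply/measurable_EFinP; exact: measurable_indic.
have mF j : measurable_fun setT (F j) by apply: emeasurable_funM.
apply: (@le_trans _ _ (\int[mu]_x \sum_(0 <= j <oo) F j x)%E).
  rewrite integral_mkcond; apply: le_integral_nonmeas.
    move=> x _; rewrite patchE; case: ifP => // _.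
    by rewrite mule_ge0// lee_fin powR_ge0.
  move=> x _; rewrite patchE; case: ifPn => [/set_mem Dx|_]; last exact: nneseries_ge0.
  have := r0 x; rewrite le_eqVlt => /predU1P[<-|rx0].
    (* Points where [r] vanishes lie in no shell; they contribute nothing, as 0 to any nonzero
       power, even a negative one, is 0 here. *)
    by rewrite powR0// mule0; exact: nneseries_ge0.
  have [j jP] := HD x Dx rx0.
  apply: (@le_trans _ _ (F j x)).
    rewrite /F indicE mem_set// mule1; apply: lee_wpmul2l => //.
    by rewrite lee_fin powR_shell.
  rewrite (nneseries_split_cond 0 j.+1)//= add0n big_nat_recr//=.
  rewrite -addeA addeCA leeDl// adde_ge0//.
    by apply: sume_ge0.
  by apply: nneseries_ge0.
rewrite integral_nneseries//.
apply: (@le_trans _ _ (\sum_(0 <= j <oo)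
   (2 `^ `|c| * W * t0 `^ (a + c) * (b `^ (a + c)) ^+ j)%:E)%E).
  apply: lee_nneseries => [j _ _|j _]; first exact: integral_ge0.
  rewrite ge0_integralZr//; last 2 first.
  - by move=> x _; rewrite mule_ge0// lee_fin.
  - by rewrite lee_fin mulr_ge0// powR_ge0.
  rewrite (_ : (\int[mu]_x _)%E = (\int[mu]_(x in [set x | (t j / 2 <= r x < t j)%R]) G x)%E);
    last first.
    rewrite [RHS]integral_mkcond; apply: eq_integral => x _.
    by rewrite patchE indicE; case: ifPn => _; rewrite ?mule1 ?mule0.
  apply: (@le_trans _ _ ((W * t j `^ a)%:E * (2 `^ `|c| * t j `^ c)%:E)%E).
    by apply: lee_wpmul2r; [rewrite lee_fin mulr_ge0// powR_ge0|exact: GW].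
  rewrite -EFinM lee_fin -powR_mulrn ?powR_ge0// powRAC powR_mulrn ?(ltW b0)//.
  rewrite [leRHS](_ : _ = 2 `^ `|c| * W * t j `^ (a + c)); last first.
    by rewrite -mulrA -powRM// ?exprn_ge0// ltW.
  by rewrite powRD_gt0// le_eqVlt; apply/orP; left; apply/eqP; ring.
apply: (le_trans (geometric_le _ _)).
- by rewrite !mulr_ge0// powR_ge0.
- by rewrite powR_ge0.
- by rewrite lee_fin le_eqVlt; apply/orP; left; apply/eqP; ring.
Qed.

Lemma integral_near_le (c : R) : c != 0 -> 0 < a + c -> forall t : R, 0 < t ->
  (\int[mu]_(x in [set x | (r x < t)%R]) (G x * (r x `^ c)%:E) <=
    (2 `^ `|c| / (1 - 2^-1 `^ (a + c)) * W * t `^ (a + c))%:E)%E.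
Proof.
move=> c0 ac t t0; apply: integral_shells_le => //.
- rewrite -[ltRHS](congr1 (@^~ (a + c)) (powR1 R)); apply: gt0_ltr_powR => //;
  rewrite ?nnegrE ?invr_ge0//.
  by lra.
- have := mr measurableT (measurable_itv `]-oo, t[).
  by rewrite setTI; congr measurable; apply/seteqP; split => x /=; rewrite in_itv.
move=> x /= xt rx0.
have [N HN] : exists N, t * 2^-1 ^+ N <= r x.
  exists (Num.truncn (t / r x)).+1; rewrite exprVn ler_pdivrMr ?exprn_gt0// mulrC -ler_pdivrMr//.
  apply: (le_trans (ltW (truncnS_gt _))).
  by rewrite -natrX ler_nat ltnW// ltn_expl.
have ex : exists N, t * 2^-1 ^+ N <= r x by exists N.
(* The least [N] with [t / 2^N <= r x] is positive because [r x < t]; the shell has the index before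
   it. *)
have := ex_minnP ex => -[[|j] hj hmin].
  by move: hj; rewrite expr0 mulr1 leNgt xt.
exists j; apply/andP; split; first by move: hj; rewrite exprSr mulrA.
by rewrite ltNge; apply/negP => /hmin; rewrite ltnn.
Qed.

(** A shell of size [t] starts at [t / 2], so the one that starts at [t] has size [2 * t]; hence the
    factor 2 in the bound. *)
Lemma integral_far_le (c : R) : c != 0 -> a + c < 0 -> forall t : R, 0 < t ->
  (\int[mu]_(x in [set x | (t <= r x)%R]) (G x * (r x `^ c)%:E) <=
    (2 `^ `|c| / (1 - 2 `^ (a + c)) * W * (2 * t) `^ (a + c))%:E)%E.
Proof.
move=> c0 ac t t0; apply: integral_shells_le => //.
- by rewrite mulr_gt0.
- rewrite -[a + c]opprK powRN.
  rewrite invf_lt1 ?powR_gt0// -[ltLHS](congr1 (@^~ (- (a + c))) (powR1 R)).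
  by apply: gt0_ltr_powR; rewrite ?nnegrE//; lra.
- have := mr measurableT (measurable_itv `[t, +oo[).
  by rewrite setTI; congr measurable; apply/seteqP; split => x /=; rewrite in_itv/= andbT.
move=> x /= xt rx0.
have [N HN] : exists N, r x < 2 * t * 2 ^+ N.
  exists (Num.truncn (r x / t)).+1; rewrite mulrAC -ltr_pdivrMr ?mulr_gt0//.
  apply: (lt_le_trans (truncnS_gt _)).
  rewrite -exprS -natrX ler_nat; apply: ltnW; apply: (@leq_trans (2 ^ (Num.truncn (r x / t)).+1)).
    exact: ltn_expl.
  by rewrite leq_exp2l.
have ex : exists N, r x < 2 * t * 2 ^+ N by exists N.
have := ex_minnP ex => -[[|j] hj hmin].
  by exists 0%N; rewrite hj andbT expr0 mulr1 [2 * t]mulrC mulfK.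
exists j.+1; rewrite hj andbT; rewrite leNgt; apply/negP => h.
have : r x < 2 * t * 2 ^+ j by move: h; rewrite exprS; lra.
by move/hmin; rewrite ltnn.
Qed.

End shell_summation.

Lemma ge0_hoelder d (T : measurableType d) (R : realType) (mu : {measure set T -> \bar R})
    (f g : T -> R) (p q : R) :
  measurable_fun setT f -> measurable_fun setT g ->
  (forall x, 0 <= f x) -> (forall x, 0 <= g x) ->
  0 < p -> 0 < q -> p^-1 + q^-1 = 1 ->
  (\int[mu]_x (f x * g x)%:E <=
   (\int[mu]_x (f x `^ p)%:E) `^ p^-1 * (\int[mu]_x (g x `^ q)%:E) `^ q^-1)%E.
Proof.
move=> mf mg f0 g0 p0 q0 pq; have := hoelder mu mf mg p0 q0 pq.
have E (h : T -> R) (s : R) : (forall x, 0 <= h x) ->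
    ('N[mu]_s%:E[EFin \o h] = (\int[mu]_x (h x `^ s)%:E) `^ s^-1)%E.
  move=> h0; rewrite unlock; apply: (congr1 (@poweR R ^~ s^-1)).
  by apply: eq_integral => x _; rewrite /= ger0_norm// poweR_EFin.
rewrite Lnorm1 !E//; apply: le_trans; rewrite le_eqVlt; apply/orP; left; apply/eqP.
by apply: eq_integral => x _; rewrite /= ger0_norm// mulr_ge0.
Qed.

(** * Pointwise bound of a power of the potential, and integrals of its weight *)

Section potential_bound.
Context d (T : measurableType d) (R : realType) (mu : {measure set T -> \bar R}).

(** Indicators in place of domains of integration make Tonelli's theorem and reflections applicable
    to functions on the whole space. *)
Lemma integral_indicM (S : set T) (a : T -> R) :
  (\int[mu]_x (\1_S x * a x)%:E = \int[mu]_(x in S) (a x)%:E)%E.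
Proof.
rewrite [RHS]integral_mkcond; apply: eq_integral => x _.
by rewrite patchE indicE; case: ifPn => _; rewrite ?mul1r ?mul0r.
Qed.

(* Let [u] be the integral of [k f], let [0 < tau <= u], choose [D] such that
   [C1 D^-beta = tau / 2], and [h] such that [C2 D^alpha h = tau / 4]. The part
   of [u] where [r < D] and [f >= h] is at least [tau / 4], and there both terms
   of the minimum are at least [tau]; then let [tau] tend to [u]. *)
Lemma potential_powR_le (k f r : T -> R) (C1 C2 alpha beta q : R) :
  measurable_fun setT k -> measurable_fun setT f -> measurable_fun setT r ->
  (forall y, 0 <= k y) -> (forall y, 0 <= f y) -> (forall y, 0 <= r y) ->
  (forall y, r y = 0 -> k y = 0) ->
  0 < C1 -> 0 < C2 -> 0 < alpha -> 0 < beta -> 1 < q ->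
  (forall t : R, 0 < t -> (\int[mu]_(y in [set y | (t <= r y)%R]) (k y * f y)%:E <=
    (C1 * t `^ (- beta))%:E)%E) ->
  (forall t : R, 0 < t ->
    (\int[mu]_(y in [set y | (r y < t)%R]) (k y)%:E <= (C2 * t `^ alpha)%:E)%E) ->
  ((\int[mu]_y (k y * f y)%:E) `^ q <=
   4%:E * \int[mu]_y (k y * f y *
     Num.min ((4 * C2 * (2 * C1) `^ (alpha / beta) * f y) `^ (beta / (alpha + beta)))
             (2 * C1 * r y `^ (- beta)) `^ (q - 1))%:E)%E.
Proof.
move=> mk mf mr k0 f0 r0 kr0 C10 C20 al0 be0 q1 far near_.
pose m y := Num.min ((4 * C2 * (2 * C1) `^ (alpha / beta) * f y) `^ (beta / (alpha + beta)))
  (2 * C1 * r y `^ (- beta)).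
have ab0 : 0 < alpha + beta by rewrite addr_gt0.
have q0 : 0 < q by lra.
have m0 y : 0 <= m y.
  by rewrite le_min !(mulr_ge0, powR_ge0)// ltW.
have mm : measurable_fun setT m.
  apply: measurable_minr.
    apply: (measurableT_comp (f := @powR R ^~ _)); first exact: measurable_powR.
    exact: measurable_funM.
  apply: measurable_funM => //.
  by apply: (measurableT_comp (f := @powR R ^~ _)); first exact: measurable_powR.
have mmq : measurable_fun setT (fun y => k y * f y * m y `^ (q - 1)).
  apply: measurable_funM; first exact: measurable_funM.
  by apply: (measurableT_comp (f := @powR R ^~ _)); first exact: measurable_powR.
have kf0 y : 0 <= k y * f y by rewrite mulr_ge0.
change ((\int[mu]_y (k y * f y)%:E) `^ q <=
  4%:E * \int[mu]_y (k y * f y * m y `^ (q - 1))%:E)%E.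
set I := (\int[mu]_y (k y * f y * _)%:E)%E.
have I0 : (0 <= I)%E by apply: integral_ge0 => y _; rewrite lee_fin mulr_ge0// powR_ge0.
suff main tau : 0 < tau -> (tau%:E <= \int[mu]_y (k y * f y)%:E)%E ->
    ((tau `^ q)%:E <= 4%:E * I)%E.
  have : (0 <= \int[mu]_y (k y * f y)%:E)%E by apply: integral_ge0 => y _; rewrite lee_fin.
  case: (\int[mu]_y (k y * f y)%:E)%E main => [u| |]// main.
    rewrite lee_fin le_eqVlt => /predU1P[<-|u0].
      by rewrite poweR_EFin powR0 ?gt_eqF// mule_ge0.
    by rewrite poweR_EFin; exact: main.
  (* When the potential is infinite every [tau] is admissible, and the one whose [q]-th power is
     [4 * M + 1] excludes a finite value [M] of [I]. *)
  move=> _; have {}main tau : 0 < tau -> ((tau `^ q)%:E <= 4%:E * I)%E.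
    by move=> t0; apply: main => //; rewrite leey.
  move: I0 main; case: I => [M| |]// I0 main; last by rewrite gt0_muley// leey.
  have M0 : 0 <= M by rewrite -lee_fin.
  have M1 : 0 < 4 * M + 1 by lra.
  have := main ((4 * M + 1) `^ q^-1) (powR_gt0 _ M1).
  rewrite -powRrM mulVf ?gt_eqF// powRr1 ?(ltW M1)// -EFinM lee_fin => M2.
  by exfalso; lra.
move=> tau0 tau_le.
pose D := (2 * C1 / tau) `^ beta^-1.
have tau1 : 0 < 2 * C1 / tau by rewrite divr_gt0// mulr_gt0.
have D0 : 0 < D by exact: powR_gt0.
pose h := tau / (4 * C2 * D `^ alpha).
have Da0 : 0 < D `^ alpha by exact: powR_gt0.
have h0 : 0 < h by rewrite divr_gt0// !mulr_gt0.
have Db : D `^ (- beta) = tau / (2 * C1).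
  by rewrite powRN /D -powRrM mulVf ?gt_eqF// powRr1 ?ltW// invf_div.
pose S1 := [set y | D <= r y]; pose S2 := [set y | r y < D].
pose S3 := [set y | r y < D] `&` [set y | h <= f y].
have mS1 : measurable S1.
  have := mr measurableT _ (measurable_itv `[D, +oo[).
  by rewrite setTI; congr measurable; apply/seteqP; split => x /=; rewrite in_itv/= andbT.
have mS2 : measurable S2.
  have := mr measurableT _ (measurable_itv `]-oo, D[).
  by rewrite setTI; congr measurable; apply/seteqP; split => x /=; rewrite in_itv.
have mS3 : measurable S3.
  apply: measurableI => //.
  have := mf measurableT _ (measurable_itv `[h, +oo[).
  by rewrite setTI; congr measurable; apply/seteqP; split => x /=; rewrite in_itv/= andbT.
have mkf : measurable_fun setT (fun y => k y * f y) by exact: measurable_funM.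
have ind0 (S : set T) y : 0 <= \1_S y :> R by rewrite indicE.
have split3 : (\int[mu]_y (k y * f y)%:E <= (tau / 2)%:E + (tau / 4)%:E +
    \int[mu]_y (\1_S3 y * (k y * f y))%:E)%E.
  apply: (@le_trans _ _ (\int[mu]_y ((\1_S1 y * (k y * f y))%:E +
      h%:E * (\1_S2 y * k y)%:E + (\1_S3 y * (k y * f y))%:E))%E).
    apply: le_integral_nonmeas => y _; first by rewrite lee_fin.
    rewrite -!EFinM -!EFinD lee_fin !indicE /S1 /S2 /S3.
    have inb (b : T -> bool) : (y \in [set z | b z]) = b y.
      by apply/idP/idP => [/set_mem|/mem_set].
    rewrite in_setI !inb; have [Dr|rD] := leP D (r y).
      by rewrite /= mul1r !mul0r mulr0 !addr0.
    rewrite /= mul0r add0r mul1r.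
    have [hf|fh] := leP h (f y).
      by rewrite mul1r lerDr mulr_ge0// ltW.
    by rewrite mul0r addr0 mulrC ler_wpM2r// ltW.
  have m1 S : measurable S -> measurable_fun setT (fun y => (\1_S y * (k y * f y))%:E).
    move=> mS; apply/measurable_EFinP; apply: measurable_funM => //; exact: measurable_indic.
  have m2 : measurable_fun setT (fun y => (\1_S2 y * k y)%:E).
    by apply/measurable_EFinP; apply: measurable_funM => //; exact: measurable_indic.
  rewrite ge0_integralD//; last 4 first.
  - move=> y _; apply: adde_ge0; first by rewrite lee_fin mulr_ge0.
    by rewrite mule_ge0 ?lee_fin ?(ltW h0)// mulr_ge0.
  - apply: emeasurable_funD; first exact: m1.
    by apply: emeasurable_funM.
  - by move=> y _; rewrite lee_fin mulr_ge0.
  - exact: m1.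
  apply: leeD => //; rewrite ge0_integralD//; last 4 first.
  - by move=> y _; rewrite lee_fin mulr_ge0.
  - exact: m1.
  - by move=> y _; rewrite mule_ge0 ?lee_fin ?(ltW h0)// mulr_ge0.
  - by apply: emeasurable_funM.
  apply: leeD; first rewrite integral_indicM.
    apply: (le_trans (far _ D0)); rewrite lee_fin Db le_eqVlt; apply/orP; left.
    by apply/eqP; field; rewrite gt_eqF.
  rewrite ge0_integralZl//; last 2 first.
  - by move=> y _; rewrite lee_fin mulr_ge0.
  - by rewrite lee_fin ltW.
  rewrite integral_indicM.
  apply: (@le_trans _ _ (h%:E * (C2 * D `^ alpha)%:E)%E).
    by apply: lee_wpmul2l; [rewrite lee_fin ltW|exact: near_].
  rewrite -EFinM lee_fin le_eqVlt; apply/orP; left; apply/eqP; rewrite /h.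
  by field; rewrite !gt_eqF.
have I3 : ((tau / 4)%:E <= \int[mu]_y (\1_S3 y * (k y * f y))%:E)%E.
  have := le_trans tau_le split3.
  have : (0 <= \int[mu]_y (\1_S3 y * (k y * f y))%:E)%E.
    by apply: integral_ge0 => y _; rewrite lee_fin mulr_ge0.
  case: (\int[mu]_y (\1_S3 y * _)%:E)%E => [x| |]//; rewrite ?leey//.
  rewrite -!EFinD !lee_fin; lra.
have tq0 : 0 <= tau `^ (q - 1) by exact: powR_ge0.
apply: (@le_trans _ _ (4%:E * ((tau `^ (q - 1))%:E * \int[mu]_y (\1_S3 y * (k y * f y))%:E))%E).
  apply: (@le_trans _ _ (4%:E * ((tau `^ (q - 1))%:E * (tau / 4)%:E))%E).
    rewrite -!EFinM lee_fin le_eqVlt; apply/orP; left; apply/eqP.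
    have -> : tau `^ q = tau `^ (q - 1) * tau.
      by rewrite -[X in _ * X](powRr1 (ltW tau0)) -powRD_gt0// subrK.
    by field.
  by do 2 (apply: lee_wpmul2l; first by rewrite lee_fin).
apply: lee_wpmul2l => //.
rewrite -ge0_integralZl//; last 2 first.
- apply/measurable_EFinP; apply: measurable_funM => //; exact: measurable_indic.
- by move=> y _; rewrite lee_fin mulr_ge0.
apply: le_integral_nonmeas => y _; first by rewrite -EFinM lee_fin !mulr_ge0.
rewrite -EFinM lee_fin indicE.
have [/set_mem[/= rD hf]|_] := boolP (y \in S3); last first.
  by rewrite mul0r mulr0 mulr_ge0// powR_ge0.
rewrite mul1r mulrC.
have := r0 y; rewrite le_eqVlt => /predU1P[/esym/kr0->|ry0]; first by rewrite !mul0r.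
apply: ler_wpM2l => //; apply: ge0_ler_powR; rewrite ?nnegrE ?subr_ge0 ?(ltW q1) ?(ltW tau0)//.
rewrite le_min; apply/andP; split.
  have e0 : 0 < beta / (alpha + beta) by rewrite divr_gt0.
  (* [D^alpha] is a constant times [tau^(- alpha / beta)], so [h] is a constant times
     [tau^((alpha + beta) / beta)]: this is the origin of the exponent and of the constant in the
     first term of the minimum. *)
  have tE : tau = (tau `^ ((alpha + beta) / beta)) `^ (beta / (alpha + beta)).
    by rewrite -powRrM mulf_div [beta * _]mulrC divff ?powRr1 ?ltW// mulf_neq0 ?gt_eqF.
  rewrite [leLHS]tE; apply: ge0_ler_powR; rewrite ?nnegrE ?powR_ge0 ?(ltW e0)//.
    by rewrite !mulr_ge0 ?powR_ge0// ltW.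
  apply: (@le_trans _ _ (4 * C2 * (2 * C1) `^ (alpha / beta) * h)); last first.
    by apply: ler_wpM2l => //; rewrite !mulr_ge0 ?powR_ge0// ltW.
  rewrite le_eqVlt; apply/orP; left; apply/eqP; rewrite /h.
  have DaE : D `^ alpha = (2 * C1) `^ (alpha / beta) / tau `^ (alpha / beta).
    rewrite /D -powRrM [_^-1 * _]mulrC powRM ?invr_ge0 ?mulr_ge0 ?ltW//.
    by rewrite -[tau^-1]powR_inv1 ?(ltW tau0)// -powRrM mulN1r powRN.
  rewrite DaE mulrDl divff ?gt_eqF// powRD_gt0// powRr1 ?ltW//.
  have a1 : 0 < (2 * C1) `^ (alpha / beta) by rewrite powR_gt0// mulr_gt0.
  have a2 : 0 < tau `^ (alpha / beta) by rewrite powR_gt0.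
  by field; rewrite !gt_eqF.
rewrite -ler_pdivrMl ?mulr_gt0// mulrC -Db !powRN lef_pV2 ?posrE ?powR_gt0//.
by apply: ge0_ler_powR; rewrite ?nnegrE ltW.
Qed.

End potential_bound.

Section weight_bound.
Context d (T : measurableType d) (R : realType) (mu : {measure set T -> \bar R}).

(* The integral is split at the radius [t] such that [(c s)^e = t^-beta]. *)
Lemma min_weight_integral_le (k r : T -> R) (B C2 C3 alpha beta p q c s : R) :
  measurable_fun setT k -> measurable_fun setT r ->
  (forall y, 0 <= k y) -> (forall y, 0 <= r y) ->
  0 < B -> 0 < c -> 0 < C2 -> 0 < C3 -> 0 < alpha -> 0 < beta -> 1 < q -> 0 < p ->
  (beta * q = p * (alpha + beta)) -> 0 <= s ->
  (forall t : R, 0 < t ->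
    (\int[mu]_(y in [set y | (r y < t)%R]) (k y)%:E <= (C2 * t `^ alpha)%:E)%E) ->
  (forall t : R, 0 < t -> (\int[mu]_(y in [set y | (t <= r y)%R])
    (k y * r y `^ (- (beta * (q - 1))))%:E <= (C3 * t `^ (alpha - beta * (q - 1)))%:E)%E) ->
  (\int[mu]_y (k y * s * Num.min ((c * s) `^ (beta / (alpha + beta)))
             (B * r y `^ (- beta)) `^ (q - 1))%:E <=
   ((C2 + B `^ (q - 1) * C3) * c `^ (p - 1) * s `^ p)%:E)%E.
Proof.
move=> mk mr k0 r0 B0 c0 C20 C30 al0 be0 q1 p0 pq s0 near_ far.
have ab0 : 0 < alpha + beta by rewrite addr_gt0.
have q10 : 0 <= q - 1 by lra.
move: s0; rewrite le_eqVlt => /predU1P[<-|s0].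
  under eq_integral do rewrite mulr0 mul0r.
  by rewrite integral0 lee_fin !mulr_ge0 ?addr_ge0 ?mulr_ge0 ?powR_ge0// ltW.
pose sg := (c * s) `^ (beta / (alpha + beta)).
have sg0 : 0 < sg by rewrite powR_gt0// mulr_gt0.
pose t := sg `^ (- beta^-1).
have t0 : 0 < t by rewrite powR_gt0.
have mS1 : measurable [set y | r y < t].
  have := mr measurableT _ (measurable_itv `]-oo, t[).
  by rewrite setTI; congr measurable; apply/seteqP; split => x /=; rewrite in_itv.
have mS2 : measurable [set y | t <= r y].
  have := mr measurableT _ (measurable_itv `[t, +oo[).
  by rewrite setTI; congr measurable; apply/seteqP; split => x /=; rewrite in_itv/= andbT.
pose b := s * sg `^ (q - 1); pose b' := s * B `^ (q - 1).
have b0 : 0 <= b by rewrite mulr_ge0 ?powR_ge0// ltW.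
have b'0 : 0 <= b' by rewrite mulr_ge0 ?powR_ge0// ltW.
have mrp : measurable_fun setT (fun y => r y `^ (- (beta * (q - 1)))).
  by apply: (measurableT_comp (f := @powR R ^~ _)); first exact: measurable_powR.
have ind0 (S : set T) y : 0 <= \1_S y :> R by rewrite indicE.
apply: (@le_trans _ _ (\int[mu]_y (b%:E * (\1_([set y | (r y < t)%R]) y * k y)%:E +
   b'%:E * (\1_([set y | (t <= r y)%R]) y * (k y * r y `^ (- (beta * (q - 1)))))%:E))%E).
  apply: le_integral_nonmeas => y _.
    by rewrite lee_fin !mulr_ge0 ?powR_ge0// ltW.
  rewrite -!EFinM -!EFinD lee_fin !indicE.
  have inb (h : T -> bool) : (y \in [set z | h z]) = h y.
    by apply/idP/idP => [/set_mem|/mem_set].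
  have min0 : 0 <= Num.min sg (B * r y `^ (- beta)).
    by rewrite le_min (ltW sg0) mulr_ge0 ?powR_ge0// ltW.
  rewrite !inb -/sg; have [tr|rt] := leP t (r y).
    rewrite /= mul0r mulr0 add0r mul1r.
    rewrite [leRHS](_ : _ = k y * s * (B `^ (q - 1) * r y `^ (- (beta * (q - 1))))); last first.
      by rewrite /b'; ring.
    apply: ler_wpM2l; first by rewrite mulr_ge0// ltW.
    rewrite -mulNr powRrM.
    apply: (@le_trans _ _ ((B * r y `^ (- beta)) `^ (q - 1))).
      apply: ge0_ler_powR; rewrite ?nnegrE// ?ge_min ?lexx ?orbT//.
      by rewrite mulr_ge0 ?powR_ge0// ltW.
    rewrite powRM; [|exact: ltW|exact: powR_ge0].
    exact: lexx.
  rewrite /= mul1r mul0r mulr0 addr0.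
  rewrite [leRHS](_ : _ = k y * s * sg `^ (q - 1)); last by rewrite /b; ring.
  apply: ler_wpM2l; first by rewrite mulr_ge0// ltW.
  apply: ge0_ler_powR; rewrite ?nnegrE// ?ge_min ?lexx//; exact: ltW.
have m1 : measurable_fun setT (fun y => (\1_([set y | (r y < t)%R]) y * k y)%:E).
  by apply/measurable_EFinP; apply: measurable_funM => //; exact: measurable_indic.
have m2 : measurable_fun setT (fun y =>
  (\1_([set y | (t <= r y)%R]) y * (k y * r y `^ (- (beta * (q - 1)))))%:E).
  apply/measurable_EFinP; apply: measurable_funM; first exact: measurable_indic.
  exact: measurable_funM.
have p1 y : (0 <= (\1_([set y | (r y < t)%R]) y * k y)%:E)%E by rewrite lee_fin mulr_ge0.
have p2 y : (0 <= (\1_([set y | (t <= r y)%R]) y * (k y * r y `^ (- (beta * (q - 1)))))%:E)%E.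
  by rewrite lee_fin !mulr_ge0 ?powR_ge0.
rewrite ge0_integralD//; last 4 first.
- by move=> y _; rewrite mule_ge0.
- exact: emeasurable_funM.
- by move=> y _; rewrite mule_ge0.
- exact: emeasurable_funM.
rewrite !ge0_integralZl// !integral_indicM.
apply: (@le_trans _ _ (b%:E * (C2 * t `^ alpha)%:E + b'%:E * (C3 * t `^ (alpha - beta * (q -
  1)))%:E)%E).
  by apply: leeD; apply: lee_wpmul2l => //; [exact: near_|exact: far].
rewrite -!EFinM -EFinD lee_fin le_eqVlt; apply/orP; left; apply/eqP.
have tE x : t `^ x = sg `^ (- (x / beta)) by rewrite /t -powRrM mulNr mulrC.
(* The exponent of [c * s] is [(beta * q) / (alpha + beta) - 1], which is [p - 1] by the relation
   between the exponents. The far part yields the same power, so that both parts scale alike. *)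
have E : sg `^ (q - 1 - alpha / beta) = c `^ (p - 1) * s `^ (p - 1).
  rewrite -powRM ?ltW// /sg -powRrM; congr (_ `^ _).
  have -> : p = beta * q / (alpha + beta) by rewrite pq mulfK// gt_eqF.
  by field; rewrite !gt_eqF.
have -> : s `^ p = s `^ (p - 1) * s.
  by rewrite -[X in _ * X](powRr1 (ltW s0)) -powRD_gt0// subrK.
rewrite !tE /b /b'.
rewrite (_ : - ((alpha - beta * (q - 1)) / beta) = q - 1 - alpha / beta); last first.
  by field; rewrite gt_eqF.
have E' : sg `^ (q - 1) * sg `^ (- (alpha / beta)) = c `^ (p - 1) * s `^ (p - 1).
  by rewrite -powRD_gt0.
rewrite E [LHS](_ : _ = s * (C2 * (sg `^ (q - 1) * sg `^ (- (alpha / beta))) +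
  B `^ (q - 1) * C3 * (c `^ (p - 1) * s `^ (p - 1)))); last by ring.
by rewrite E'; ring.
Qed.

End weight_bound.

(** Makes a constant positive without inspecting its formula. *)
Lemma le_max1_mul (R : realType) (C x : R) : 0 < x -> ((C * x)%:E <= (Num.max C 1 * x)%:E)%E.
Proof. by move=> x0; rewrite lee_fin ler_pM2r// le_max lexx. Qed.

(** * The potential between Morrey spaces *)

Section riesz_potential.
Variables (R : realType) (n : nat) (P : 'M[R]_n) (rho : 'cV[R]_n -> R).
Hypothesis qd : quasi_distance P rho.
Local Notation mu := (@lebesgue_cv R n).
Local Notation gam := (\tr P).
Variables (g : 'cV[R]_n -> R) (alpha : R).

Definition kernel (z : 'cV[R]_n) : R := `|g z| * rho z `^ (alpha - gam).

Definition potential (f : 'cV[R]_n -> R) (x : 'cV[R]_n) : \bar R :=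
  (\int[mu]_y (kernel (x - y) * f y)%:E)%E.

Hypothesis mg : measurable_fun setT g.
Hypothesis al : 0 < alpha < gam.

Let agam0 : alpha - gam != 0.
Proof. by move: al => /andP[_ ?]; rewrite lt_eqF// subr_lt0. Qed.

Lemma kernel_ge0 z : 0 <= kernel z.
Proof. by rewrite mulr_ge0// powR_ge0. Qed.

Lemma measurable_kernel : measurable_fun setT kernel.
Proof.
apply: measurable_funM; first exact: measurableT_comp.
apply: (measurableT_comp (f := @powR R ^~ _)); first exact: measurable_powR.
exact: rho_measurable qd.
Qed.

(** Not the singular value but 0, by the convention on powers of 0; [potential_powR_le] asks for
    this at points where negative powers of [rho] are meaningless. *)
Lemma kernel_rho0 z : rho z = 0 -> kernel z = 0.
Proof. by rewrite /kernel => ->; rewrite powR0// mulr0. Qed.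

Lemma measurable_cv_sub : measurable_fun setT (fun u : 'cV[R]_n * 'cV[R]_n => u.1 - u.2).
Proof. by apply: measurable_subcv. Qed.

Lemma measurable_potential (f : 'cV[R]_n -> R) : measurable_fun setT f ->
  (forall x, 0 <= f x) -> measurable_fun setT (potential f).
Proof.
move=> mf f0.
have mF : measurable_fun setT (fun u : 'cV[R]_n * 'cV[R]_n => (kernel (u.1 - u.2) * f u.2)%:E).
  apply/measurable_EFinP; apply: measurable_funM; last exact: measurableT_comp.
  by apply: (measurableT_comp measurable_kernel); exact: measurable_cv_sub.
apply: (measurable_fun_fubini_tonelli_F (m2 := mu) _ mF).
by move=> u; rewrite lee_fin mulr_ge0// kernel_ge0.
Qed.

Variables (p q lam W W' : R).
Hypotheses (p1 : 1 < p) (pq : p < q) (lam0 : 0 < lam) (lamg : lam < gam - alpha * p).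
Hypothesis pq_eq : p^-1 - q^-1 = alpha / (gam - lam).
Hypotheses (W0 : 0 < W) (W'0 : 0 < W').
Hypothesis HW : forall t : R, 0 < t ->
  (\int[mu]_(x in shell rho t) (`|g x|)%:E <= (W * t `^ gam)%:E)%E.
Hypothesis HW' : forall t : R, 0 < t ->
  (\int[mu]_(x in shell rho t) (`|g x| `^ (p / (p - 1)))%:E <= (W' * t `^ gam)%:E)%E.

Local Notation beta := ((gam - lam) / q).
(** Equal to [gamma / p' + lambda / p], the exponent that Hoelder's inequality produces on a set of
    size [t] (see [kapE]). The factor [rho^(alpha - gam)] of the kernel turns it into [- beta]. *)
Local Notation kap := (gam - alpha - beta).

Let al0 : 0 < alpha. Proof. by case/andP: al. Qed.
Let p0 : 0 < p. Proof. exact: lt_trans ltr01 p1. Qed.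
Let q0 : 0 < q. Proof. exact: lt_trans p0 pq. Qed.
Let gl0 : 0 < gam - lam.
Proof.
have h : 0 < alpha * p by rewrite mulr_gt0.
by rewrite subr_gt0 (lt_trans lamg)// gtrBl.
Qed.
Let be0 : 0 < beta. Proof. exact: divr_gt0. Qed.
Let abE : alpha + beta = (gam - lam) / p.
Proof.
have E : alpha = (p^-1 - q^-1) * (gam - lam) by rewrite pq_eq divfK// gt_eqF.
by rewrite {1}E mulrBl ![_^-1 * _]mulrC subrK.
Qed.
Let beq : beta * q = p * (alpha + beta).
Proof. by rewrite abE mulfVK ?gt_eqF// [RHS]mulrC mulfVK// gt_eqF. Qed.
Let far_exp : alpha - beta * (q - 1) < 0.
Proof.
have -> : alpha - beta * (q - 1) = alpha + beta - beta * q by ring.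
have ab : 0 < alpha + beta by exact: addr_gt0.
by rewrite beq -[X in X - _]mul1r -mulrBl pmulr_llt0// subr_lt0.
Qed.

Let mrho : measurable_fun setT rho. Proof. exact: rho_measurable qd. Qed.
Let r0 x : 0 <= rho x. Proof. exact: rho_ge0 qd x. Qed.

Let kernel_near : exists2 C : R, 0 < C & forall t : R, 0 < t ->
  (\int[mu]_(x in [set x | (rho x < t)%R]) (kernel x)%:E <= (C * t `^ alpha)%:E)%E.
Proof.
have mG : measurable_fun setT (fun x => (`|g x|)%:E).
  by apply/measurable_EFinP; exact: measurableT_comp.
have G0 x : (0 <= (`|g x|)%:E)%E by rewrite lee_fin.
have := integral_near_le mrho mG r0 G0 (ltW W0) HW agam0.
have -> : gam + (alpha - gam) = alpha by ring.
move=> /(_ al0); set C := _ / _ * _ => H.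
exists (Num.max C 1); first by rewrite lt_max ltr01 orbT.
move=> t t0; apply: le_trans (le_max1_mul _ (powR_gt0 _ t0)).
apply: le_trans (H t t0); rewrite le_eqVlt; apply/orP; left; apply/eqP.
by apply: eq_integral => x _; rewrite -EFinM.
Qed.

Let kernel_far : exists2 C : R, 0 < C & forall t : R, 0 < t ->
  (\int[mu]_(x in [set x | (t <= rho x)%R]) (kernel x * rho x `^ (- (beta * (q - 1))))%:E <=
    (C * t `^ (alpha - beta * (q - 1)))%:E)%E.
Proof.
have mG : measurable_fun setT (fun x => (`|g x|)%:E).
  by apply/measurable_EFinP; exact: measurableT_comp.
have G0 x : (0 <= (`|g x|)%:E)%E by rewrite lee_fin.
pose c := alpha - gam - beta * (q - 1).
have gc : gam + c = alpha - beta * (q - 1) by rewrite /c; ring.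
have c0 : c != 0.
  by rewrite lt_eqF// /c; move: far_exp al => + /andP[? ?]; lra.
have := integral_far_le mrho mG r0 G0 (ltW W0) HW c0.
rewrite gc => /(_ far_exp); set C := _ / _ * _ => H.
pose D := C * 2 `^ (alpha - beta * (q - 1)).
exists (Num.max D 1); first by rewrite lt_max ltr01 orbT.
move=> t t0; apply: le_trans (le_max1_mul _ (powR_gt0 _ t0)).
rewrite (_ : D * _ = C * (2 * t) `^ (alpha - beta * (q - 1))); last first.
  by rewrite powRM ?(ltW t0)// mulrA.
apply: le_trans (H t t0); rewrite le_eqVlt; apply/orP; left; apply/eqP.
apply: eq_integral => x /set_mem/= tx; have x0 : 0 < rho x by exact: lt_le_trans tx.
have -> : rho x `^ c = rho x `^ (alpha - gam) * rho x `^ (- (beta * (q - 1))).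
  by rewrite -powRD_gt0.
by rewrite -EFinM mulrA.
Qed.

Section fixed_function.
Variable f : 'cV[R]_n -> R.
Hypotheses (mf : measurable_fun setT f) (f0 : forall x, 0 <= f x).
Hypothesis Hf : forall x (r : R), 0 < r ->
  (\int[mu]_(y in ellipsoid rho x r) (f y `^ p)%:E <= (r `^ lam)%:E)%E.

Let pp0 : 0 < p / (p - 1). Proof. by rewrite divr_gt0// subr_gt0. Qed.
Let ppE : (p / (p - 1))^-1 + p^-1 = 1.
Proof. by field; rewrite !gt_eqF// subr_gt0. Qed.
Let kapE : gam * (p / (p - 1))^-1 + lam * p^-1 = kap.
Proof.
have -> : kap = gam - (alpha + beta) by ring.
by rewrite abE; field; rewrite !gt_eqF// subr_gt0.
Qed.

Let powR_indic (S : set 'cV[R]_n) (a : 'cV[R]_n -> R) (e : R) y : 0 < e ->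
  (\1_S y * a y) `^ e = \1_S y * a y `^ e.
Proof.
by move=> e0; rewrite indicE; case: (y \in S); rewrite ?mul1r ?mul0r// powR0// gt_eqF.
Qed.

Let hoelder_on (S : set 'cV[R]_n) (a : 'cV[R]_n -> R) (A t : R) :
  measurable S -> measurable_fun setT a -> (forall x, 0 <= a x) -> 0 <= A -> 0 < t ->
  (\int[mu]_(y in S) (a y `^ (p / (p - 1)))%:E <= (A * t `^ gam)%:E)%E ->
  (\int[mu]_(y in S) (f y `^ p)%:E <= (t `^ lam)%:E)%E ->
  (\int[mu]_(y in S) (a y * f y)%:E <= (A `^ (p / (p - 1))^-1 * t `^ kap)%:E)%E.
Proof.
move=> mS ma a0 A0 t0 Ha HfS.
have mi (b : 'cV[R]_n -> R) : measurable_fun setT b -> measurable_fun setT (fun y => \1_S y * b y).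
  by move=> mb; apply: measurable_funM => //; exact: measurable_indic.
have i0 (b : 'cV[R]_n -> R) y : (forall y, 0 <= b y) -> 0 <= \1_S y * b y.
  by move=> b0; rewrite mulr_ge0// indicE.
have := ge0_hoelder mu (mi _ ma) (mi _ mf) (fun y => i0 _ y a0) (fun y => i0 _ y f0) pp0 p0 ppE.
rewrite (_ : (\int[mu]_y (\1_S y * a y * (\1_S y * f y))%:E)%E =
  (\int[mu]_(y in S) (a y * f y)%:E)%E); last first.
  rewrite -[RHS]integral_indicM; apply: eq_integral => y _; congr (_%:E).
  by rewrite indicE; case: (y \in S); rewrite ?mul1r// !mul0r.
move=> /le_trans; apply.
under eq_integral do rewrite powR_indic//.
under [X in (_ * X `^ _)%E]eq_integral do rewrite powR_indic//.
rewrite !integral_indicM -kapE powRD_gt0// mulrA !EFinM.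
apply: lee_pmul; rewrite ?poweR_ge0//.
  rewrite -EFinM [in leRHS]powRrM -powRM ?powR_ge0// -poweR_EFin.
  apply: gt0_ler_poweR => //; rewrite ?invr_ge0 ?(ltW pp0) ?in_itv/= ?andbT ?leey//.
  - by rewrite integral_ge0// => y _; rewrite lee_fin powR_ge0.
  - by rewrite lee_fin mulr_ge0// powR_ge0.
rewrite powRrM -poweR_EFin.
apply: gt0_ler_poweR => //; rewrite ?invr_ge0 ?(ltW p0) ?in_itv/= ?andbT ?leey//.
- by rewrite integral_ge0// => y _; rewrite lee_fin powR_ge0.
- by rewrite lee_fin powR_ge0.
Qed.

(** Hoelder's inequality on each shell needs the power [p' = p / (p - 1)] of [g], that is [HW']:
    this is what [s' < p] is for. The exponents then add up to [- beta], which is negative, and the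
    shells can be summed. *)
Lemma potential_far (x : 'cV[R]_n) (t : R) : 0 < t ->
  (\int[mu]_(y in [set y | (t <= rho (x - y))%R]) (kernel (x - y) * f y)%:E <=
   (Num.max (2 `^ `|alpha - gam| / (1 - 2 `^ (- beta)) * W' `^ (p / (p - 1))^-1 *
     2 `^ (- beta)) 1 * t `^ (- beta))%:E)%E.
Proof.
move=> t0.
have mx : measurable_fun setT (fun y : 'cV[R]_n => x - y) by exact: measurable_reflect.
have mgx : measurable_fun setT (fun y : 'cV[R]_n => `|g (x - y)|).
  by apply: measurableT_comp => //; exact: measurableT_comp.
have mrx : measurable_fun setT (fun y : 'cV[R]_n => rho (x - y)) by exact: measurableT_comp.
have mG : measurable_fun setT (fun y : 'cV[R]_n => (`|g (x - y)| * f y)%:E).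
  by apply/measurable_EFinP; exact: measurable_funM.
have G0 y : (0 <= (`|g (x - y)| * f y)%:E)%E by rewrite lee_fin mulr_ge0.
have HG (s : R) : 0 < s ->
    (\int[mu]_(y in [set y | (s / 2 <= rho (x - y)%R < s)%R]) (`|g (x - y)| * f y)%:E <=
     (W' `^ (p / (p - 1))^-1 * s `^ kap)%:E)%E.
  move=> s0.
  have mS : measurable [set y | s / 2 <= rho (x - y)%R < s].
    by have := mx measurableT _ (measurable_shell qd s); rewrite setTI.
  apply: hoelder_on => //; first exact: ltW.
    apply: le_trans (HW' s0); rewrite le_eqVlt; apply/orP; left; apply/eqP.
    rewrite -[RHS]integral_indicM -[LHS]integral_indicM.
    apply: (@ge0_integral_reflect _ _ x (fun z =>
      (\1_(shell rho s) z * `|g z| `^ (p / (p - 1)))%:E)).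
      apply/measurable_EFinP; apply: measurable_funM.
        by apply: measurable_indic; exact: (measurable_shell qd).
      apply: (measurableT_comp (f := @powR R ^~ _)); first exact: measurable_powR.
      exact: measurableT_comp.
    by move=> z; rewrite lee_fin mulr_ge0 ?powR_ge0// indicE.
  apply: le_trans (Hf x s0); apply: ge0_subset_integral => //.
  - exact: (measurable_ellipsoid qd).
  - apply/measurable_EFinP; apply: measurable_funTS.
    by apply: (measurableT_comp (f := @powR R ^~ _)); first exact: measurable_powR.
  - by move=> y _; rewrite lee_fin powR_ge0.
  - by move=> y /= /andP[].
have kc : kap + (alpha - gam) = - beta by ring.
have kc0 : kap + (alpha - gam) < 0 by rewrite kc oppr_lt0.
have H := integral_far_le mrx mG (fun y => r0 _) G0 (powR_ge0 W' _) HG agam0 kc0 t0.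
apply: le_trans (le_max1_mul _ (powR_gt0 _ t0)).
rewrite -[X in (X)%:E]mulrA -powRM ?(ltW t0)//.
move: H; rewrite kc; apply: le_trans; rewrite le_eqVlt; apply/orP; left; apply/eqP.
by apply: eq_integral => y _; rewrite -EFinM /kernel mulrAC.
Qed.

(** Hoelder's inequality with the constant 1 in place of [g]: the volume of a ball grows like
    [t^gam], as does the integral of the power of [g] over a shell, whence the same exponent
    [kap]. *)
Lemma ball_average (x : 'cV[R]_n) (t : R) : 0 < t ->
  (\int[mu]_(y in ellipsoid rho x t) (f y)%:E <=
   ((fine (mu [set x | (rho x < 1)%R])) `^ (p / (p - 1))^-1 * t `^ kap)%:E)%E.
Proof.
move=> t0.
have mE := measurable_ellipsoid qd x t.
have := @hoelder_on _ (cst 1) (fine (mu [set x | (rho x < 1)%R])) t mE _ _ _ t0 _ (Hf x t0).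
rewrite (_ : (\int[mu]_(y in ellipsoid rho x t) (cst 1 y * f y)%:E)%E =
  (\int[mu]_(y in ellipsoid rho x t) (f y)%:E)%E); last first.
  by apply: eq_integral => y _; rewrite mul1r.
apply=> //; first by rewrite fine_ge0.
rewrite (eq_integral (cst 1%E)) => [|y _]; last by rewrite /= powR1.
rewrite integral_cst// mul1e [leLHS](ellipsoid_measure qd x t0) EFinM muleC.
by rewrite fineK// ge0_fin_numE//; exact: (rho_ball_fin qd).
Qed.

End fixed_function.

Lemma potential_morrey_le : exists2 C : R, 0 < C & forall f : 'cV[R]_n -> R,
  measurable_fun setT f -> (forall x, 0 <= f x) ->
  (forall x (r : R), 0 < r ->
    (\int[mu]_(y in ellipsoid rho x r) (f y `^ p)%:E <= (r `^ lam)%:E)%E) ->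
  forall x (r : R), 0 < r ->
    (\int[mu]_(y in ellipsoid rho x r) (potential f y `^ q) <= (C * r `^ lam)%:E)%E.
Proof.
have [C2 C20 near_] := kernel_near.
have [C3 C30 far] := kernel_far.
have [k k1 tri] := rho_quasi_triangle qd.
pose C1 := Num.max (2 `^ `|alpha - gam| / (1 - 2 `^ (- beta)) * W' `^ (p / (p - 1))^-1 *
     2 `^ (- beta)) 1.
have C10 : 0 < C1 by rewrite lt_max ltr01 orbT.
pose B := 2 * C1; have B0 : 0 < B by rewrite mulr_gt0.
pose c := 4 * C2 * B `^ (alpha / beta).
have c0 : 0 < c by rewrite !mulr_gt0// powR_gt0.
pose V := fine (mu [set x | (rho x < 1)%R]) `^ (p / (p - 1))^-1.
have V0 : 0 <= V by exact: powR_ge0.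
pose C5 := (C2 + B `^ (q - 1) * C3) * c `^ (p - 1).
have C50 : 0 < C5 by rewrite mulr_gt0 ?powR_gt0 ?addr_gt0 ?mulr_gt0 ?powR_gt0.
have k0 : 0 < k by exact: lt_le_trans k1.
have q1 : 1 < q by exact: lt_trans pq.
exists (4 * (C5 * (2 * k) `^ lam + B `^ (q - 1) * (C3 * V))).
  have h1 : 0 < C5 * (2 * k) `^ lam by rewrite mulr_gt0// powR_gt0// mulr_gt0.
  have h2 : 0 <= B `^ (q - 1) * (C3 * V).
    by apply: mulr_ge0; [exact: powR_ge0|apply: mulr_ge0; [exact: ltW|]].
  by rewrite mulr_gt0// ltr_wpDr.
move=> f mf f0 Hf x0 r r0'.
pose m (u : 'cV[R]_n * 'cV[R]_n) := Num.min ((c * f u.2) `^ (beta / (alpha + beta)))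
  (B * rho (u.1 - u.2) `^ (- beta)).
pose Phi u := kernel (u.1 - u.2) * f u.2 * m u `^ (q - 1).
pose E := ellipsoid rho x0 r; pose E' := ellipsoid rho x0 (2 * k * r).
pose L z := \1_([set z | r <= rho z]) z * (kernel z * rho z `^ (- (beta * (q - 1)))).
(* [F1] confines [y] to the larger ball and frees [x], so that [x] can be integrated over the whole
   space. [F2] confines only [x], and its minimum is replaced by the second term, which no longer
   depends on [f]. *)
pose F1 u := \1_E' u.2 * Phi u.
pose F2 u := \1_E u.1 * (B `^ (q - 1) * (L (u.1 - u.2) * f u.2)).
have ind0 (S : set 'cV[R]_n) y : 0 <= \1_S y :> R by rewrite indicE.
have Phi0 u : 0 <= Phi u by rewrite !mulr_ge0 ?powR_ge0.
have L0 z : 0 <= L z by rewrite !mulr_ge0 ?powR_ge0.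
have F10 u : 0 <= F1 u by rewrite mulr_ge0.
have F20 u : 0 <= F2 u by rewrite mulr_ge0// mulr_ge0 ?powR_ge0// mulr_ge0.
have mE : measurable E by exact: (measurable_ellipsoid qd).
have mE' : measurable E' by exact: (measurable_ellipsoid qd).
have msub := measurable_cv_sub.
have mf2 : measurable_fun setT (fun u : 'cV[R]_n * 'cV[R]_n => f u.2) by exact: measurableT_comp.
have mpw (e : R) : measurable_fun setT (@powR R ^~ e) by exact: measurable_powR.
have mks : measurable_fun setT (fun u : 'cV[R]_n * 'cV[R]_n => kernel (u.1 - u.2)).
  by apply: (measurableT_comp measurable_kernel).
have mm : measurable_fun setT m.
  apply: measurable_minr.
    by apply: (measurableT_comp (mpw _)); exact: measurable_funM.
  apply: measurable_funM => //; apply: (measurableT_comp (mpw _)).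
  exact: measurableT_comp mrho msub.
have mPhi : measurable_fun setT Phi.
  apply: measurable_funM; first exact: measurable_funM.
  by apply: (measurableT_comp (mpw _)).
have mL : measurable_fun setT L.
  apply: measurable_funM.
    apply: measurable_indic.
    have := mrho measurableT (measurable_itv `[r, +oo[).
    by rewrite setTI; congr measurable; apply/seteqP; split => x /=; rewrite in_itv/= andbT.
  apply: measurable_funM; first exact: measurable_kernel.
  by apply: (measurableT_comp (mpw _)).
have mF1 : measurable_fun setT F1.
  apply: measurable_funM => //.
  by apply: (measurableT_comp (f := \1_E' : 'cV[R]_n -> R)); [exact: measurable_indic|].
have mF2 : measurable_fun setT F2.
  apply: measurable_funM.
    by apply: (measurableT_comp (f := \1_E : 'cV[R]_n -> R)); [exact: measurable_indic|].
  apply: measurable_funM => //; apply: measurable_funM => //.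
  exact: measurableT_comp mL msub.
pose F u : \bar R := (F1 u + F2 u)%:E.
have mF : measurable_fun setT F by apply/measurable_EFinP; exact: measurable_funD.
have F0 u : (0 <= F u)%E by rewrite lee_fin addr_ge0.
have FF : measurable_fun setT (fun x => \int[mu]_y F (x, y))%E.
  exact: (measurable_fun_fubini_tonelli_F (m2 := mu) _ mF F0).
have domin x y : E x -> Phi (x, y) <= F1 (x, y) + F2 (x, y).
  move=> Ex; rewrite /F1 /F2 /=; have [rx|xr] := leP r (rho (x - y)).
    apply: ler_wpDl; first exact: (F10 (x, y)).
    rewrite indicE (mem_set Ex) mul1r /L indicE mem_set// mul1r /Phi /=.
    rewrite [leRHS](_ : _ = kernel (x - y) * f y * (B `^ (q - 1) * rho (x - y) `^ (- (beta * (q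
      - 1))))); last by ring.
    apply: ler_wpM2l; first by rewrite mulr_ge0// kernel_ge0.
    rewrite -mulNr [rho _ `^ (- _ * _)]powRrM -powRM ?powR_ge0 ?(ltW B0)//.
    apply: ge0_ler_powR; rewrite ?nnegrE ?subr_ge0 ?(ltW q1)//.
    - by rewrite le_min powR_ge0 mulr_ge0 ?powR_ge0// ltW.
    - by rewrite mulr_ge0 ?powR_ge0// ltW.
    - by rewrite /m ge_min lexx orbT.
  have E'y : E' y.
    rewrite /E' /ellipsoid /=; have -> : x0 - y = (x0 - x) + (x - y) by rewrite addrA subrK.
    apply: (le_lt_trans (tri _ _)).
    have -> : 2 * k * r = k * (r + r) by ring.
    by rewrite ltr_pM2l// ltrD.
  by rewrite indicE (mem_set E'y) mul1r lerDl; exact: (F20 (x, y)).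
apply: (@le_trans _ _ (4%:E * \int[mu]_x \int[mu]_y F (x, y))%E).
  rewrite -ge0_integralZl//; last by move=> x _; exact: integral_ge0.
  rewrite [leLHS]integral_mkcond; apply: le_integral_nonmeas => x _.
    by rewrite patchE; case: ifP => // _; rewrite poweR_ge0.
  rewrite patchE; case: ifPn => [/set_mem Ex|_]; last by rewrite mule_ge0// integral_ge0.
  have mx : measurable_fun setT (fun y : 'cV[R]_n => x - y) by exact: measurable_reflect.
  have H := @potential_powR_le _ _ _ mu (fun y => kernel (x - y)) f (fun y => rho (x - y))
    C1 C2 alpha beta q (measurableT_comp measurable_kernel mx) mf (measurableT_comp mrho mx)
    (fun y => kernel_ge0 _) f0 (fun y => r0 _) (fun y => @kernel_rho0 _) C10 C20 al0 be0 q1.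
  apply: le_trans (H _ _) _ => [t t0|t t0|].
  - exact: potential_far.
  - apply: le_trans (near_ _ t0); rewrite le_eqVlt; apply/orP; left; apply/eqP.
    rewrite -[RHS]integral_indicM -[LHS]integral_indicM.
    apply: (@ge0_integral_reflect _ _ x (fun z => (\1_([set z | (rho z < t)%R]) z * kernel z)%:E)).
      apply/measurable_EFinP; apply: measurable_funM; last exact: measurable_kernel.
      by apply: measurable_indic; exact: (measurable_rho_ball qd).
    by move=> z; rewrite lee_fin mulr_ge0// kernel_ge0.
  apply: lee_wpmul2l => //; apply: le_integral_nonmeas => y _; first exact: (Phi0 (x, y)).
  by rewrite lee_fin; exact: domin.
have mF1' : measurable_fun setT (EFin \o F1) by exact/measurable_EFinP.
have mF2' : measurable_fun setT (EFin \o F2) by exact/measurable_EFinP.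
have split_F : (\int[mu]_x \int[mu]_y F (x, y) = \int[mu]_y \int[mu]_x (F1 (x, y))%:E +
    \int[mu]_x \int[mu]_y (F2 (x, y))%:E)%E.
  have S0 := fubini_tonelli1 (m1 := mu) (m2 := mu) F mF F0.
  have S1 := fubini_tonelli2 (m1 := mu) (m2 := mu) (EFin \o F1) mF1' F10.
  have S2 := fubini_tonelli1 (m1 := mu) (m2 := mu) (EFin \o F2) mF2' F20.
  have S3 : (\int[mu \x mu]_u F u = \int[mu \x mu]_u (F1 u)%:E + \int[mu \x mu]_u (F2 u)%:E)%E.
    by rewrite -ge0_integralD// => u _; rewrite lee_fin.
  by apply: (etrans (esym S0)); rewrite S3; congr (_ + _)%E; [exact: S1|exact: S2].
rewrite split_F [leRHS](_ : _ = (4%:E * ((C5 * (2 * k * r) `^ lam)%:E +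
   (B `^ (q - 1) * (C3 * V) * r `^ lam)%:E))%E); last first.
  rewrite -EFinD -EFinM; congr (_%:E).
  by rewrite [(2 * k * r) `^ _]powRM ?mulr_ge0 ?(ltW k0) ?(ltW r0')//; ring.
apply: lee_wpmul2l => //; apply: leeD.
  apply: (@le_trans _ _ (\int[mu]_y (C5%:E * (\1_E' y * f y `^ p)%:E))%E).
    apply: le_integral_nonmeas => y _; first by apply: integral_ge0 => x _; rewrite lee_fin.
    have H := @min_weight_integral_le _ _ _ mu kernel rho B C2 C3 alpha beta p q c (f y)
      measurable_kernel mrho kernel_ge0 r0 B0 c0 C20 C30 al0 be0 q1 p0 beq (f0 y) near_ far.
    rewrite indicE; case: (boolP (y \in E')) => yE; last first.
      rewrite mul0r mule0 integral0_eq// => x _; by rewrite /F1 indicE (negbTE yE) mul0r.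
    rewrite mul1r -EFinM; apply: le_trans H; rewrite le_eqVlt; apply/orP; left; apply/eqP.
    rewrite -[RHS](@ge0_integral_translate _ _ (- y)).
    - by apply: eq_integral => x _; rewrite /F1 indicE yE mul1r.
    - apply/measurable_EFinP; apply: measurable_funM.
        by apply: measurable_funM => //; exact: measurable_kernel.
      apply: (measurableT_comp (mpw _)).
      apply: measurable_minr => //; apply: measurable_funM => //.
      by apply: (measurableT_comp (mpw _)).
    - by move=> x; rewrite lee_fin !mulr_ge0 ?powR_ge0.
  rewrite ge0_integralZl//; last 3 first.
  - apply/measurable_EFinP; apply: measurable_funM; first exact: measurable_indic.
    by apply: (measurableT_comp (mpw _)).
  - by move=> y _; rewrite lee_fin mulr_ge0// powR_ge0.
  - by rewrite lee_fin ltW.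
  rewrite [leRHS]EFinM; apply: lee_wpmul2l; first by rewrite lee_fin ltW.
  by rewrite integral_indicM; apply: Hf; rewrite !mulr_gt0.
(* With [z = x - y] as second variable and [x] integrated first, what remains for each [z] is the
   integral of [f] over a translate of [E], bounded uniformly in [z] by [ball_average]. *)
pose F2' (u : 'cV[R]_n * 'cV[R]_n) : \bar R :=
  (\1_E u.1 * (B `^ (q - 1) * (L u.2 * f (u.1 - u.2))))%:E.
have mF2'' : measurable_fun setT F2'.
  apply/measurable_EFinP; apply: measurable_funM.
    by apply: (measurableT_comp (f := \1_E : 'cV[R]_n -> R)); [exact: measurable_indic|].
  apply: measurable_funM => //; apply: measurable_funM; first exact: measurableT_comp.
  exact: measurableT_comp mf msub.
have F2'0 u : (0 <= F2' u)%E.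
  by rewrite lee_fin mulr_ge0// mulr_ge0 ?powR_ge0// mulr_ge0.
have -> : (\int[mu]_x \int[mu]_y (F2 (x, y))%:E = \int[mu]_x \int[mu]_z F2' (x, z))%E.
  apply: eq_integral => x _.
  rewrite -[RHS](@ge0_integral_reflect _ _ x)//; last first.
    by apply: (measurableT_comp mF2''); exact: pair1_measurable.
  by apply: eq_integral => y _; rewrite /F2' /F2 /= subKr.
have S := fubini_tonelli (m1 := mu) (m2 := mu) F2' mF2'' F2'0.
rewrite [leLHS]S.
apply: (@le_trans _ _ (\int[mu]_z ((B `^ (q - 1) * (V * r `^ kap))%:E * (L z)%:E))%E).
  apply: le_integral_nonmeas => z _; first by apply: integral_ge0 => x _; exact: F2'0.
  have := ball_average mf f0 Hf (x0 - z) r0'; rewrite -/V => H.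
  apply: (@le_trans _ _ ((B `^ (q - 1) * L z)%:E * \int[mu]_x (\1_E x * f (x - z))%:E)%E).
    have mEf : measurable_fun setT (fun x => (\1_E x * f (x - z))%:E).
      apply/measurable_EFinP; apply: measurable_funM; first exact: measurable_indic.
      by apply: (measurableT_comp mf); apply: measurable_subcv.
    have Ef0 x : [set: 'cV[R]_n] x -> (0 <= (\1_E x * f (x - z))%:E)%E.
      by move=> _; rewrite lee_fin mulr_ge0.
    have BL : (0 <= (B `^ (q - 1) * L z)%:E)%E by rewrite lee_fin mulr_ge0 ?powR_ge0.
    rewrite -[leRHS](ge0_integralZl _ measurableT mEf Ef0 BL).
    apply: le_integral_nonmeas => x _; first exact: F2'0.
    rewrite -EFinM lee_fin /F2' /= le_eqVlt; apply/orP; left; apply/eqP; ring.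
  rewrite -EFinM [leRHS](_ : _ = ((B `^ (q - 1) * L z)%:E * (V * r `^ kap)%:E)%E); last first.
    by rewrite -EFinM; congr (_%:E); ring.
  apply: lee_wpmul2l; first by rewrite lee_fin mulr_ge0 ?powR_ge0.
  apply: le_trans H; rewrite -[leRHS]integral_indicM.
  rewrite -[leRHS](@ge0_integral_translate _ _ (- z)); last 2 first.
  - apply/measurable_EFinP; apply: measurable_funM; last exact: mf.
    by apply: measurable_indic; exact: (measurable_ellipsoid qd).
  - by move=> x; rewrite lee_fin mulr_ge0.
  rewrite le_eqVlt; apply/orP; left; apply/eqP; apply: eq_integral => x _.
  congr (_ * _)%:E; rewrite !indicE; congr (nat_of_bool _)%:R.
  have xE : x0 - z - (x - z) = x0 - x by rewrite opprB addrA subrK.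
  by apply/idP/idP => /set_mem h; apply/mem_set; move: h; rewrite /E /ellipsoid /= xE.
have mLE : measurable_fun setT (fun z => (L z)%:E) by exact/measurable_EFinP.
have L0E z : [set: 'cV[R]_n] z -> (0 <= (L z)%:E)%E by move=> _; rewrite lee_fin.
have BV : (0 <= (B `^ (q - 1) * (V * r `^ kap))%:E)%E by rewrite lee_fin !mulr_ge0 ?powR_ge0.
rewrite (ge0_integralZl _ measurableT mLE L0E BV).
rewrite [(\int[mu]_z (L z)%:E)%E]integral_indicM.
apply: (@le_trans _ _ ((B `^ (q - 1) * (V * r `^ kap))%:E * (C3 * r `^ (alpha - beta * (q -
  1)))%:E)%E).
  by apply: lee_wpmul2l; [rewrite lee_fin !mulr_ge0 ?powR_ge0|exact: far].
rewrite -EFinM lee_fin le_eqVlt; apply/orP; left; apply/eqP.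
(* The average contributes [r^kap] and the tail of the kernel [r^(alpha - beta * (q - 1))]; the
   exponents add up to [gam - beta * q], which is [lam]. *)
have bq : beta * q = gam - lam by exact: (divfK (lt0r_neq0 q0)).
have lamE : kap + (alpha - beta * (q - 1)) = lam.
  rewrite (_ : kap + _ = gam - beta * q); last by ring.
  by rewrite bq; ring.
have -> : r `^ lam = r `^ kap * r `^ (alpha - beta * (q - 1)).
  by rewrite -(powRD_gt0 _ _ r0') lamE.
by ring.
Qed.

End riesz_potential.

(** * Morrey spaces *)

Section morrey_norm.
Variables (R : realType) (n : nat) (P : 'M[R]_n) (rho : 'cV[R]_n -> R).
Local Notation mu := (@lebesgue_cv R n).
Implicit Types (f : 'cV[R]_n -> \bar R) (D : set 'cV[R]_n).

Lemma Lp_norm_onE (p : R) D f : 0 < p ->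
  Lp_norm_on p D f = ((\int[mu]_(x in D) (`|f x| `^ p)) `^ p^-1)%E.
Proof.
move=> p0; rewrite /Lp_norm_on unlock; congr (_ `^ _)%E.
rewrite [RHS]integral_mkcond; apply: eq_integral => x _.
rewrite !patchE; case: ifP => // _.
by rewrite abse0 -[0%E]/(0%:E) poweR_EFin powR0// gt_eqF.
Qed.

Lemma Lp_norm_on_le (p c : R) D f : 0 < p -> 0 <= c ->
  (Lp_norm_on p D f <= c%:E)%E = (\int[mu]_(x in D) (`|f x| `^ p) <= (c `^ p)%:E)%E.
Proof.
move=> p0 c0; rewrite Lp_norm_onE//; have pN : p != 0 by rewrite gt_eqF.
have : (0 <= \int[mu]_(x in D) (`|f x| `^ p))%E.
  by apply: integral_ge0 => x _; exact: poweR_ge0.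
case: (\int[mu]_(x in D) (`|f x| `^ p))%E => [I| |]//.
- rewrite poweR_EFin !lee_fin => I0.
  apply/idP/idP => [h|h].
    rewrite -[leLHS](powRr1 I0) -[1%R](mulVf pN) powRrM.
    by apply: ge0_ler_powR; rewrite ?nnegrE ?powR_ge0 ?(ltW p0).
  rewrite -[leRHS](powRr1 c0) -[1%R](mulfV pN) powRrM.
  by apply: ge0_ler_powR; rewrite ?nnegrE ?powR_ge0 ?invr_ge0 ?(ltW p0).
- by move=> _; rewrite poweRyr ?invr_eq0 ?gt_eqF// !leye_eq.
Qed.

Lemma morrey_norm_leP (p lam F : R) f : 0 < p -> 0 <= F ->
  (morrey_norm rho p lam f <= F%:E)%E <->
  (forall x (r : R), 0 < r ->
    (\int[mu]_(y in ellipsoid rho x r) (`|f y| `^ p) <= (F `^ p * r `^ lam)%:E)%E).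
Proof.
move=> p0 F0.
have E x (r : R) : 0 < r ->
    ((r `^ (- lam / p))%:E * Lp_norm_on p (ellipsoid rho x r) f <= F%:E)%E =
    (\int[mu]_(y in ellipsoid rho x r) (`|f y| `^ p) <= (F `^ p * r `^ lam)%:E)%E.
  move=> r0; have rl : 0 < r `^ (lam / p) by exact: powR_gt0.
  rewrite mulNr powRN lee_pdivrMl// -EFinM Lp_norm_on_le ?mulr_ge0 ?powR_ge0//.
  by rewrite powRM ?powR_ge0// -powRrM divfK ?gt_eqF// mulrC.
split=> [h x r r0|h].
  rewrite -E//; apply: le_trans h; apply: ereal_sup_ubound.
  by exists (x, r).
by apply: ge_ereal_sup => _ [[x r] /= r0 <-]; rewrite E//; exact: h.
Qed.

Hypothesis qd : quasi_distance P rho.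

(** Local integrability comes for free: a compact set is bounded, hence contained in a ball of [rho]
    by [rho_bounded]. *)
Lemma morreyP (p lam F : R) f : 0 < p -> 0 <= F -> ae_measurable mu f ->
  (forall x (r : R), 0 < r ->
    (\int[mu]_(y in ellipsoid rho x r) (`|f y| `^ p) <= (F `^ p * r `^ lam)%:E)%E) ->
  morrey rho p lam f.
Proof.
move=> p0 F0 mf h; split; last first.
  by apply: le_lt_trans (ltry F); apply/morrey_norm_leP.
split => // K /compact_bounded[M [Mreal HM]].
have [r r0 Hr] := rho_bounded qd (Num.max M 0 + 1).
have KE : K `<=` ellipsoid rho 0 (r + 1).
  move=> x Kx; rewrite /ellipsoid /= sub0r (rhoN qd).
  apply: (@le_lt_trans _ _ r); last by rewrite ltrDl.
  apply: Hr; apply: HM => //; apply: (@le_lt_trans _ _ (Num.max M 0)).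
    by rewrite le_max lexx.
  by rewrite ltrDl.
have r10 : 0 < r + 1 by rewrite addr_gt0.
pose c := (F `^ p * (r + 1) `^ lam) `^ p^-1.
apply: (@le_lt_trans _ _ c%:E); last exact: ltry.
rewrite Lp_norm_on_le ?powR_ge0// /c -powRrM mulVf ?gt_eqF// powRr1; last first.
  by rewrite mulr_ge0 ?powR_ge0.
apply: le_trans (h 0 _ r10).
rewrite integral_mkcond [leRHS]integral_mkcond; apply: le_integral_nonmeas => x _.
  by rewrite patchE; case: ifP => // _; exact: poweR_ge0.
rewrite !patchE; case: ifPn => [/set_mem /KE Ex|_]; first by rewrite mem_set.
by case: ifP => // _; exact: poweR_ge0.
Qed.

(** Infinite values of [f] occur only on a null set, because its [p]-th power is integrable over the
    balls of integer radius, which cover the space. *)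
Lemma morrey_real_representative (p lam : R) f : 0 < p -> morrey rho p lam f ->
  exists f0 : 'cV[R]_n -> R, [/\ measurable_fun setT f0, forall x, 0 <= f0 x &
    {ae mu, forall x, `|f x|%E = (f0 x)%:E}].
Proof.
move=> p0 [[[fb mfb ffb] _] fin_norm].
have mabs : measurable_fun setT (fun x => `|fb x|%E) by exact: measurableT_comp.
exists (fun x => fine `|fb x|%E); split.
- exact: measurableT_comp.
- by move=> x; rewrite fine_ge0.
have [F F0 HF] : exists2 F : R, 0 <= F & (morrey_norm rho p lam f <= F%:E)%E.
  case: (morrey_norm _ _ _ _) fin_norm => [F| |]// _.
    by exists `|F|; rewrite // lee_fin ler_norm.
  by exists 0; rewrite // leNye.
move/(morrey_norm_leP _ _ p0 F0) : HF => HF.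
have fin_k (k : nat) : {ae mu, forall x,
  ellipsoid rho 0 k.+1%:R x -> (`|fb x| `^ p)%E \is a fin_num}.
  apply: integrable_ae; first exact: (measurable_ellipsoid qd).
  have mp : measurable_fun (ellipsoid rho 0 k.+1%:R) (fun x => `|fb x| `^ p)%E.
    apply: measurable_funTS; apply: (measurableT_comp (f := @poweR R ^~ p)) => //.
    exact: measurable_poweR.
  apply/integrableP; split => //.
  apply: le_lt_trans (ltry (F `^ p * k.+1%:R `^ lam)).
  apply: le_trans (HF 0 k.+1%:R _); last by rewrite ltr0n.
  rewrite le_eqVlt; apply/orP; left; apply/eqP.
  rewrite integral_mkcond [RHS]integral_mkcond; apply: ae_eq_integralT.
  apply: filterS ffb => x fx; rewrite !patchE; case: ifP => // _.
  by rewrite gee0_abs ?poweR_ge0// fx.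
have := ae_foralln fin_k.
apply: (filterS2 _ _ ffb) => x -> finx; rewrite fineK//.
have [k xk] : exists k : nat, rho (0 - x) < k.+1%:R.
  by exists (Num.truncn (rho (0 - x))); exact: truncnS_gt.
have := finx k xk; case: (fb x) => [y| |]//=; by rewrite gt_eqF.
Qed.

End morrey_norm.

(** * Operators dominated by the potential *)

Section bounded_by_potential.
Variables (R : realType) (n : nat) (P : 'M[R]_n) (rho : 'cV[R]_n -> R).
Hypothesis qd : quasi_distance P rho.
Local Notation mu := (@lebesgue_cv R n).
Variables (g : 'cV[R]_n -> R) (alpha p q lam C : R).
Hypotheses (mg : measurable_fun setT g) (al : 0 < alpha < \tr P).
Hypotheses (p0 : 0 < p) (q0 : 0 < q) (C0 : 0 < C).
Hypothesis HC : forall f : 'cV[R]_n -> R,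
  measurable_fun setT f -> (forall x, 0 <= f x) ->
  (forall x (r : R), 0 < r ->
    (\int[mu]_(y in ellipsoid rho x r) (f y `^ p)%:E <= (r `^ lam)%:E)%E) ->
  forall x (r : R), 0 < r ->
    (\int[mu]_(y in ellipsoid rho x r) (potential P rho g alpha f y `^ q) <=
      (C * r `^ lam)%:E)%E.

Lemma potential_ge0 (f : 'cV[R]_n -> R) x : (forall y, 0 <= f y) ->
  (0 <= potential P rho g alpha f x)%E.
Proof.
by move=> f0; apply: integral_ge0 => y _; rewrite lee_fin mulr_ge0// kernel_ge0.
Qed.

Lemma potentialZ (F : R) (f : 'cV[R]_n -> R) x : 0 < F -> measurable_fun setT f ->
  (forall y, 0 <= f y) ->
  potential P rho g alpha f x = (F%:E * potential P rho g alpha (fun y => (f y / F)%R) x)%E.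
Proof.
move=> F0 mf f0; rewrite /potential -ge0_integralZl//; last 3 first.
- apply/measurable_EFinP; apply: measurable_funM; last exact: measurable_funM.
  apply: (measurableT_comp (measurable_kernel qd alpha mg)); exact: measurable_reflect.
- by move=> y _; rewrite lee_fin mulr_ge0 ?kernel_ge0// divr_ge0// ltW.
- by rewrite lee_fin ltW.
apply: eq_integral => y _; rewrite -EFinM; congr (_%:E).
by field; rewrite gt_eqF.
Qed.

Lemma morrey_norm_ge0 f : (0 <= morrey_norm rho p lam f)%E.
Proof.
apply: (@le_trans _ _ ((1 `^ (- lam / p))%:E * Lp_norm_on p (ellipsoid rho 0 1) f)%E).
  rewrite mule_ge0 ?lee_fin ?powR_ge0// Lp_norm_onE//; exact: poweR_ge0.
by apply: ereal_sup_ubound; exists (0 : 'cV[R]_n, 1 : R); rewrite /= ?ltr01.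
Qed.

(** The estimate [HC] is for normalised functions. Division is by an arbitrary [F > m], not by the
    norm [m], which may be 0; the bound for [m] follows as [F] decreases to it. *)
Lemma morrey_bounded_of_potential (A : R)
    (T : ('cV[R]_n -> \bar R) -> 'cV[R]_n -> \bar R) : 0 < A ->
  (forall f (f0 : 'cV[R]_n -> R), ae_measurable mu f -> measurable_fun setT f0 ->
    (forall x, 0 <= f0 x) -> {ae mu, forall x, `|f x|%E = (f0 x)%:E} ->
    ae_measurable mu (T f) /\
    forall x, (`|T f x| <= A%:E * potential P rho g alpha f0 x)%E) ->
  morrey_bounded rho p q lam T.
Proof.
move=> A0 HT; pose K := A * C `^ q^-1.
have K0 : 0 < K by rewrite mulr_gt0// powR_gt0.
exists K => f fM.
have [f0 [mf0 f00 ff0]] := morrey_real_representative qd p0 fM.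
have [mT leT] := HT _ _ fM.1.1 mf0 f00 ff0.
have bound (F : R) : 0 < F -> (morrey_norm rho p lam f <= F%:E)%E ->
    forall x (r : R), 0 < r ->
    (\int[mu]_(y in ellipsoid rho x r) (`|T f y| `^ q) <= ((K * F) `^ q * r `^ lam)%:E)%E.
  move=> F0 /(morrey_norm_leP _ _ _ p0 (ltW F0)) HF x r r0.
  pose f1 y := f0 y / F.
  have mf1 : measurable_fun setT f1 by exact: measurable_funM.
  have f10 y : 0 <= f1 y by rewrite divr_ge0// ltW.
  have Hf1 z (s : R) : 0 < s ->
      (\int[mu]_(y in ellipsoid rho z s) (f1 y `^ p)%:E <= (s `^ lam)%:E)%E.
    move=> s0; have mE := measurable_ellipsoid qd z s.
    have Fp : 0 < F `^ p by exact: powR_gt0.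
    have -> : (\int[mu]_(y in ellipsoid rho z s) (f1 y `^ p)%:E =
        ((F `^ p)^-1)%:E * \int[mu]_(y in ellipsoid rho z s) (f0 y `^ p)%:E)%E.
      rewrite -ge0_integralZl//; last 3 first.
      - apply: measurable_funTS; apply/measurable_EFinP.
        by apply: (measurableT_comp (f := @powR R ^~ p)) => //; exact: measurable_powR.
      - by move=> y _; rewrite lee_fin powR_ge0.
      - by rewrite lee_fin invr_ge0 ltW.
      apply: eq_integral => y _; rewrite -EFinM /f1 powRM ?invr_ge0 ?(ltW F0)//.
      rewrite mulrC; congr (_ * _)%:E.
      by rewrite -powRN -[F^-1]powR_inv1 ?(ltW F0)// -powRrM mulN1r.
    rewrite lee_pdivrMl// -EFinM; apply: le_trans (HF z s s0).
    rewrite le_eqVlt; apply/orP; left; apply/eqP.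
    rewrite integral_mkcond [RHS]integral_mkcond; apply: ae_eq_integralT.
    by apply: filterS ff0 => y fy; rewrite !patchE; case: ifP => // _; rewrite fy poweR_EFin.
  have mpot := measurable_potential qd alpha mg mf1 f10.
  have mpq : measurable_fun (ellipsoid rho x r) (fun y => potential P rho g alpha f1 y `^ q)%E.
    apply: measurable_funTS; apply: (measurableT_comp (f := @poweR R ^~ q)) => //.
    exact: measurable_poweR.
  have AF0 : 0 < A * F by rewrite mulr_gt0.
  apply: (@le_trans _ _ (\int[mu]_(y in ellipsoid rho x r)
      (((A * F) `^ q)%:E * potential P rho g alpha f1 y `^ q))%E).
    apply: le_integral_nonmeas => y _; first exact: poweR_ge0.
    have pot0 := potential_ge0 y f10.
    rewrite -poweR_EFin -poweRM ?lee_fin ?(ltW AF0)//.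
    apply: gt0_ler_poweR; rewrite ?(ltW q0) ?in_itv/= ?leey ?andbT//.
      by rewrite mule_ge0// lee_fin ltW.
    by rewrite EFinM -muleA -potentialZ//; exact: leT.
  rewrite ge0_integralZl//; last 3 first.
  - exact: (measurable_ellipsoid qd).
  - by move=> y _; exact: poweR_ge0.
  - by rewrite lee_fin powR_ge0.
  apply: (@le_trans _ _ (((A * F) `^ q)%:E * (C * r `^ lam)%:E)%E).
    by apply: lee_wpmul2l; [rewrite lee_fin powR_ge0|exact: HC].
  rewrite -EFinM lee_fin le_eqVlt; apply/orP; left; apply/eqP.
  rewrite mulrA; congr (_ * _).
  rewrite /K [A * _ * F]mulrAC [RHS]powRM ?powR_ge0 ?(ltW AF0)// -powRrM mulVf ?gt_eqF//.
  by rewrite powRr1// ltW.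
have := morrey_norm_ge0 f; have := fM.2.
case: (morrey_norm rho p lam f) bound => [m| |]// bound _; rewrite lee_fin => m0.
have bound' (F : R) : m < F -> forall x (r : R), 0 < r ->
    (\int[mu]_(y in ellipsoid rho x r) (`|T f y| `^ q) <= ((K * F) `^ q * r `^ lam)%:E)%E.
  by move=> mF; apply: bound; [exact: le_lt_trans mF|rewrite lee_fin ltW].
split.
  apply: (@morreyP _ _ _ _ qd q lam (K * (m + 1))) => //.
    by rewrite mulr_ge0 ?(ltW K0)// addr_ge0.
  by apply: bound'; rewrite ltrDl.
apply/lee_addgt0Pr => e e0.
rewrite -EFinM -EFinD; have -> : K * m + e = K * (m + e / K).
  by field; rewrite gt_eqF.
apply/(morrey_norm_leP _ _ _ q0); first by rewrite mulr_ge0 ?(ltW K0)// addr_ge0// ltW// divr_gt0.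
by apply: bound'; rewrite ltrDl divr_gt0.
Qed.

End bounded_by_potential.

(** * Measurability and domination of the two operators *)

Section operators.
Variables (R : realType) (n : nat) (P : 'M[R]_n) (rho : 'cV[R]_n -> R).
Hypothesis qd : quasi_distance P rho.
Local Notation mu := (@lebesgue_cv R n).
Local Notation gam := (\tr P).
Variables (Omega g : 'cV[R]_n -> R) (alpha : R).
Hypotheses (mg : measurable_fun setT g) (Og : {ae mu, forall x, Omega x = g x}).
Hypothesis al : 0 < alpha < gam.

Let gam0 : 0 < gam. Proof. by case/andP: al => a0 /(lt_trans a0). Qed.

(** With this, replacing [Omega] and [f] by Borel representatives changes the value of neither
    operator at any point [x]. *)
Lemma ae_reflect (A : 'cV[R]_n -> Prop) x : {ae mu, forall y, A y} ->
  {ae mu, forall y, A (x - y)}.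
Proof.
move=> [N [mN N0 NP]]; exists ((fun y => x - y) @^-1` N); split.
- by have := measurable_reflect x measurableT mN; rewrite setTI.
- by have := lebesgue_cv_reflect x mN; rewrite N0.
- by move=> y /= ne; apply: NP.
Qed.

(** The origin is fixed by the dilation by 2, which gives [m = 2^(- gam) * m] for its volume [m],
    finite since the origin lies in a ball of [rho]. *)
Lemma ae_neq0 : {ae mu, forall y : 'cV[R]_n, y != 0}.
Proof.
have rho_eq0 : [set y : 'cV[R]_n | rho y = 0] = [set 0].
  apply/seteqP; split => y /=; last by move=> ->; exact: rho0 qd.
  by move=> y0; apply/eqP; apply: contraT => /(rho_gt0 qd); rewrite y0 ltxx.
have m0 : measurable ([set 0] : set 'cV[R]_n).
  rewrite -rho_eq0; have := rho_measurable qd measurableT (measurable_set1 (0 : R)).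
  by rewrite setTI.
exists [set 0]; split => //; last by move=> y /= /negP; rewrite negbK => /eqP.
have := lebesgue_cv_dil qd (t := 2) _ m0.
have -> : mulmx (dil P 2) @^-1` [set 0] = [set 0 : 'cV[R]_n].
  rewrite -rho_eq0; apply/seteqP; split => y /=; rewrite (rho_dil qd)//.
    by move/eqP; rewrite mulf_eq0 pnatr_eq0/= => /eqP.
  by move=> ->; rewrite mulr0.
move=> /(_ (ltr0Sn _ 1)); have : (mu [set 0%R] < +oo)%E.
  apply: le_lt_trans (rho_ball_fin qd); apply: le_measure; rewrite ?inE//.
    exact: (measurable_rho_ball qd).
  by move=> y /= ->; rewrite (rho0 qd).
have : (0 <= mu [set 0%R])%E by [].
case: (mu [set 0]) => [m| |]//; rewrite lee_fin => m_ge0 _.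
move=> /(congr1 fine)/= mE.
congr (_%:E); apply/eqP; rewrite eq_le m_ge0 andbT.
have h : 2 `^ (- gam) < 1.
  rewrite powRN invf_lt1 ?powR_gt0// -[ltLHS](congr1 (@^~ gam) (powR1 R)).
  by apply: gt0_ltr_powR; rewrite ?nnegrE// ltr1n.
have : (1 - 2 `^ (- gam)) * m = 0 by rewrite mulrBl mul1r -mE subrr.
by move/eqP; rewrite mulf_eq0 subr_eq0 gt_eqF//= => /eqP->.
Qed.

Lemma integral_op_le (f : 'cV[R]_n -> \bar R) (f0 : 'cV[R]_n -> R) :
  ae_measurable mu f -> measurable_fun setT f0 ->
  (forall x, 0 <= f0 x) -> {ae mu, forall x, `|f x|%E = (f0 x)%:E} ->
  ae_measurable mu (integral_op rho P Omega alpha f) /\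
  forall x, (`|integral_op rho P Omega alpha f x| <=
    1%:E * potential P rho g alpha f0 x)%E.
Proof.
move=> [fb mfb ffb] mf0 f00 ff0.
have mpw (e : R) : measurable_fun setT (@powR R ^~ e) by exact: measurable_powR.
pose w z := g z * rho z `^ (alpha - gam).
have mw : measurable_fun setT w.
  apply: measurable_funM => //; apply: (measurableT_comp (mpw _)).
  exact: rho_measurable qd.
pose H (u : 'cV[R]_n * 'cV[R]_n) := ((w (u.1 - u.2))%:E * fb u.2)%E.
have mH : measurable_fun setT H.
  apply: emeasurable_funM; last exact: measurableT_comp.
  apply/measurable_EFinP; apply: (measurableT_comp mw); exact: measurable_cv_sub.
have opE x : integral_op rho P Omega alpha f x = (\int[mu]_y H (x, y))%E.
  apply: ae_eq_integralT; apply: (filterS2 _ _ (ae_reflect x Og) ffb) => y Oy fy.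
  by rewrite /H /w /= Oy fy -powRN opprB.
split.
  exists (integral_op rho P Omega alpha f); last exact: aeW.
  (* At every point, even where both parts are infinite, the operator is this difference of two
     Tonelli integrals; so it is itself Borel. *)
  rewrite (_ : integral_op _ _ _ _ _ = fun x => (\int[mu]_y (H^\+)%E (x,
    y) - \int[mu]_y (H^\-)%E (x, y))%E); last first.
    apply/funext => x; rewrite opE integralE.
    by congr (_ - _)%E; apply: eq_integral => y _; rewrite ?funeposE ?funenegE.
  apply: emeasurable_funB.
    apply: (measurable_fun_fubini_tonelli_F (m2 := mu)) => //; exact: measurable_funepos.
  apply: (measurable_fun_fubini_tonelli_F (m2 := mu)) => //; exact: measurable_funeneg.
move=> x; rewrite mul1e opE.
have mHx : measurable_fun setT (fun y => H (x, y)).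
  by apply: (measurableT_comp mH); exact: pair1_measurable.
apply: (le_trans (le_abse_integral _ measurableT mHx)).
rewrite le_eqVlt; apply/orP; left; apply/eqP; apply: ae_eq_integralT.
apply: (filterS2 _ _ ff0 ffb) => y fy fby.
by rewrite /H abseM -fby fy /= /w normrM /kernel [`|_ `^ _|]ger0_norm ?powR_ge0.
Qed.

Section maximal.
Variable f0 : 'cV[R]_n -> R.
Hypotheses (mf0 : measurable_fun setT f0) (f00 : forall x, 0 <= f0 x).

(** Balls of radius [t] have [t^gam] times the volume of the unit ball, so the factor in the maximal
    operator is [A * t^(alpha - gam)]. *)
Let A := fine (mu [set x | (rho x < 1)%R]) `^ (-1 + alpha / gam).

Let A0 : 0 < A.
Proof. by rewrite powR_gt0// fine_gt0// (rho_ball_gt0 qd) (rho_ball_fin qd). Qed.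

Let G (x y : 'cV[R]_n) : \bar R := (`|g (x - y)| * f0 y)%:E.

Let G0 x y : (0 <= G x y)%E. Proof. by rewrite lee_fin mulr_ge0. Qed.

Let mG : measurable_fun setT (fun u : 'cV[R]_n * 'cV[R]_n => G u.1 u.2).
Proof.
apply/measurable_EFinP; apply: measurable_funM; last exact: measurableT_comp.
by apply: measurableT_comp => //; apply: (measurableT_comp mg); exact: measurable_cv_sub.
Qed.

Let mGx x : measurable_fun setT (G x).
Proof. by apply: (measurableT_comp mG (pair1_measurable x)). Qed.

Let M x (t : R) : \bar R := ((A * t `^ (alpha - gam))%:E * \int[mu]_(y in ellipsoid rho x t) G x
  y)%E.

Let M0 x t : (0 <= M x t)%E.
Proof.
by rewrite mule_ge0 ?integral_ge0// lee_fin mulr_ge0 ?powR_ge0.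
Qed.

Let measurable_M t : measurable_fun setT (M ^~ t).
Proof.
apply: emeasurable_funM => //.
pose H (u : 'cV[R]_n * 'cV[R]_n) : \bar R :=
  ((\1_([set z | (rho z < t)%R]) (u.1 - u.2))%:E * G u.1 u.2)%E.
have mH : measurable_fun setT H.
  apply: emeasurable_funM => //; apply/measurable_EFinP.
  apply: (measurableT_comp (f := \1_([set z | rho z < t]) : 'cV[R]_n -> R)).
    by apply: measurable_indic; exact: (measurable_rho_ball qd).
  exact: measurable_cv_sub.
have H0 u : (0 <= H u)%E by rewrite mule_ge0// lee_fin indicE.
rewrite (_ : (fun x => _) = (fun x => \int[mu]_y H (x, y))%E).
  exact: (measurable_fun_fubini_tonelli_F (m2 := mu)).
apply/funext => x; rewrite integral_mkcond; apply: eq_integral => y _.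
rewrite patchE /H indicE (_ : (_ - _ \in _) = (y \in ellipsoid rho x t))//.
by case: ifP => _; rewrite ?mul1e ?mul0e.
Qed.

Let dyad (t : R) (j : nat) : R := (Num.truncn (t * 2 ^+ j))%:R / 2 ^+ j.

Let dyad_le t j : 0 < t -> dyad t j <= t.
Proof.
move=> t0; rewrite ler_pdivrMr ?exprn_gt0//.
by rewrite truncn_le// mulr_ge0 ?exprn_ge0// ltW.
Qed.

Let dyad_gt t r : 0 < t -> r < t -> \forall j \near \oo, r < dyad t j.
Proof.
move=> t0 rt; have tr0 : 0 < t - r by rewrite subr_gt0.
exists (Num.truncn (t - r)^-1).+1 => // j /= jN.
have h : (t - r)^-1 < 2 ^+ j.
  apply: (lt_le_trans (truncnS_gt _)).
  by rewrite -natrX ler_nat (leq_trans jN)// ltnW// ltn_expl.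
have h2 : 1 < (t - r) * 2 ^+ j by rewrite -ltr_pdivrMl// mulr1.
rewrite ltr_pdivlMr ?exprn_gt0//.
have := truncnS_gt (t * 2 ^+ j); rewrite -natr1; move: h2; rewrite mulrBl; lra.
Qed.

(** A supremum over countably many radii, to make the maximal operator measurable. *)
Let sup_M x := ereal_sup (range (fun j => ereal_sup (range (fun k : nat =>
  M x (k.+1%:R / 2 ^+ j))))).

(* Fatou's lemma along the dyadic radii below [t], which tend to [t]. *)
Let M_le_sup x t : 0 < t -> (M x t <= sup_M x)%E.
Proof.
move=> t0; have M_le k j : (M x (k.+1%:R / 2 ^+ j) <= sup_M x)%E.
  apply: (@le_trans _ _ (ereal_sup (range (fun k : nat => M x (k.+1%:R / 2 ^+ j))))).
    by apply: ereal_sup_ubound; exists k.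
  by apply: ereal_sup_ubound; exists j.
have := le_trans (M0 _ _) (M_le 0 0).
case: (sup_M x) M_le => [S| |]// M_le; rewrite ?leey//.
rewrite lee_fin => S0.
have ag : alpha - gam <= 0 by case/andP: al => _ ?; rewrite subr_le0 ltW.
have B0 : 0 < A * t `^ (alpha - gam) by rewrite mulr_gt0// powR_gt0.
rewrite /M muleC -lee_pdivlMr// -EFinM.
have dyad_bound j : (\int[mu]_(y in ellipsoid rho x (dyad t j)) G x y <=
    (S * (A * t `^ (alpha - gam))^-1)%:E)%E.
  rewrite EFinM lee_pdivlMr// muleC; have := dyad_le j t0; rewrite /dyad.
  (* Rounding down may give the radius 0, which does not occur in [sup_M]; its ball is empty.
     Otherwise the smaller radius has the larger factor, as [alpha - gam] is negative. *)
  case: (Num.truncn (t * 2 ^+ j)) => [|k] kt.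
    rewrite mul0r (_ : ellipsoid rho x 0 = set0) ?integral_set0 ?mule0//.
    by apply/seteqP; split => y //=; rewrite /ellipsoid /= ltNge (rho_ge0 qd).
  apply: le_trans (M_le k j); apply: lee_wpmul2r; first exact: integral_ge0.
  rewrite lee_fin ler_pM2l//.
  have k0 : 0 < k.+1%:R / 2 ^+ j :> R by rewrite divr_gt0 ?exprn_gt0.
  rewrite -[alpha - gam]opprK !(powRN _ (- (alpha - gam))) lef_pV2 ?posrE ?powR_gt0//.
  by apply: ge0_ler_powR; rewrite ?nnegrE ?oppr_ge0 ?(ltW k0) ?(ltW t0).
pose F j y : \bar R := ((G x) \_ (ellipsoid rho x (dyad t j))) y.
have mF j : measurable_fun setT (F j).
  apply/(measurable_restrictT _ _).1; first exact: (measurable_ellipsoid qd).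
  exact: measurable_funTS.
have F0 j y : (0 <= F j y)%E by rewrite /F patchE; case: ifP.
have fat := fatou mu measurableT mF (fun j y _ => F0 j y).
apply: (@le_trans _ _ (\int[mu]_y limn_einf (F ^~ y))%E).
  rewrite integral_mkcond; apply: le_integral_nonmeas => y _.
    by rewrite patchE; case: ifP.
  rewrite patchE; case: ifPn => [/set_mem /= yt|_]; apply: limn_einf_ge; last exact: nearW.
  near=> j; rewrite /F patchE mem_set//.
  by rewrite /ellipsoid /=; near: j; exact: dyad_gt.
apply: (le_trans fat); apply: limn_einf_le => j.
by rewrite /F -integral_mkcond.
Unshelve. all: by end_near. Qed.

(** On the ball of radius [t] the factor [t^(alpha - gam)], of negative exponent, is at most
    [rho(x - y)^(alpha - gam)]; so each average is below [A] times the potential. *)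
Lemma maximal_op_le (f : 'cV[R]_n -> \bar R) :
  {ae mu, forall x, `|f x|%E = (f0 x)%:E} ->
  ae_measurable mu (maximal_op rho P Omega alpha f) /\
  forall x, (`|maximal_op rho P Omega alpha f x| <=
    A%:E * potential P rho g alpha f0 x)%E.
Proof.
move=> ff0.
have opE x : maximal_op rho P Omega alpha f x = ereal_sup [set M x t | t in [set t : R | 0 < t]].
  congr (ereal_sup _); apply/seteqP.
  suff E t : 0 < t -> (mu (ellipsoid rho x t) `^ (- 1 + alpha / gam) *
      \int[mu]_(y in ellipsoid rho x t) (`|Omega (x - y)|%:E * `|f y|) = M x t)%E.
    by split => z /= [t t0 <-]; exists t => //; rewrite E.
  move=> t0; rewrite /M; congr (_ * _)%E.
    have -> := ellipsoid_measure qd x t0.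
    rewrite -[X in (_ * X)%E]fineK; last by rewrite ge0_fin_numE//; exact: (rho_ball_fin qd).
    rewrite -EFinM poweR_EFin powRM ?powR_ge0 ?fine_ge0// mulrC -powRrM; congr (_ * _ `^ _)%:E.
    by field; rewrite gt_eqF.
  rewrite integral_mkcond [RHS]integral_mkcond; apply: ae_eq_integralT.
  apply: (filterS2 _ _ (ae_reflect x Og) ff0) => y Oy fy.
  by rewrite !patchE; case: ifP => // _; rewrite /G Oy fy EFinM.
split.
  exists (maximal_op rho P Omega alpha f); last exact: aeW.
  have -> : maximal_op rho P Omega alpha f = sup_M.
    apply/funext => x; rewrite opE; apply/eqP; rewrite eq_le; apply/andP; split.
      by apply: ge_ereal_sup => _ [t /= t0 <-]; exact: M_le_sup.
    apply: ge_ereal_sup => _ [j _ <-]; apply: ge_ereal_sup => _ [k _ <-].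
    by apply: ereal_sup_ubound; exists (k.+1%:R / 2 ^+ j) => //=.
  have supE (u : (\bar R)^nat) : ereal_sup (range u) = esups u 0.
    by congr (ereal_sup _); apply/seteqP; split => _ [k _ <-]; exists k.
  rewrite (_ : sup_M = fun x => esups (fun j => esups (fun k : nat =>
    M x (k.+1%:R / 2 ^+ j)) 0) 0); last first.
    by apply/funext => x; rewrite /sup_M supE; congr (esups _ _); apply/funext => j; rewrite supE.
  apply: (measurable_fun_esups (f := fun j x => esups (fun k : nat =>
    M x (k.+1%:R / 2 ^+ j)) 0)) => j.
  by apply: (measurable_fun_esups (f := fun k x => M x (k.+1%:R / 2 ^+ j))) => k.
move=> x; rewrite opE gee0_abs; last first.
  by apply: (le_trans (M0 x 1)); apply: ereal_sup_ubound; exists 1 => //=.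
apply: ge_ereal_sup => _ [t /= t0 <-].
rewrite /M EFinM -muleA; apply: lee_wpmul2l; first by rewrite lee_fin ltW.
rewrite -ge0_integralZl//; last 3 first.
- exact: (measurable_ellipsoid qd).
- exact: measurable_funTS.
- by rewrite lee_fin powR_ge0.
rewrite integral_mkcond; apply: ae_le_integralT.
- by move=> y; rewrite patchE; case: ifP => // _; rewrite mule_ge0// lee_fin powR_ge0.
- by move=> y; rewrite lee_fin mulr_ge0// kernel_ge0.
(* At [y = x] the kernel is 0 by convention, and the comparison may fail there. *)
apply: filterS (ae_reflect x ae_neq0) => y /(rho_gt0 qd) rxy.
rewrite patchE; case: ifPn => [/set_mem/= yt|_]; last by rewrite lee_fin mulr_ge0// kernel_ge0.
rewrite /G -EFinM lee_fin /kernel mulrA ler_wpM2r// mulrC ler_wpM2l//.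
rewrite -[alpha - gam]opprK !(powRN _ (- (alpha - gam))) lef_pV2 ?posrE ?powR_gt0//.
apply: ge0_ler_powR; rewrite ?nnegrE ?oppr_ge0 ?(ltW rxy) ?(ltW t0) ?(ltW yt)//.
by case/andP: al => _ ?; rewrite subr_le0 ltW.
Qed.

End maximal.
End operators.

Lemma conjugate_le (R : realType) (s : \bar R) (p : R) : 1 < p -> (1 < s)%E ->
  (hoelder_conjugate s < p%:E)%E -> ((p / (p - 1))%:E <= s)%E.
Proof.
move=> p1; case: s => [s| |]//; last by rewrite leey.
rewrite lte_fin => s1; have s0 : 0 < s - 1 by rewrite subr_gt0.
have p0 : 0 < p - 1 by rewrite subr_gt0.
have -> : (hoelder_conjugate s%:E = (s / (s - 1))%:E)%E.
  rewrite /hoelder_conjugate /= eqe gt_eqF ?(lt_trans ltr01 s1)//.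
  by rewrite -EFinB inver gt_eqF.
rewrite lte_fin lee_fin ltr_pdivrMr// ler_pdivrMr// => h.
by rewrite ltW//; lra.
Qed.

Theorem corollary4 (R : realType) (n : nat) (P : 'M[R]_n)
    (rho Omega : 'cV[R]_n -> R) (s : \bar R) (alpha p q lam : R) :
  (2 <= n)%N ->
  eigenvalues_Re_gt0 P ->
  quasi_distance P rho ->
  (1 < s)%E ->
  ae_measurable (@lebesgue_cv R n) Omega ->
  homogeneous0 P Omega ->
  Lsphere s Omega ->
  0 < alpha < \tr P ->
  1 < p < \tr P / alpha ->
  (hoelder_conjugate s < p%:E)%E ->
  p < q ->
  0 < lam < \tr P - alpha * p ->
  p^-1 - q^-1 = alpha / (\tr P - lam) ->
  morrey_bounded rho p q lam (maximal_op rho P Omega alpha) /\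
  morrey_bounded rho p q lam (integral_op rho P Omega alpha).
Proof.
move=> _ _ qd s1 [g mg Og] hom [[h mh Oh] Ns] al /andP[p1 _] sp pq /andP[_ lamg] pq_eq.
have p0 : 0 < p by exact: lt_trans p1.
have q0 : 0 < q by exact: lt_trans pq.
(* Exponent 1 serves the integrals of the kernel itself; the exponent [p / (p - 1)] below serves
   Hoelder's inequality. *)
have [W W0 HW] := shell_integral_le qd hom mg mh Og Oh s1 ltr01 (ltW s1) Ns.
have {}HW (t : R) : 0 < t ->
    (\int[@lebesgue_cv R n]_(x in shell rho t) `|g x|%:E <= (W * t `^ \tr P)%:E)%E.
  move=> t0; apply: le_trans (HW t t0); rewrite le_eqVlt; apply/orP; left; apply/eqP.
  by apply: eq_integral => x _; rewrite powRr1.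
have pp0 : 0 < p / (p - 1) by rewrite divr_gt0// subr_gt0.
have [W' W'0 HW'] := shell_integral_le qd hom mg mh Og Oh s1 pp0 (conjugate_le p1 s1 sp) Ns.
have [C C0 HC] := potential_morrey_le qd mg al p1 pq lamg pq_eq W0 W'0 HW HW'.
split.
  apply: (morrey_bounded_of_potential qd mg p0 q0 C0 HC
    (A := fine (@lebesgue_cv R n [set x | rho x < 1]) `^ (-1 + alpha / \tr P))).
    by rewrite powR_gt0// fine_gt0// (rho_ball_gt0 qd) (rho_ball_fin qd).
  by move=> f f0 _ mf0 f00 ff0; exact: (maximal_op_le qd mg Og al mf0 f00 ff0).
apply: (morrey_bounded_of_potential qd mg p0 q0 C0 HC ltr01) => f f0 mf mf0 f00 ff0.
exact: (@integral_op_le _ _ _ _ qd _ _ alpha mg Og f f0 mf mf0 f00 ff0).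
Qed.
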